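(* Let $\eta>2$, $\lambda>0$, $\rho>0$, $P_u^{(m)}>0$, $P_b>0$, $\beta\ge 0$, $\sigma_n^2\ge 0$, $\omega_1\in\mathbb{R}$, $\omega_2>0$, and let $a_u,a_d\ge 0$ be the constants defined in the context. Let $F(x):={}_2F_1\!\left(1,1-\tfrac{2}{\eta};2-\tfrac{2}{\eta};x\right)$ and $r_{\max}=(P_u^{(m)}/\rho)^{1/\eta}$. In the uplink and downlink models described in the context: (Uplink) $$\mathrm{BER}_{UL}=\omega_1-\int_0^\infty \frac{\omega_1}{\sqrt{\pi z}}\exp\!\Bigg(-\frac{2\pi\lambda}{\eta-2}\,\frac{z}{\omega_2}\,\rho^{-2/\eta}\,\mathbb{E}\!\left[P_u^{2/\eta}\right]F\!\left(-\frac{z}{\omega_2}\right)-\frac{2\pi^2\lambda}{\eta}\left(\frac{z P_b a_u}{\omega_2\rho}\right)^{2/\eta}\csc\!\left(\frac{2\pi}{\eta}\right)-z\left(1+\frac{\beta P_b a_u}{\omega_2\rho}+\frac{\sigma_n^2}{\omega_2\rho}\right)\Bigg)dz .$$ (Downlink) $$\mathrm{BER}_{DL}=\omega_1-\int_0^\infty\!\int_0^{r_{\max}}\frac{\omega_1 f_R(r)}{\sqrt{\pi z}}\exp\!\Bigg(-z\left(1+\frac{\beta\rho a_d r^{2\eta}}{\omega_2P_b}+\frac{\sigma_n^2 r^{\eta}}{\omega_2P_b}\right)-\frac{2\pi\lambda z\, a_d\,\mathbb{E}\!\left[P_u^{2/\eta}\right]\rho^{1-2/\eta}r^{\eta}}{\omega_2(\eta-2)P_b}F\!\left(-\frac{z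 a_d\rho r^{\eta}}{\omega_2P_b}\right)-\frac{2\pi\lambda r^2 z}{(\eta-2)\omega_2}F\!\left(-\frac{z}{\omega_2}\right)\Bigg)dr\,dz,$$ where $$\mathbb{E}\!\left[P_u^{2/\eta}\right]=\frac{\rho^{2/\eta}\,\gamma\!\left(2,\ \pi\lambda r_{\max}^2\right)}{\pi\lambda\left(1-e^{-\pi\lambda r_{\max}^2}\right)}$$ and $\gamma(\cdot,\cdot)$ is the lower incomplete gamma function.
   Context: Model (single-tier cellular network with truncated channel-inversion uplink power control and $\alpha$-duplexing). Fix $\eta>2$ (path-loss exponent), $\lambda>0$ (BS intensity), $\rho>0$ (power-control target), $P_u^{(m)}>0$ (max UE power), $P_b>0$ (BS power), $\beta\ge0$ (residual self-interference attenuation), $\sigma_n^2\ge0$ (noise variance), and modulation constants $\omega_1\in\mathbb R$, $\omega_2>0$. Let $r_{\max}=(P_u^{(m)}/\rho)^{1/\eta}$ and let $f_R$ be the density $$f_R(r)=\frac{2\pi\lambda r e^{-\pi\lambda r^2}}{1-e^{-\pi\lambda r_{\max}^2}}\mathbf 1_{\{0\le r\le r_{\max}\}}.$$ A random variable $P_u$ (the transmit power of an active UE) is defined as $P_u=\rho R^{\eta}$ with $R$ having density $f_R$. Interference factors: for the overlap parameter $\alpha\in[0,1]$ and pulse spectra $S_u,S_d$ (uplink/downlink, with bandwidths $B_u,B_d$, $B=\min(B_u,B_d)$, center frequencies $f_u,f_d$ with $f_d-f_u=\frac{B_u+B_d}{2}-\alpha B$), define for $a,b\in\{u,d\}$: $\mathcal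 I^{(a)}_b(\alpha)=\int_{-(B_a+\alpha B)/2}^{(B_a+\alpha B)/2}S_b(f-f_b+f_a)S_a^*(f)\,df$. Set $a_u:=|\mathcal I^{(u)}_d(\alpha)|^2$ and $a_d:=|\mathcal I^{(d)}_u(\alpha)|^2$; for the statements these are simply fixed nonnegative constants (the self-interference factors equal these cross-mode factors). Uplink model: the test BS is at the origin. $\Psi$ and $\Phi$ are independent homogeneous Poisson point processes on $\mathbb R^2$ of intensity $\lambda$ (interfering BSs and interfering UEs). Each $y\in\Phi$ carries an independent mark $P_y$ distributed as $P_u$. All fading gains $h_x$ ($x\in\Psi$), $h_y$ ($y\in\Phi$) and $h_o$ are i.i.d. exponential with mean 1, independent of everything else. Define $$I_u=\sum_{x\in\Psi}\frac{P_b a_u h_x\|x\|^{-\eta}}{\rho}+\sum_{y\in\Phi}\mathbf 1\{P_y\|y\|^{-\eta}<\rho\}\frac{P_y h_y\|y\|^{-\eta}}{\rho},\quad \mathrm{SINR}_u=\frac{h_o}{I_u+\frac{\beta P_b a_u}{\rho}+\frac{\sigma_n^2}{\rho}},$$ and $\mathrm{BER}_{UL}=\mathbb E\big[\omega_1\,\mathrm{erfc}(\sqrt{\omega_2\,\mathrm{SINR}_u})\big]$. Downlink model: the test UE is at the origin and its serving BS is at distance $r_o$ with density $f_R$. Conditionally on $r_o$, the interfering BSs form a homogeneous PPP $\Psi$ of intensity $\lambda$ on $\{x:\|x\|>r_o\}$; $\Phi$ is an independent homogeneous PPP of intensity $\lambda$ on $\mathbb R^2$ of interfering UEs with i.i.d.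 marks $P_y\sim P_u$; fading gains are i.i.d. $\mathrm{Exp}(1)$ and independent of everything else. Define $$I_d=\sum_{x\in\Psi,\ \|x\|>r_o}\frac{h_x\|x\|^{-\eta}}{r_o^{-\eta}}+\sum_{y\in\Phi}\mathbf 1\{P_y\|y\|^{-\eta}<\rho\}\frac{a_d P_y h_y\|y\|^{-\eta}}{P_b r_o^{-\eta}},\quad \mathrm{SINR}_d=\frac{h_o}{I_d+\frac{\beta\rho a_d r_o^{2\eta}}{P_b}+\frac{\sigma_n^2 r_o^{\eta}}{P_b}},$$ and $\mathrm{BER}_{DL}=\mathbb E\big[\omega_1\,\mathrm{erfc}(\sqrt{\omega_2\,\mathrm{SINR}_d})\big]$ (expectation over $r_o$, the point processes, marks and fading). *)

(* Defs.v *)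
From HB Require Import structures.
From mathcomp Require Import all_boot all_order all_algebra.
From mathcomp Require Import all_classical all_reals all_analysis.

Set Implicit Arguments.
Unset Strict Implicit.
Unset Printing Implicit Defensive.

Import Order.TTheory GRing.Theory Num.Def Num.Theory.

Local Open Scope classical_set_scope.
Local Open Scope ring_scope.

Section special_functions.
Context {R : realType}.
Notation mu := (@lebesgue_measure R).

Definition Gammaf (s : R) : R :=
  Rintegral mu `]0, +oo[ (fun t => t `^ (s - 1) * expR (- t)).

Definition lower_gamma (s x : R) : R :=
  Rintegral mu `]0, x[ (fun t => t `^ (s - 1) * expR (- t)).

(* Gauss hypergeometric function 2F1(a,b;c;x), given (for c > b > 0 and
   x < 1, the only regime used here) by Euler's integral representation,
   i.e. the analytic continuation of the hypergeometric series (DLMF 15.6.1). *)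
Definition hyp2F1 (a b c x : R) : R :=
  Gammaf c / (Gammaf b * Gammaf (c - b)) *
  Rintegral mu `]0, 1[
    (fun t => t `^ (b - 1) * (1 - t) `^ (c - b - 1) * (1 - x * t) `^ (- a)).

Definition erfc (x : R) : R :=
  2 / Num.sqrt pi * Rintegral mu `[x, +oo[ (fun t => expR (- (t ^+ 2))).

Definition csc (x : R) : R := (sin x)^-1.

Definition Fhyp (eta x : R) : R := hyp2F1 1 (1 - 2 / eta) (2 - 2 / eta) x.

End special_functions.

Section model_constants.
Context {R : realType}.
Notation mu := (@lebesgue_measure R).

Definition norm2 (p : R * R) : R := Num.sqrt (p.1 ^+ 2 + p.2 ^+ 2).

Definition rmax (Pum rho eta : R) : R := (Pum / rho) `^ (eta^-1).

Definition fR (lam rmx : R) (r : R) : R :=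
  if (0 <= r) && (r <= rmx) then
    2 * pi * lam * r * expR (- (pi * lam * r ^+ 2)) /
      (1 - expR (- (pi * lam * rmx ^+ 2)))
  else 0.

(* E[P_u^(2/eta)] where P_u = rho R^eta and R has density f_R *)
Definition EPu (eta lam rho rmx : R) : R :=
  Rintegral mu `[0, rmx] (fun r => (rho * r `^ eta) `^ (2 / eta) * fR lam rmx r).

End model_constants.

Section probability_defs.
Context {R : realType} {d : measure_display} {Omega : measurableType d}.
Variable P : probability Omega R.
Notation mu := (@lebesgue_measure R).

Definition has_density (X : Omega -> R) (f : R -> R) : Prop :=
  measurable_fun setT X /\
  forall B : set R, measurable B ->
    P (X @^-1` B) = (\int[mu]_(x in B) (f x)%:E)%E.

Definition sigma_of {d' : measure_display} {T : measurableType d'}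
  (X : Omega -> T) : set (set Omega) :=
  <<s [set X @^-1` B | B in measurable] >>.

Definition sigma_of_seq {d' : measure_display} {T : measurableType d'}
  (X : nat -> Omega -> T) : set (set Omega) :=
  <<s \bigcup_n [set X n @^-1` B | B in measurable] >>.

Definition mutually_independent {I : eqType} (F : I -> set (set Omega)) : Prop :=
  forall (J : seq I) (A : I -> set Omega),
    uniq J -> (forall i, i \in J -> F i (A i)) ->
    P (\big[setI/setT]_(i <- J) A i) = (\prod_(i <- J) P (A i))%E.

(* A point process on R^2 represented by an enumeration of its points
   X 0, X 1, ... ; number of points in B *)
Definition count (X : nat -> Omega -> R * R) (B : set (R * R)) (w : Omega)
  : \bar R := (\sum_(0 <= n <oo) (\1_B (X n w) : R)%:E)%E.

Definition area2 (B : set (R * R)) : \bar R := (mu \x mu)%E B.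

Definition bounded2 (B : set (R * R)) : Prop :=
  exists M : R, forall p, B p -> `|p.1| <= M /\ `|p.2| <= M.

Definition poisson_mass (m : R) (k : nat) : R := expR (- m) * m ^+ k / k`!%:R.

Definition is_PPP (lam : R) (X : nat -> Omega -> R * R) : Prop :=
  (forall n, measurable_fun setT (X n)) /\
  (forall B, measurable B -> bounded2 B -> forall k : nat,
     P [set w | count X B w = (k%:R)%:E] =
       (poisson_mass (lam * fine (area2 B)) k)%:E) /\
  (forall (m : nat) (B : nat -> set (R * R)) (k : nat -> nat),
     (forall i, (i < m)%N -> measurable (B i) /\ bounded2 (B i)) ->
     (forall i j, (i < m)%N -> (j < m)%N -> i != j -> B i `&` B j = set0) ->
     P (\bigcap_(i < m) [set w | count X (B i) w = ((k i)%:R)%:E]) =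
       (\prod_(i < m) P [set w | count X (B i) w = ((k i)%:R)%:E])%E).

End probability_defs.

Inductive idx := iPsi | iPhi | iMark of nat | iHx of nat | iHy of nat | iHo | iRo.

Definition idx_eqb (a b : idx) : bool :=
  match a, b with
  | iPsi, iPsi | iPhi, iPhi | iHo, iHo | iRo, iRo => true
  | iMark m, iMark n | iHx m, iHx n | iHy m, iHy n => (m == n)%N
  | _, _ => false
  end.

Lemma idx_eqP : Equality.axiom idx_eqb.
Proof.
by case=> [||m|m|m||] [||n|n|n||] /=; try (by constructor);
  apply: (iffP eqP) => [->|[]].
Qed.

HB.instance Definition _ := hasDecEq.Build idx idx_eqP.

Section model.
Context {R : realType} {d : measure_display} {Omega : measurableType d}.
Variable P : probability Omega R.

(* The family of sigma-algebras: interfering BS process Psi, interfering UE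
   process Phi, the i.i.d. radii R_y defining the marks P_y = rho R_y^eta,
   fadings h_x, h_y, h_o, and (downlink only) the serving distance r_o. *)
Definition model_family (Psi Phi : nat -> Omega -> R * R)
  (Ry hx hy : nat -> Omega -> R) (ho ro : Omega -> R) : idx -> set (set Omega) :=
  fun i => match i with
  | iPsi => sigma_of_seq Psi
  | iPhi => sigma_of_seq Phi
  | iMark n => sigma_of (Ry n)
  | iHx n => sigma_of (hx n)
  | iHy n => sigma_of (hy n)
  | iHo => sigma_of ho
  | iRo => sigma_of ro
  end.

Definition base_model (eta lam rho Pum : R) (Psi Phi : nat -> Omega -> R * R)
  (Ry hx hy : nat -> Omega -> R) (ho ro : Omega -> R) : Prop :=
  is_PPP P lam Psi /\ is_PPP P lam Phi /\
  (forall n, has_density P (Ry n) (fR lam (rmax Pum rho eta))) /\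
  (forall n, has_density P (hx n) (exponential_pdf 1)) /\
  (forall n, has_density P (hy n) (exponential_pdf 1)) /\
  has_density P ho (exponential_pdf 1) /\
  mutually_independent P (model_family Psi Phi Ry hx hy ho ro).

Definition ul_model eta lam rho Pum Psi Phi Ry hx hy ho : Prop :=
  base_model eta lam rho Pum Psi Phi Ry hx hy ho (fun _ => 0).

(* Downlink: Psi is a PPP on all of R^2 independent of r_o; the interfering
   BSs are its points outside the ball of radius r_o, which conditionally on
   r_o is a PPP of intensity lam on {x : |x| > r_o}. *)
Definition dl_model eta lam rho Pum Psi Phi Ry hx hy ho ro : Prop :=
  base_model eta lam rho Pum Psi Phi Ry hx hy ho ro /\
  has_density P ro (fR lam (rmax Pum rho eta)).

Definition sinr (h : R) (I : \bar R) (c : R) : R :=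
  if I is r%:E then h / (r + c) else 0.

Definition Pmark (rho eta : R) (Ry : nat -> Omega -> R) n w : R :=
  rho * Ry n w `^ eta.

Definition I_u (eta rho Pb au : R) (Psi Phi : nat -> Omega -> R * R)
  (Ry hx hy : nat -> Omega -> R) (w : Omega) : \bar R :=
  (\sum_(0 <= n <oo) (Pb * au * hx n w * norm2 (Psi n w) `^ (- eta) / rho)%:E +
   \sum_(0 <= n <oo)
     (if Pmark rho eta Ry n w * norm2 (Phi n w) `^ (- eta) < rho
      then Pmark rho eta Ry n w * hy n w * norm2 (Phi n w) `^ (- eta) / rho
      else 0)%:E)%E.

Definition SINR_u (eta rho Pb au beta sigma2 : R) Psi Phi Ry hx hy ho w : R :=
  sinr (ho w) (I_u eta rho Pb au Psi Phi Ry hx hy w)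
       (beta * Pb * au / rho + sigma2 / rho).

Definition BER_UL (eta rho Pb au beta sigma2 om1 om2 : R) Psi Phi Ry hx hy ho
  : \bar R :=
  (\int[P]_w (om1 * erfc (Num.sqrt (om2 *
       SINR_u eta rho Pb au beta sigma2 Psi Phi Ry hx hy ho w)))%:E)%E.

Definition I_d (eta rho Pb ad : R) (Psi Phi : nat -> Omega -> R * R)
  (Ry hx hy : nat -> Omega -> R) (ro : Omega -> R) (w : Omega) : \bar R :=
  (\sum_(0 <= n <oo)
     (if ro w < norm2 (Psi n w)
      then hx n w * norm2 (Psi n w) `^ (- eta) / ro w `^ (- eta)
      else 0)%:E +
   \sum_(0 <= n <oo)
     (if Pmark rho eta Ry n w * norm2 (Phi n w) `^ (- eta) < rho
      then ad * Pmark rho eta Ry n w * hy n w * norm2 (Phi n w) `^ (- eta)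
             / (Pb * ro w `^ (- eta))
      else 0)%:E)%E.

Definition SINR_d (eta rho Pb ad beta sigma2 : R) Psi Phi Ry hx hy ho ro w : R :=
  sinr (ho w) (I_d eta rho Pb ad Psi Phi Ry hx hy ro w)
       (beta * rho * ad * ro w `^ (2 * eta) / Pb + sigma2 * ro w `^ eta / Pb).

Definition BER_DL (eta rho Pb ad beta sigma2 om1 om2 : R) Psi Phi Ry hx hy ho ro
  : \bar R :=
  (\int[P]_w (om1 * erfc (Num.sqrt (om2 *
       SINR_d eta rho Pb ad beta sigma2 Psi Phi Ry hx hy ho ro w)))%:E)%E.

End model.

(* Main.v *)
(** For an exponential variable [h] of mean 1 and [Y > 0], Tonelli gives
    [E (1 - erfc (sqrt (om2 h / Y))) =
       int_0^oo (pi z)^(-1/2) exp (- z (1 + Y / om2)) dz],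
    so that, after integrating out the desired signal, each error rate is an
    integral of the Laplace transform of interference plus noise.  Conditionally on
    the serving distance the interference is a functional of two independent marked
    Poisson processes.  Integrating out the exponential fadings turns each
    point [x] into a factor [G x = E (1 / (1 + s b x))], and the Laplace functional of
    a Poisson process of intensity [lam] evaluates the expected product as
    [exp (- lam int (1 - G))].  In polar coordinates these area integrals reduce to
    [int_0^oo t^(a - 1) / (1 + t) dt = pi / sin (pi a)] when all of the plane
    contributes, and to Euler's integral for [2F1 (1, 1 - 2/eta; 2 - 2/eta; - s)] when
    a disk is excluded; averaging the squared radius of that disk over the mark
    produces [E P_u^(2/eta)]. *)

Require Import Defs.
From HB Require Import structures.
From mathcomp Require Import all_boot all_order all_algebra.
From mathcomp Require Import all_classical all_reals all_analysis.
From mathcomp Require Import measurable_realfun ring lra.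

Set Implicit Arguments.
Unset Strict Implicit.
Unset Printing Implicit Defensive.

Import Order.TTheory GRing.Theory Num.Def Num.Theory.
Import numFieldNormedType.Exports.
Local Open Scope classical_set_scope.
Local Open Scope ring_scope.

(** The main obstacle is that [is_PPP] gives no law for the individual points of the enumeration: it
    only describes joint counts on bounded disjoint regions. The Laplace functional is therefore a
    limit over the first N points: generating functions of counts settle simple functions of bounded
    support, and a squeeze settles the rest. Fadings, marks and then each whole process are
    integrated out by independence at a fixed N.

    Almost sure finiteness of the interference is never proved. An infinite interference has SINR 0,
    [erfc 0 = 1] and Laplace weight 0, so the bounded quantity 1 - erfc agrees with the formula
    there too. What has to be excluded is zero interference, since the SINR denominator would be 0
    when noise and self-interference vanish. A distant point is almost surely present and makes the
    sum positive; it is a user in the uplink and a base station in the downlink, because [au] and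
    [ad] may be 0.

    Fadings enter through their absolute values, which makes every sum nonnegative everywhere and
    changes nothing almost surely. *)

Section measurable_inverse.
Context (R : realType).

(** Powers are measurable, so inversion is cut into a power on each open half line and the value 0
    at 0. *)
Lemma measurable_invr : measurable_fun setT (fun x : R => x^-1).
Proof.
rewrite (_ : (fun x => _) = fun x : R => if 0 < x then x `^ (-1) else
    if x < 0 then - ((- x) `^ (-1)) else 0); last first.
  apply/funext => x; case: ltgtP => [x0|x0|<-]; last by rewrite invr0.
    by rewrite powR_inv1// ltW.
  by rewrite powR_inv1 ?oppr_ge0 ?(ltW x0)// invrN opprK.
apply: measurable_fun_ifT; first exact: measurable_fun_ltr.
  exact: measurable_powR.
apply: measurable_fun_ifT; [exact: measurable_fun_ltr| |exact: measurable_cst].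
apply: measurable_funN; apply: (measurableT_comp (f := fun x : R => x `^ (-1))).
  exact: measurable_powR.
exact: measurable_funN.
Qed.

Lemma measurable_funV d (T : measurableType d) (D : set T) (f : T -> R) :
  measurable_fun D f -> measurable_fun D (fun x => (f x)^-1).
Proof. exact: (measurableT_comp measurable_invr). Qed.

End measurable_inverse.

(** * Measures with a density and comparison of measures on the half line *)

Section density_measure.
Context d (T : measurableType d) (R : realType).
Variables (m : {measure set T -> \bar R}) (w : T -> R).
Hypotheses (mw : measurable_fun setT w) (w0 : forall x, 0 <= w x).
Local Open Scope ereal_scope.

(** The two proofs are arguments so that the measure structure, which depends on them, can be
    declared on the constant itself. *)
Definition density_measure of measurable_fun setT w & (forall x, 0 <= w x)%R :=
  fun A : set T => \int[m]_(x in A) (w x)%:E.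

Local Notation nu := (density_measure mw w0).

Let nu0 : nu set0 = 0. Proof. exact: integral_set0. Qed.

Let nu_ge0 A : 0 <= nu A.
Proof. by apply: integral_ge0 => x _; rewrite lee_fin. Qed.

Let nu_sigma_additive : semi_sigma_additive nu.
Proof.
apply: semi_sigma_additive_nng_induced => [|x]; first exact/measurable_EFinP.
by rewrite lee_fin.
Qed.

HB.instance Definition _ :=
  isMeasure.Build _ _ _ nu nu0 nu_ge0 nu_sigma_additive.

Import HBNNSimple.

Let integral_density_nnsfun (D : set T) (mD : measurable D)
    (f : {nnsfun T >-> R}) :
  \int[nu]_(x in D) (f x)%:E = \int[m]_(x in D) ((f x)%:E * (w x)%:E).
Proof.
have f1 r : measurable (f @^-1` [set r]) by exact: measurable_funPTI.
under [LHS]eq_integral do rewrite fimfunE -fsumEFin//.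
rewrite ge0_integral_fsum//; last 2 first.
- by move=> y; exact/measurable_EFinP/measurable_funM.
- by move=> y x _; rewrite nnfun_muleindic_ge0.
under [RHS]eq_integral.
  move=> x _; rewrite fimfunE -fsumEFin// ge0_mule_fsuml; last first.
    by move=> y; rewrite nnfun_muleindic_ge0.
  over.
rewrite ge0_integral_fsum//; last 2 first.
- move=> y; apply: emeasurable_funM; last exact/measurable_EFinP/measurable_funTS.
  by apply/measurable_EFinP; apply: measurable_funM; [exact: measurable_cst|exact: measurable_indic].
- move=> y x _; apply: mule_ge0; last by rewrite lee_fin.
  exact: nnfun_muleindic_ge0.
apply: eq_fsbigr => r; rewrite inE => -[t _ <-{r}]; set r := f t.
have r0 : (0 <= r)%R by exact: fun_ge0.
rewrite integralZl_indic_nnsfun// integral_indic//=.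
under [RHS]eq_integral do rewrite EFinM -muleA.
rewrite ge0_integralZl_EFin//; last 2 first.
- by move=> x _; rewrite mule_ge0 ?lee_fin.
- apply: emeasurable_funM; last exact/measurable_EFinP/measurable_funTS.
  exact/measurable_EFinP.
congr (_ * _); rewrite /density_measure setIC integral_mkcondr.
apply: eq_integral => x xD; rewrite patchE indicE.
by case: ifPn => // _; rewrite ?mul1e ?mul0e.
Qed.

Lemma integral_density (D : set T) (f : T -> \bar R) :
  measurable D -> measurable_fun D f -> (forall x, D x -> 0 <= f x) ->
  \int[nu]_(x in D) f x = \int[m]_(x in D) (f x * (w x)%:E).
Proof.
move=> mD mf f0; pose f_ := nnsfun_approx mD mf.
transitivity (limn (fun n => \int[nu]_(x in D) (f_ n x)%:E)).
  rewrite -monotone_convergence//.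
  - apply: eq_integral => y /[!inE] yD; apply/esym/cvg_lim => //.
    exact: cvg_nnsfun_approx.
  - by move=> n; exact/measurable_EFinP/measurable_funTS.
  - by move=> n y _; rewrite lee_fin.
  - by move=> y _ k n kn; rewrite lee_fin; exact/lefP/nd_nnsfun_approx.
under eq_fun do rewrite integral_density_nnsfun//.
rewrite -monotone_convergence//.
- apply: eq_integral => y /[!inE] yD; apply/cvg_lim => //.
  by apply: cvgeZr => //; exact: cvg_nnsfun_approx.
- move=> n; apply: emeasurable_funM; last exact/measurable_EFinP/measurable_funTS.
  exact/measurable_EFinP/measurable_funTS.
- by move=> n y _; rewrite mule_ge0 ?lee_fin.
- move=> y _ k n kn; apply: lee_wpmul2r; first by rewrite lee_fin.
  by rewrite lee_fin; exact/lefP/nd_nnsfun_approx.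
Qed.
End density_measure.

Section half_line.
Context (R : realType).
Local Open Scope ereal_scope.
Implicit Types m : {measure set (measurableTypeR R) -> \bar R}.

(** Both measures may be infinite near 0, as with the density t^(p-1) for negative p, and near
    infinity. Uniqueness is therefore applied to their restrictions to intervals bounded away from
    both ends. *)
Lemma eq_measure_half_line m1 m2 :
  (forall a b : R, (0 < a)%R -> (a < b)%R -> m1 `]a, b]%classic = m2 `]a, b]%classic) ->
  (forall a b : R, (0 < a)%R -> (a < b)%R -> m1 `]a, b]%classic < +oo) ->
  forall B : set (measurableTypeR R),
    measurable B -> B `<=` `]0%R, +oo[%classic -> m1 B = m2 B.
Proof.
move=> m12 m1oo B mB B0.
(* Half-open like the generators []a, b]], so that intersecting a generator with [D n] gives a
   generator or the empty set. *)
pose D n : set (measurableTypeR R) := `]n.+1%:R^-1%R, n.+1%:R]%classic.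
have mD n : measurable (D n) by exact: measurable_itv.
have DI n (a b : R) : `]a, b]%classic `&` D n =
    `](Num.max a n.+1%:R^-1)%R, (Num.min b n.+1%:R)%R]%classic.
  apply/seteqP; split => x; rewrite /D /= !in_itv/= gt_max le_min.
    by move=> [/andP[-> ->] /andP[-> ->]].
  by move=> /andP[/andP[-> ->] /andP[-> ->]].
have DB n : m1 (B `&` D n) = m2 (B `&` D n).
  rewrite -[LHS]/(mrestr m1 (mD n) B) -[RHS]/(mrestr m2 (mD n) B).
  apply: (@measure_unique _ R (measurableTypeR R) (@ocitv R)
    (fun k : nat => `](- k%:R)%R, k%:R]%classic) _ _ _ _
    (mrestr m1 (mD n)) (mrestr m2 (mD n))) => //.
  - exact: ocitvI.
  - by move=> k; exact: is_ocitv.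
  - rewrite -subTset => x _ /=; exists (truncn `|x|).+1 => //=.
    have := truncnS_gt `|x|%R; rewrite in_itv/= ltr_norml => /andP[-> /ltW] //.
  - move=> _ [[a b] _ <-]; rewrite /= /mrestr DI.
    have [ab|ab] := ltP (Num.max a n.+1%:R^-1)%R (Num.min b n.+1%:R)%R.
      by apply: m12 => //; rewrite lt_max invr_gt0 ltr0n orbT.
    by rewrite set_itv_ge ?measure0// bnd_simp -leNgt.
  - move=> k; rewrite /= /mrestr DI.
    set a := Num.max _ _; set b := Num.min _ _.
    have [ab|ab] := ltP a b.
      by apply: m1oo => //; rewrite lt_max invr_gt0 ltr0n orbT.
    by rewrite set_itv_ge ?measure0// bnd_simp -leNgt.
have BE : B = \bigcup_n (B `&` D n).
  rewrite -setI_bigcupr setIidl// => x /B0; rewrite /= in_itv/= andbT => x0.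
  exists (maxn (truncn x^-1) (truncn x)) => //; rewrite /D/= in_itv/=; apply/andP; split.
    rewrite invf_plt ?posrE// ?ltr0n//.
    by rewrite (lt_le_trans (truncnS_gt _))// ler_nat ltnS leq_maxl.
  by rewrite ltW// (lt_le_trans (truncnS_gt _))// ler_nat ltnS leq_maxr.
have ndD : nondecreasing_seq (fun n => B `&` D n).
  move=> n k nk; apply/subsetPset; apply: setIS => x; rewrite /D /= !in_itv/=.
  move=> /andP[nx xn]; apply/andP; split.
    by rewrite (le_lt_trans _ nx)// lef_pV2 ?posrE ?ltr0n// ler_nat.
  by rewrite (le_trans xn)// ler_nat.
have cv m : m (B `&` D n) @[n --> \oo] --> m B.
  rewrite [in X in _ --> X]BE; apply: nondecreasing_cvg_mu => //.
    by move=> n; exact: measurableI.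
  by rewrite -BE.
have c1 := cv m1; rewrite (_ : (fun n => _) = fun n => m2 (B `&` D n)) in c1; last first.
  by apply/funext => n; exact: DB.
exact: cvg_unique c1 (cv m2).
Qed.

(* Both sides are integrals against measures on the half line; it suffices to
   compare the masses of bounded intervals. *)
Lemma integral_comp_half_line d (T : measurableType d)
    (m : {measure set T -> \bar R}) (phi : T -> R) (w : R -> R)
    (g : R -> \bar R) :
  measurable_fun setT phi -> measurable_fun setT w -> (forall r, 0 <= w r)%R ->
  (forall a b : R, (0 < a)%R -> (a < b)%R ->
    m (phi @^-1` `]a, b]) = \int[lebesgue_measure]_(r in `]a, b]) (w r)%:E) ->
  (forall a b : R, (0 < a)%R -> (a < b)%R -> m (phi @^-1` `]a, b]) < +oo) ->
  measurable_fun setT g -> (forall r, 0 <= g r) ->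
  \int[m]_(x in phi @^-1` `]0%R, +oo[) g (phi x) =
  \int[lebesgue_measure]_(r in `]0%R, +oo[) (g r * (w r)%:E).
Proof.
move=> mphi mw w0 E foo mg g0.
rewrite -[LHS](@ge0_integral_pushforward _ _ _ (measurableTypeR R) _ phi)//;
  last exact: measurable_funTS.
rewrite -[RHS](@integral_density _ _ _ lebesgue_measure _ mw w0)//;
  last exact: measurable_funTS.
by apply: eq_measure_integral => B mB B0; exact: eq_measure_half_line.
Qed.

End half_line.

(** * Power substitutions and polar coordinates *)

Section substitutions.
Context (R : realType).
Notation mu := (@lebesgue_measure R).

Lemma integral_powR_itv (p a b : R) : 0 < a -> a < b ->
  (\int[mu]_(t in `]a, b]) (p * t `^ (p - 1))%:E = (b `^ p - a `^ p)%:E)%E.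
Proof.
move=> a0 ab; rewrite integral_itv_obnd_cbnd; last first.
  by apply/measurable_EFinP; apply: measurable_funM => //;
    apply: measurable_funTS; exact: measurable_powR.
have cp (q x : R) : 0 < x -> {for x, continuous (fun t : R => t `^ q)}.
  move=> x0; apply: differentiable_continuous; apply/derivable1_diffP.
  by apply: derivable_powR; rewrite in_itv/= andbT.
have cq : {within `[a, b], continuous (fun t : R => p * t `^ (p - 1))}.
  apply: continuous_in_subspaceT => x; rewrite inE/= in_itv/= => /andP[ax _].
  apply: cvgM; first exact: cvg_cst.
  by apply: cp; exact: lt_le_trans ax.
rewrite (@continuous_FTC2 _ _ (fun t : R => t `^ p)) ?EFinB//.
- split.
  + move=> x; rewrite in_itv/= => /andP[ax _]; apply: derivable_powR.
    by rewrite in_itv/= andbT (lt_trans a0).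
  + by apply: cvg_at_right_filter; exact: cp.
  + by apply: cvg_at_left_filter; apply: cp; exact: lt_trans ab.
- move=> x; rewrite in_itv/= => /andP[ax _]; rewrite powR_derive1//.
  by rewrite in_itv/= andbT (lt_trans a0).
Qed.

Lemma integral_powR_subst (p : R) (g : R -> \bar R) : p != 0 ->
  measurable_fun setT g -> (forall r, 0 <= g r)%E ->
  (\int[mu]_(x in `]0%R, +oo[) g x =
   \int[mu]_(t in `]0%R, +oo[) (g (t `^ p)%R * (`|p| * t `^ (p - 1))%:E))%E.
Proof.
move=> p0 mg g0.
(* The inverse of the power map. The value 0 off the half line makes the preimage of []0, +oo[]
   exactly the half line, whatever the power returns at negative arguments. *)
pose phi (x : R) := if 0 < x then x `^ p^-1 else 0.
have phiP : phi @^-1` `]0%R, +oo[%classic = `]0%R, +oo[%classic.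
  apply/seteqP; split => x; rewrite /phi /= !in_itv/= !andbT.
    by case: ifPn => //; rewrite ltxx.
  by move=> x0; rewrite x0 powR_gt0.
transitivity (\int[mu]_(x in phi @^-1` `]0%R, +oo[) g (phi x `^ p)%R)%E.
  rewrite phiP; apply: eq_integral => x; rewrite inE/= in_itv/= andbT => x0.
  by rewrite /phi x0 -powRrM mulVf// powRr1// ltW.
have mphi : measurable_fun setT phi.
  have mlt : measurable_fun setT (fun x : R => 0 < x) by exact: measurable_fun_ltr.
  exact: (measurable_fun_ifT mlt (measurable_powR _) (measurable_cst _)).
have powp (a x : R) : 0 < a -> 0 < x -> (0 < p -> (a < x `^ p^-1) = (a `^ p < x))
    /\ (p < 0 -> (a < x `^ p^-1) = (x < a `^ p)).
  move=> a0 x0; have xp : x = (x `^ p^-1) `^ p by rewrite -powRrM mulVf// powRr1// ltW.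
  have y0 : 0 < x `^ p^-1 by rewrite powR_gt0.
  rewrite {2 4}xp; move: (x `^ p^-1) y0 => y y0; split => pp.
    apply/idP/idP; last by apply: contraTT; rewrite -!leNgt => /(ge0_ler_powR (ltW pp)); apply; rewrite nnegrE ltW.
    by move=> ay; apply: gt0_ltr_powR => //; rewrite nnegrE ltW.
  rewrite -[in RHS](opprK p) 2!(powRN _ (- p)) ltf_pV2 ?posrE ?powR_gt0//.
  have {}pp : 0 < - p by rewrite oppr_gt0.
  apply/idP/idP; last by apply: contraTT; rewrite -!leNgt => /(ge0_ler_powR (ltW pp)); apply; rewrite nnegrE ltW.
  by move=> ay; apply: gt0_ltr_powR => //; rewrite nnegrE ltW.
have mE (a b : R) : 0 < a -> a < b -> mu (phi @^-1` `]a, b]%classic) =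
    (`|b `^ p - a `^ p|)%:E.
  move=> a0 ab; have b0 := lt_trans a0 ab.
  have [pp|pp] : 0 < p \/ p < 0 by apply/orP; rewrite orbC -neq_lt.
    rewrite (_ : _ @^-1` _ = `](a `^ p), (b `^ p)]%classic); last first.
      apply/seteqP; split => x; rewrite /phi /= !in_itv/=.
        case: ifPn => x0; last by rewrite ltNge (ltW a0).
        rewrite (powp a x a0 x0).1// => /andP[-> /=].
        by rewrite !leNgt (powp b x b0 x0).1.
      move=> /andP[ax xb]; have x0 : 0 < x by rewrite (lt_trans _ ax)// powR_gt0.
      by rewrite x0 (powp a x a0 x0).1// ax/= leNgt (powp b x b0 x0).1// -leNgt.
    have ap : a `^ p < b `^ p by apply: gt0_ltr_powR => //; rewrite nnegrE ltW.
    by rewrite lebesgue_measure_itv/= lte_fin ap gtr0_norm ?subr_gt0// EFinB.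
  (* For negative [p] the order is reversed, so the closed end changes side; the length is still the
     absolute difference. *)
  rewrite (_ : _ @^-1` _ = `[(b `^ p), (a `^ p)[%classic); last first.
    apply/seteqP; split => x; rewrite /phi /= !in_itv/=.
      case: ifPn => x0; last by rewrite ltNge (ltW a0).
      rewrite (powp a x a0 x0).2// => /andP[-> /=].
      by rewrite !leNgt (powp b x b0 x0).2// => ->.
    move=> /andP[bx xa]; have x0 : 0 < x by rewrite (lt_le_trans _ bx)// powR_gt0.
    by rewrite x0 (powp a x a0 x0).2// xa/= leNgt (powp b x b0 x0).2// -leNgt.
  have ap : b `^ p < a `^ p.
    rewrite -(opprK p) 2!(powRN _ (- p)) ltf_pV2 ?posrE ?powR_gt0//.
    by apply: gt0_ltr_powR; rewrite ?oppr_gt0// nnegrE ltW.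
  by rewrite lebesgue_measure_itv/= lte_fin ap ltr0_norm ?subr_lt0// opprB EFinB.
apply: (@integral_comp_half_line R _ _ mu phi (fun t => `|p| * t `^ (p - 1))
  (fun t => g (t `^ p))) => //.
- apply: measurable_funM => //; exact: measurable_powR.
- by move=> r; rewrite mulr_ge0// powR_ge0.
- move=> a b a0 ab; transitivity (`|b `^ p - a `^ p|)%:E; first exact: mE.
  have [pp|pp] : 0 < p \/ p < 0 by apply/orP; rewrite orbC -neq_lt.
    apply/esym; apply: eq_trans; last first.
      rewrite ger0_norm; first by [].
      rewrite subr_ge0; apply: ge0_ler_powR; rewrite ?nnegrE;
        do ?[exact: ltW | apply: ltW; exact: lt_trans ab].
    by rewrite gtr0_norm//; exact: integral_powR_itv.
  apply/esym/oppe_inj; rewrite -integral_ge0N; last first.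
    by move=> x _; rewrite lee_fin mulr_ge0// powR_ge0.
  apply: eq_trans; last first.
    rewrite -EFinN ler0_norm ?opprK; first by [].
    rewrite subr_le0 -(opprK p) 2!(powRN _ (- p)) lef_pV2 ?posrE ?powR_gt0// ?(lt_trans a0)//.
    apply: ge0_ler_powR; rewrite ?nnegrE ?oppr_ge0;
      do ?[exact: ltW | apply: ltW; exact: lt_trans ab].
  rewrite ltr0_norm//; under eq_integral do rewrite mulNr EFinN oppeK.
  exact: integral_powR_itv.
- move=> a b a0 ab; rewrite [X in (X < _)%E](_ : _ = (`|b `^ p - a `^ p|)%:E) ?ltry//.
  exact: mE.
- apply: measurableT_comp => //; exact: measurable_powR.
Qed.

Lemma norm2_le (r : R) (x : R * R) : 0 <= r ->
  (norm2 x <= r) = (x.1 ^+ 2 + x.2 ^+ 2 <= r ^+ 2).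
Proof.
move=> r0; rewrite /norm2 -[X in _ <= X]ger0_norm// -sqrtr_sqr ler_sqrt//.
by rewrite sqr_ge0.
Qed.

Lemma measurable_norm2 : measurable_fun setT (@norm2 R).
Proof.
rewrite /norm2; apply: (measurableT_comp (f := @Num.sqrt R)).
  apply: continuous_measurable_fun; exact: sqrt_continuous.
by apply: measurable_funD; apply: measurable_funX.
Qed.

(** Integration over vertical sections, then the substitution x = r sin t, which turns chord length
    times Jacobian into 2 r^2 cos^2 t. *)
Lemma area_disk (r : R) : 0 < r ->
  area2 [set x : R * R | norm2 x <= r] = (pi * r ^+ 2)%:E.
Proof.
move=> r0; rewrite /area2 /product_measure1.
(* One formula covers every [x]: beyond the disk the section is empty, and [Num.sqrt] returns 0 on
   negative numbers. *)
transitivity (\int[mu]_x (2 * Num.sqrt (r ^+ 2 - x ^+ 2))%:E)%E.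
  apply: eq_integral => x _ /=.
  have [xr|xr] := leP (x ^+ 2) (r ^+ 2).
    rewrite (_ : xsection _ _ = `[(- Num.sqrt (r ^+ 2 - x ^+ 2)),
       (Num.sqrt (r ^+ 2 - x ^+ 2))]%classic); last first.
      apply/seteqP; split => y; rewrite /xsection/= inE/= in_itv/=;
        rewrite norm2_le ?(ltW r0)//= -ler_norml -sqrtr_sqr.
        by move=> h; rewrite ler_wsqrtr// lerBrDl.
      by rewrite ler_sqrt ?subr_ge0// lerBrDl.
    rewrite lebesgue_measure_itv/= lte_fin; case: ifPn.
      by move=> _; rewrite -EFinB opprK mulr_natl mulr2n.
    rewrite -leNgt -subr_ge0 => h; have := sqrtr_ge0 (r ^+ 2 - x ^+ 2) => h2.
    by congr (_%:E); lra.
  rewrite (_ : xsection _ _ = set0); last first.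
    apply/seteqP; split => y //; rewrite /xsection/= inE/= norm2_le ?(ltW r0)//=.
    by have := sqr_ge0 y; lra.
  by rewrite measure0 ler0_sqrtr ?mulr0// subr_le0 ltW.
transitivity (\int[mu]_(x in `[(- r)%R, r]) (2 * Num.sqrt (r ^+ 2 - x ^+ 2))%:E)%E.
  rewrite [RHS]integral_mkcond; apply: eq_integral => x _; rewrite patchE.
  case: ifPn => //; rewrite notin_setE/= in_itv/= -ler_norml => /negP.
  rewrite -ltNge => rx; rewrite ler0_sqrtr ?mulr0// subr_le0 -(real_normK (num_real x)).
  by rewrite ler_sqr ?nnegrE ?(ltW r0)// ltW.
pose F (t : R) := r * sin t.
have dF (t : R) : is_derive t 1 F (r * cos t).
  exact: (@is_deriveZ _ _ _ (@sin R : R -> R^o) r t 1 (cos t)).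
have dFE : F^`()%classic = fun t => r * cos t.
  by apply/funext => t; rewrite derive1E derive_val.
have FN : F (- (pi / 2)) = - r by rewrite /F sinN sin_pihalf mulrN1.
have FP : F (pi / 2) = r by rewrite /F sin_pihalf mulr1.
have cc : continuous (fun t : R => r * cos t).
  by move=> t; apply: cvgM; [exact: cvg_cst|exact: continuous_cos].
have cF : continuous F.
  by move=> t; apply: cvgM; [exact: cvg_cst|exact: continuous_sin].
have pi2 : - (pi / 2) < pi / 2 :> R by rewrite gtrN// divr_gt0// pi_gt0.
rewrite (_ : `[(- r)%R, r]%classic = `[F (- (pi / 2)), F (pi / 2)]%classic);
  last by rewrite FN FP.
apply: (eq_trans (@integration_by_substitution_increasing R F
  (fun x => 2 * Num.sqrt (r ^+ 2 - x ^+ 2)) _ _ _ _ _ _ _ _ _)); last first.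
- rewrite dFE.
  transitivity (\int[mu]_(t in `[(- (pi / 2))%R, (pi / 2)%R])
     (2 * r ^+ 2 * cos t ^+ 2)%:E)%E.
    apply: eq_integral => t; rewrite inE/= in_itv/= => tpi /=.
    rewrite [in LHS]mulrfctE /= /F.
    rewrite (_ : r ^+ 2 - _ = (r * cos t) ^+ 2); last by rewrite !exprMn cos2sin2; ring.
    rewrite sqrtr_sqr ger0_norm ?mulr_ge0 ?(ltW r0)// ?cos_ge0_pihalf//.
    by congr (_%:E); ring.
  pose G (t : R) := r ^+ 2 * (t + sin t * cos t).
  have dG (t : R) : is_derive t 1 G (2 * r ^+ 2 * cos t ^+ 2).
    have : is_derive t 1 (r ^+ 2 *: ((id : R -> R^o) + (@sin R : R -> R^o) * (@cos R : R -> R^o)))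
      (2 * r ^+ 2 * cos t ^+ 2).
      apply: is_derive_eq; rewrite /GRing.scale/=.
      by rewrite -[X in _ * (X + _)](cos2Dsin2 t); ring.
    exact.
  have cc2 : continuous (fun t : R => 2 * r ^+ 2 * cos t ^+ 2).
    move=> t; apply: cvgM; first exact: cvg_cst.
    by apply: cvgM; exact: continuous_cos.
  rewrite (@continuous_FTC2 _ _ G)//.
  + rewrite /G sinN cosN sin_pihalf cos_pihalf -EFinB; congr (_%:E); by field.
  + exact: continuous_subspaceT cc2.
  + have cG t : {for t, continuous G}.
      by apply: differentiable_continuous; apply/derivable1_diffP; exact: ex_derive.
    by split; [move=> t _; exact: ex_derive|apply: cvg_at_right_filter; exact: cG|
      apply: cvg_at_left_filter; exact: cG].
  + by move=> t _; rewrite derive1E derive_val.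
- apply: continuous_subspaceT => x; apply: cvgM; first exact: cvg_cst.
  apply: continuous_comp; last exact: sqrt_continuous.
  by apply: cvgB; [exact: cvg_cst|exact: exprn_continuous].
- by split; [move=> t _; exact: ex_derive|apply: cvg_at_right_filter; exact: cF|
    apply: cvg_at_left_filter; exact: cF].
- by rewrite dFE; apply/cvg_ex; eexists; apply: cvg_at_left_filter; exact: cc.
- by rewrite dFE; apply/cvg_ex; eexists; apply: cvg_at_right_filter; exact: cc.
- by rewrite dFE => t _; exact: cc.
- move=> x y; rewrite !in_itv/= => /andP[x1 x2] /andP[y1 y2] xy.
  by rewrite /F ltr_pM2l// ltr_sin ?in_itv/= ?x1 ?x2 ?y1 ?y2.
- exact: ltW.
Qed.

(** The norm pushes planar Lebesgue measure forward to the measure of density 2 pi r: on []a, b]]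
    both give the area of an annulus. *)
Lemma integral_polar (g : R -> \bar R) :
  measurable_fun setT g -> (forall r, 0 <= g r)%E ->
  (\int[mu \x mu]_x g (norm2 x) =
   \int[mu]_(r in `]0%R, +oo[) (g r * (2 * pi * r)%:E))%E.
Proof.
move=> mg g0.
have mD (r : R) : measurable [set x : R * R | norm2 x <= r].
  by rewrite -[X in measurable X]setTI; apply: measurable_fun_ler => //; exact: measurable_norm2.
(* The change of variables only sees positive radii, so the origin must be negligible: for every [e]
   it lies in a disk of area [e]. *)
have disk0 : (mu \x mu)%E [set x : R * R | norm2 x <= 0] = 0%E.
  apply/eqP; rewrite eq_le measure_ge0 andbT; apply/lee_addgt0Pr => e e0; rewrite add0e.
  have r0 : 0 < Num.sqrt (e / pi) by rewrite sqrtr_gt0 divr_gt0// pi_gt0.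
  apply: (@le_trans _ _ (area2 [set x : R * R | norm2 x <= Num.sqrt (e / pi)])).
    apply: le_measure; rewrite ?inE; try exact: mD.
    by move=> x /= /le_trans; apply; exact: ltW.
  rewrite area_disk// sqr_sqrtr ?divr_ge0 ?pi_ge0 ?(ltW e0)//.
  by rewrite mulrC divfK// gt_eqF// pi_gt0.
transitivity (\int[(mu \x mu)%E]_(x in (@norm2 R) @^-1` `]0%R, +oo[) g (norm2 x))%E.
  rewrite (@ge0_negligible_integral _ (measurableTypeR R * measurableTypeR R)%type
      R (mu \x mu)%E setT [set x | norm2 x <= 0]) => //; first last.
  - exact: measurableT_comp mg measurable_norm2.
  - exact: mD.
  congr (integral _ _ _); apply/seteqP; split => x /=; rewrite in_itv/= andbT.
    by case=> _ /negP; rewrite -ltNge.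
  by move=> x0; split => //; apply/negP; rewrite -ltNge.
have mE (a b : R) : 0 < a -> a < b ->
    (mu \x mu)%E ((@norm2 R) @^-1` `]a, b]%classic) = (pi * b ^+ 2 - pi * a ^+ 2)%:E.
  move=> a0 ab; rewrite (_ : _ @^-1` _ =
    [set x : R * R | norm2 x <= b] `\` [set x : R * R | norm2 x <= a]); last first.
    apply/seteqP; split => x /=; rewrite in_itv/=.
      by move=> /andP[ax ->]; split => //; apply/negP; rewrite -ltNge.
    by case=> -> /negP; rewrite -ltNge => ->.
  rewrite measureD//; last by rewrite [X in (X < _)%E]area_disk ?ltry// (lt_trans a0).
  rewrite setIidr; last by move=> x /= /le_trans; apply; exact: ltW.
  - rewrite [X in (X - _)%E](_ : _ = (pi * b ^+ 2)%:E).
      by rewrite [X in (_ - X)%E](_ : _ = (pi * a ^+ 2)%:E)//; exact: area_disk.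
    by apply: area_disk; exact: lt_trans ab.
  - exact: mD.
  - exact: mD.
(* The density must be nonnegative on the whole line, hence [Num.max r 0] in place of [r]. *)
rewrite (@integral_comp_half_line R _ _ (mu \x mu)%E (@norm2 R) (fun r => 2 * pi * Num.max r 0))//.
- apply: eq_integral => r; rewrite inE/= in_itv/= andbT => r0.
  by rewrite max_l// ltW.
- exact: measurable_norm2.
- by apply: measurable_funM => //; exact: measurable_maxr.
- by move=> r; rewrite !mulr_ge0// ?pi_ge0// le_max lexx orbT.
- move=> a b a0 ab; transitivity (pi * b ^+ 2 - pi * a ^+ 2)%:E; first exact: mE.
  transitivity (\int[mu]_(t in `]a, b]) (pi%:E * (2%:R * t `^ (2%:R - 1))%:E))%E; last first.
    apply: eq_integral => t; rewrite inE/= in_itv/= => /andP[at_ _].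
    have t0 := lt_trans a0 at_; rewrite (_ : 2%:R - 1 = 1 :> R); last by ring.
    by rewrite powRr1 ?(ltW t0)// max_l ?(ltW t0)// -EFinM; congr (_%:E); ring.
  rewrite ge0_integralZl_EFin ?pi_ge0//.
  + rewrite integral_powR_itv// !powR_mulrn ?(ltW a0) ?(ltW (lt_trans a0 ab))// -EFinM.
    by rewrite mulrBr.
  + by move=> x _; rewrite lee_fin mulr_ge0// powR_ge0.
  + apply/measurable_EFinP; apply: measurable_funM => //; apply: measurable_funTS.
    exact: measurable_powR.
- move=> a b a0 ab; rewrite [X in (X < _)%E](_ : _ = (pi * b ^+ 2 - pi * a ^+ 2)%:E) ?ltry//.
  exact: mE.
Qed.

End substitutions.

(** * Euler's reflection integral *)

Section powers.
Context (R : realType).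
Notation mu := (@lebesgue_measure R).

Lemma integral_powR_subst_set (p : R) (D D' : set R) (g : R -> \bar R) :
  p != 0 -> measurable D -> measurable D' ->
  D `<=` `]0%R, +oo[%classic -> D' `<=` `]0%R, +oo[%classic ->
  (forall t, 0 < t -> D' t <-> D (t `^ p)) ->
  measurable_fun D g -> (forall r, D r -> 0 <= g r)%E ->
  (\int[mu]_(x in D) g x =
   \int[mu]_(t in D') (g (t `^ p)%R * (`|p| * t `^ (p - 1))%:E))%E.
Proof.
move=> p0 mD mD' D0 D'0 DD' mg g0.
transitivity (\int[mu]_(x in `]0%R, +oo[) (g \_ D) x)%E.
  rewrite integral_mkcond [RHS]integral_mkcond; apply: eq_integral => x _.
  rewrite !patchE; case: ifPn => // xD; case: ifPn => //.
  by rewrite notin_setE => /(_ (D0 _ (set_mem xD))).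
rewrite (@integral_powR_subst _ p)//.
- rewrite [LHS]integral_mkcond [RHS]integral_mkcond; apply: eq_integral => x _.
  rewrite !patchE; case: ifPn => x0; last first.
    case: ifPn => // /set_mem /D'0 xD'; by move: x0; rewrite notin_setE.
  have {}x0 : 0 < x by move: x0; rewrite inE/= in_itv/= andbT.
  have [h|h] := pselect (D' x).
    by rewrite !mem_set//; exact/DD'.
  rewrite [in RHS]memNset// memNset ?mul0e//; by move=> /(DD' _ x0).
- by apply/(measurable_restrictT g mD).
- by move=> r; rewrite patchE; case: ifPn => // /set_mem; exact: g0.
Qed.

Lemma powRD_gt0 (t r s : R) : 0 < t -> t `^ (r + s) = t `^ r * t `^ s.
Proof. by move=> t0; rewrite powRD// (gt_eqF t0) implybT. Qed.

Lemma powR_lt1 (t p : R) : 0 < t -> 0 < p -> (t `^ p < 1) = (t < 1).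
Proof.
move=> t0 p0; apply/idP/idP.
  apply: contraTT; rewrite -!leNgt => t1; rewrite -[X in X <= _](powRr0 t).
  by rewrite ler_powR// ltW.
move=> t1; rewrite -[X in _ < X](_ : 1 `^ p = 1); last by rewrite powR1.
by apply: gt0_ltr_powR => //; rewrite nnegrE ltW.
Qed.

Lemma integral01_powR_subst (p : R) (g : R -> \bar R) : 0 < p ->
  measurable_fun (`]0%R, 1%R[ : set R) g -> (forall r : R, (0 < r < 1)%R -> 0 <= g r)%E ->
  (\int[mu]_(x in `]0%R, 1%R[) g x =
   \int[mu]_(t in `]0%R, 1%R[) (g (t `^ p)%R * (p * t `^ (p - 1))%:E))%E.
Proof.
move=> p0 mg g0; rewrite (@integral_powR_subst_set p _ `]0%R, 1%R[%classic)//.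
- by rewrite gtr0_norm.
- by rewrite gt_eqF.
- by move=> x /=; rewrite !in_itv/= andbT => /andP[].
- by move=> x /=; rewrite !in_itv/= andbT => /andP[].
- by move=> t t0; rewrite /= !in_itv/= t0 powR_gt0// powR_lt1.
Qed.

Lemma integral1y_powR_subst (p : R) (g : R -> \bar R) : 0 < p ->
  measurable_fun (`]1%R, +oo[ : set R) g -> (forall r : R, (1 < r)%R -> 0 <= g r)%E ->
  (\int[mu]_(x in `]1%R, +oo[) g x =
   \int[mu]_(t in `]0%R, 1%R[) (g (t `^ (- p))%R * (p * t `^ (- p - 1))%:E))%E.
Proof.
move=> p0 mg g0; rewrite (@integral_powR_subst_set (- p) _ `]0%R, 1%R[%classic)//.
- by rewrite normrN gtr0_norm.
- by rewrite oppr_eq0 gt_eqF.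
- by move=> x /=; rewrite !in_itv/= !andbT; exact: lt_trans.
- by move=> x /=; rewrite !in_itv/= andbT => /andP[].
- move=> t t0; rewrite /= !in_itv/= t0 andbT /= powRN.
  by rewrite invf_gt1 ?powR_gt0// powR_lt1.
- by move=> r; rewrite /= in_itv/= andbT; exact: g0.
Qed.

Lemma measurable_powR_itv (q : R) (D : set R) : measurable_fun D (fun t : R => t `^ q).
Proof. by apply: measurable_funTS; exact: measurable_powR. Qed.

(** The power substitution applied to the constant 1, which avoids the singular endpoint 0 when
    [q < 1]. *)
Lemma integral01_powR (q : R) : 0 < q ->
  (\int[mu]_(t in `]0%R, 1%R[) (t `^ (q - 1))%:E = (q^-1)%:E)%E.
Proof.
move=> q0; have h : (\int[mu]_(t in `]0%R, 1%R[) (q%:E * (t `^ (q - 1))%:E) = 1)%E.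
  transitivity (\int[mu]_(t in `]0%R, 1%R[) ((cst 1%E) (t `^ q)%R * (q * t `^ (q - 1))%:E))%E.
    by apply: eq_integral => t _; rewrite mul1e EFinM.
  rewrite -integral01_powR_subst//.
  rewrite integral_cst; last exact: measurable_itv.
  by rewrite mul1e; have := @lebesgue_measure_itv R `]0, 1[; rewrite /= lte_fin ltr01 oppr0 adde0.
rewrite ge0_integralZl_EFin ?(ltW q0)// in h; first last.
- by apply/measurable_EFinP; exact: measurable_powR_itv.
- by move=> t _; rewrite lee_fin powR_ge0.
have -> : q^-1%:E = (q^-1%:E * 1)%E by rewrite mule1.
by rewrite -h muleA -EFinM mulVf ?gt_eqF// mul1e.
Qed.

End powers.

Section reflection.
Context (R : realType).
Notation mu := (@lebesgue_measure R).

(* Herglotz' trick: [cotint a] satisfies the duplication formula of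
   [pi * cot (pi * a)] and has the same singularity at [0]. *)
Definition cotint (a : R) : \bar R :=
  (\int[mu]_(t in `]0%R, 1%R[) ((t `^ (a - 1) - t `^ (- a)) / (1 - t))%:E)%E.

(** The integral of t^(a-1) / (1 + t) over the half line, with the part beyond 1 folded back by t ->
    1/t. Its value will be pi / sin (pi a). *)
Definition cscint (a : R) : \bar R :=
  (\int[mu]_(t in `]0%R, 1%R[) ((t `^ (a - 1) + t `^ (- a)) / (1 + t))%:E)%E.

Lemma measurable_cotint a :
  measurable_fun (`]0%R, 1%R[ : set R) (fun t : R => (t `^ (a - 1) - t `^ (- a)) / (1 - t)).
Proof.
apply: measurable_funM.
  by apply: measurable_funB; exact: measurable_powR_itv.
by apply: measurable_funV; exact: measurable_funB.
Qed.

Lemma measurable_cscint a :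
  measurable_fun (`]0%R, 1%R[ : set R) (fun t : R => (t `^ (a - 1) + t `^ (- a)) / (1 + t)).
Proof.
apply: measurable_funM.
  by apply: measurable_funD; exact: measurable_powR_itv.
by apply: measurable_funV; exact: measurable_funD.
Qed.

(** The condition a <= 1/2 is exactly a - 1 <= -a. Staying in this range keeps the cotangent
    integrals nonnegative, so additivity holds before finiteness is known. *)
Lemma cotint_ge0 (a t : R) : a <= 1 / 2 -> 0 < t < 1 ->
  0 <= (t `^ (a - 1) - t `^ (- a)) / (1 - t).
Proof.
move=> a2 /andP[t0 t1]; apply: divr_ge0; last by rewrite subr_ge0 ltW.
by rewrite subr_ge0; apply: ger_powR; [rewrite t0 ltW|lra].
Qed.

Let cot_subst (a t : R) : 0 < t ->
  (((t `^ 2) `^ (a - 1) - (t `^ 2) `^ (- a)) / (1 - t `^ 2)) * (2 * t `^ (2 - 1)) =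
  2 * (t `^ (2 * a - 1) - t `^ (1 - 2 * a)) / (1 - t ^+ 2).
Proof.
move=> t0; rewrite -!powRrM (_ : 2 - 1 = 1); last by ring.
rewrite powRr1 ?(ltW t0)// (powR_mulrn 2) ?(ltW t0)//.
rewrite (_ : t `^ (2 * a - 1) = t `^ (2 * (a - 1)) * t); last first.
  rewrite -[X in _ = _ * X](powRr1 (ltW t0)) -powRD_gt0//.
  by congr (_ `^ _); ring.
rewrite (_ : t `^ (1 - 2 * a) = t `^ (2 * - a) * t); first by ring.
rewrite -[X in _ = _ * X](powRr1 (ltW t0)) -powRD_gt0//.
by congr (_ `^ _); ring.
Qed.

(** Squaring the variable replaces 1 - t by 1 - t^2 = (1 - t)(1 + t), a common denominator for the
    identities below. *)
Let cotint_sqr (a : R) : a <= 1 / 2 -> cotint a =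
  (\int[mu]_(t in `]0%R, 1%R[)
    (2 * (t `^ (2 * a - 1) - t `^ (1 - 2 * a)) / (1 - t ^+ 2))%:E)%E.
Proof.
move=> a2; rewrite /cotint (@integral01_powR_subst _ 2)//.
- apply: eq_integral => t; rewrite inE/= in_itv/= => /andP[t0 _].
  by rewrite -EFinM cot_subst.
- by apply/measurable_EFinP; exact: measurable_cotint.
- by move=> r r01; rewrite lee_fin cotint_ge0.
Qed.

Let measurable_cot_sqr (a : R) : measurable_fun (`]0%R, 1%R[ : set R)
  (fun t : R => (2 * (t `^ (2 * a - 1) - t `^ (1 - 2 * a)) / (1 - t ^+ 2))%:E).
Proof.
apply/measurable_EFinP; apply: measurable_funM.
  apply: measurable_funM => //.
  by apply: measurable_funB; exact: measurable_powR_itv.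
by apply: measurable_funV; apply: measurable_funB => //; exact: measurable_funX.
Qed.

(** The integral form of cot y = 2 cot (2y) + tan y at y = pi a / 2, where tan y = cot (pi/2 - y).
    With u = t^(a-1) and v = t^(-a) it holds on integrands, since (u - v t) - (v - u t) = (u - v)(1
    + t). *)
Lemma cotint_dup (a : R) : 0 < a -> a <= 1 / 2 ->
  (cotint (a / 2) = cotint a + cotint a + cotint ((1 - a) / 2))%E.
Proof.
move=> a0 a2; rewrite [LHS]cotint_sqr; last by lra.
rewrite [X in (_ + X)%E]cotint_sqr; last by lra.
have g0 := @cotint_ge0 a ^~ a2.
rewrite /cotint -ge0_integralD//;
  try by [move=> t; rewrite /= in_itv/= lee_fin; exact: g0|
          apply/measurable_EFinP; exact: measurable_cotint].
rewrite -ge0_integralD//.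
- apply: eq_integral => t; rewrite inE/= in_itv/= => /andP[t0 t1].
  rewrite -!EFinD; congr (_%:E).
  rewrite (_ : 2 * (a / 2) - 1 = a - 1); last by field.
  rewrite (_ : 1 - 2 * (a / 2) = - a + 1); last by field.
  rewrite (_ : 2 * ((1 - a) / 2) - 1 = - a); last by field.
  rewrite (_ : 1 - 2 * ((1 - a) / 2) = a - 1 + 1); last by field.
  rewrite !(@powRD_gt0 _ t _ 1 t0) powRr1 ?(ltW t0)//.
  have h1 : 1 - t != 0 by rewrite subr_eq0 gt_eqF.
  have h2 : 1 - t ^+ 2 != 0 by rewrite gt_eqF// subr_gt0 expr_lt1// ltW.
  move: (t `^ (a - 1)) (t `^ (- a)) => u v.
  have -> : 1 - t ^+ 2 = (1 - t) * (1 + t) by ring.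
  have h3 : 1 + t != 0 by rewrite gt_eqF// addr_gt0.
  by field; rewrite h1 h3.
- by move=> t; rewrite /= in_itv/= lee_fin => ?; rewrite addr_ge0// g0.
- by apply: emeasurable_funD; apply/measurable_EFinP; exact: measurable_cotint.
- move=> t; rewrite /= in_itv/= lee_fin => /andP[t0 t1].
  rewrite divr_ge0 ?mulr_ge0 ?subr_ge0 ?expr_le1 ?(ltW t0) ?(ltW t1)//.
  by apply: ger_powR; [rewrite t0 ltW|lra].
- exact: measurable_cot_sqr.
Qed.

(** The integral form of 2 / sin (2y) = cot y + tan y at y = pi a / 2. On integrands it is (u - v t)
    + (v - u t) = (u + v)(1 - t). *)
Lemma cscint_cotint (a : R) : 0 < a -> a < 1 ->
  (cscint a + cscint a = cotint (a / 2) + cotint ((1 - a) / 2))%E.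
Proof.
move=> a0 a1; rewrite !cotint_sqr; [|by lra..].
have g0 t : 0 < t < 1 -> 0 <= (t `^ (a - 1) + t `^ (- a)) / (1 + t).
  by move=> /andP[t0 t1]; rewrite divr_ge0 ?addr_ge0 ?powR_ge0// ltW.
rewrite /cscint -ge0_integralD//;
  try by [move=> t; rewrite /= in_itv/= lee_fin; exact: g0|
          apply/measurable_EFinP; exact: measurable_cscint].
rewrite -ge0_integralD//.
- apply: eq_integral => t; rewrite inE/= in_itv/= => /andP[t0 t1].
  rewrite -!EFinD; congr (_%:E).
  rewrite (_ : 2 * (a / 2) - 1 = a - 1); last by field.
  rewrite (_ : 1 - 2 * (a / 2) = - a + 1); last by field.
  rewrite (_ : 2 * ((1 - a) / 2) - 1 = - a); last by field.
  rewrite (_ : 1 - 2 * ((1 - a) / 2) = a - 1 + 1); last by field.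
  rewrite !(@powRD_gt0 _ t _ 1 t0) powRr1 ?(ltW t0)//.
  have h1 : 1 - t != 0 by rewrite subr_eq0 gt_eqF.
  move: (t `^ (a - 1)) (t `^ (- a)) => u v.
  have -> : 1 - t ^+ 2 = (1 - t) * (1 + t) by ring.
  have h3 : 1 + t != 0 by rewrite gt_eqF// addr_gt0.
  by field; rewrite h1 h3.
- move=> t; rewrite /= in_itv/= lee_fin => /andP[t0 t1].
  rewrite divr_ge0 ?mulr_ge0 ?subr_ge0 ?expr_le1 ?(ltW t0) ?(ltW t1)//.
  by apply: ger_powR; [rewrite t0 ltW|lra].
- exact: measurable_cot_sqr.
- move=> t; rewrite /= in_itv/= lee_fin => /andP[t0 t1].
  rewrite divr_ge0 ?mulr_ge0 ?subr_ge0 ?expr_le1 ?(ltW t0) ?(ltW t1)//.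
  by apply: ger_powR; [rewrite t0 ltW|lra].
- exact: measurable_cot_sqr.
Qed.

(** What remains of t^(a-1), whose integral is 1/a, after subtracting the integrand of [cotint a].
    It stays bounded near t = 1. *)
Let remainder (a t : R) := (t `^ (- a) - t `^ a) / (1 - t).

Let remainder_bound (a t : R) : 0 < a -> a <= 1 / 2 -> 0 < t < 1 ->
  0 <= remainder a t <= 8 * a * t `^ (1 / 4 - 1).
Proof.
move=> a0 a2 /andP[t0 t1]; rewrite /remainder.
have u0 : 0 < 1 - t by rewrite subr_gt0.
apply/andP; split.
  rewrite divr_ge0 ?(ltW u0)// subr_ge0; apply: ger_powR; [by rewrite t0 ltW|lra].
rewrite ler_pdivrMr//.
have e1 : t `^ (- a) - t `^ a = t `^ (- a) * (1 - t `^ (2 * a)).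
  rewrite mulrBr mulr1 -powRD_gt0//.
  by congr (_ - _ `^ _); ring.
have e2 : 1 - t `^ (2 * a) <= 2 * a * ln t^-1.
  rewrite /powR gt_eqF// lnV ?posrE//.
  by have := expR_ge1Dx (2 * a * ln t); lra.
(* This is ln s <= s - 1 at s = t^(-1/4). The fourth root leaves room for the factor t^(-a): since a
   <= 1/2, the total exponent is at least -3/4 and the bound remains integrable at 0. *)
have e3 : ln t^-1 <= 4 * t `^ (- (1 / 4)) * (1 - t).
  rewrite -[t^-1]powR_inv1 ?(ltW t0)// (_ : -1 = - (1 / 4) * 4); last by field.
  rewrite powRrM ln_powR -mulrA ler_pM2l//.
  set s := t `^ _; have s0 : 0 < s by rewrite powR_gt0.
  apply: (@le_trans _ _ (s - 1)).
    by have := @le_ln1Dx _ (s - 1); rewrite subrKC; apply; lra.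
  have : t <= t `^ (1 / 4) by apply: ger1_powR; [rewrite t0 ltW|lra].
  have -> : t `^ (1 / 4) = s^-1 by rewrite /s powRN invrK.
  move=> h; have := ler_wpM2l (ltW s0) h; rewrite mulfV ?gt_eqF//.
  by lra.
rewrite e1.
apply: (@le_trans _ _ (t `^ (- a) * (2 * a * (4 * t `^ (- (1 / 4)) * (1 - t))))).
  rewrite ler_wpM2l ?powR_ge0//; apply: (le_trans e2).
  by rewrite ler_wpM2l// mulr_ge0// ltW.
rewrite (_ : _ * _ = 8 * a * (t `^ (- a) * t `^ (- (1 / 4))) * (1 - t)); last by ring.
rewrite ler_wpM2r ?(ltW u0)// ler_wpM2l// ?mulr_ge0 ?(ltW a0)//.
rewrite -powRD_gt0//.
by apply: ger_powR; [rewrite t0 ltW|lra].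
Qed.

(** [cotint a] and the integral of [remainder a] add up to 1/a. The constant is 32 = 8 * 4, where 4
    is the integral of t^(-3/4) over the unit interval. *)
Lemma cotint_bound (a : R) : 0 < a -> a <= 1 / 2 ->
  exists2 c : R, cotint a = c%:E & `|c - a^-1| <= 32 * a.
Proof.
move=> a0 a2.
have tpow t : 0 < t -> t `^ a = t `^ (a - 1) * t.
  by move=> t0; rewrite -[X in _ = _ * X](powRr1 (ltW t0)) -powRD_gt0// subrK.
have mr : measurable_fun (`]0%R, 1%R[ : set R) (remainder a).
  apply: measurable_funM; last by apply: measurable_funV; exact: measurable_funB.
  by apply: measurable_funB; exact: measurable_powR_itv.
pose E := (\int[mu]_(t in `]0%R, 1%R[) (remainder a t)%:E)%E.
have E0 : (0 <= E)%E.
  apply: integral_ge0 => t; rewrite /= in_itv/= lee_fin => t01.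
  by have /andP[] := remainder_bound a0 a2 t01.
have Ele : (E <= (32 * a)%:E)%E.
  apply: (@le_trans _ _ (\int[mu]_(t in `]0%R, 1%R[) ((8 * a)%:E * (t `^ (1 / 4 - 1))%:E)))%E.
    apply: ge0_le_integral => //.
    - move=> t; rewrite /= in_itv/= lee_fin => t01.
      by have /andP[] := remainder_bound a0 a2 t01.
    - exact/measurable_EFinP.
    - apply: emeasurable_funM => //; apply/measurable_EFinP; exact: measurable_powR_itv.
    - move=> t; rewrite /= in_itv/= -EFinM lee_fin => t01.
      by have /andP[] := remainder_bound a0 a2 t01.
  rewrite ge0_integralZl_EFin//.
  - by rewrite integral01_powR// -EFinM lee_fin; lra.
  - by move=> t _; rewrite lee_fin powR_ge0.
  - by apply/measurable_EFinP; exact: measurable_powR_itv.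
  - by rewrite mulr_ge0// ltW.
have CE : (cotint a + E = (a^-1)%:E)%E.
  rewrite /cotint -ge0_integralD//.
  - rewrite -integral01_powR//; apply: eq_integral => t; rewrite inE/= in_itv/= => /andP[t0 t1].
    rewrite -EFinD /remainder tpow//.
    by congr (_%:E); field; rewrite subr_eq0 gt_eqF.
  - by move=> t; rewrite /= in_itv/= lee_fin; exact: cotint_ge0.
  - by apply/measurable_EFinP; exact: measurable_cotint.
  - move=> t; rewrite /= in_itv/= lee_fin => t01.
    by have /andP[] := remainder_bound a0 a2 t01.
  - exact/measurable_EFinP.
have C0 : (0 <= cotint a)%E.
  by apply: integral_ge0 => t; rewrite /= in_itv/= lee_fin; exact: cotint_ge0.
move: CE Ele E0 C0; case: E => [e| |]//; case: (cotint a) => [c| |]// [ce].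
rewrite !lee_fin => e32 e0 c0; exists c => //.
by rewrite -ce opprD addrA subrr sub0r normrN ger0_norm.
Qed.

Lemma sin_le_id (x : R) : 0 <= x -> sin x <= x.
Proof.
move=> x0; pose f : R -> R := (id : R -> R^o) - (@sin R : R -> R^o).
have df (t : R) : is_derive t 1 f (1 - cos t) by exact: is_deriveB.
have cf : continuous f.
  by move=> t; apply: differentiable_continuous; apply/derivable1_diffP; exact: ex_derive.
have : f 0 <= f x.
  apply: (@ger0_derive1_le_cc R f 0 x); rewrite ?in_itv/= ?lexx ?x0//.
  - by move=> t _; rewrite derive1E derive_val subr_ge0 cos_le1.
  - exact: continuous_subspaceT.
by rewrite /f !fctE sin0 subrr subr_ge0.
Qed.

Lemma le_id_tan (x : R) : 0 <= x -> x <= pi / 2 -> x * cos x <= sin x.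
Proof.
move=> x0 x2; pose f : R -> R := (@sin R : R -> R^o) - (id : R -> R^o) * (@cos R : R -> R^o).
have df (t : R) : is_derive t 1 f (t * sin t).
  by apply: is_derive_eq; rewrite /GRing.scale/=; ring.
have cf : continuous f.
  by move=> t; apply: differentiable_continuous; apply/derivable1_diffP; exact: ex_derive.
have : f 0 <= f x.
  apply: (@ger0_derive1_le_cc R f 0 x); rewrite ?in_itv/= ?lexx ?x0//.
  - move=> t; rewrite in_itv/= => /andP[t0 tx]; rewrite derive1E derive_val.
    by rewrite mulr_ge0 ?(ltW t0)// sin_ge0_pi//; have := pi_gt0 R; lra.
  - exact: continuous_subspaceT.
by rewrite /f !fctE sin0 mul0r subrr subr_ge0.
Qed.

(** The same linear control as for [cotint], so that the poles at 0 cancel in the difference of the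
    two functions. *)
Lemma cot_bound (x : R) : 0 < x -> x <= pi / 2 ->
  `|cos x / sin x - x^-1| <= x.
Proof.
move=> x0 x2; have pi0 : 0 < pi :> R := pi_gt0 R.
have sx : 0 < sin x by apply: sin_gt0_pi; rewrite x0/=; lra.
pose y := x / 2; have xy : x = y *+ 2 by rewrite /y mulr2n; field.
have cx : 0 <= cos x by apply: cos_ge0_pihalf; rewrite x2 andbT; lra.
have cy : 0 < cos y by apply: cos_gt0_pihalf; rewrite /y; lra.
have sy : 0 <= sin y by apply: sin_ge0_pi; rewrite /y; lra.
(* As cos (2y) >= 0, the square of cos y is at least 1/2; and cos y <= 1 makes cos y at least its
   square. *)
have cy2 : 1 / 2 <= cos y.
  have : 1 / 2 <= cos y ^+ 2 by move: cx; rewrite xy cos_mulr2n; lra.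
  have := cos_le1 y; nra.
have h : x * cos x <= sin x by apply: le_id_tan => //; exact: ltW.
have -> : cos x / sin x - x^-1 = - ((sin x - x * cos x) / (x * sin x)).
  by field; rewrite !gt_eqF.
rewrite normrN ger0_norm; last by rewrite divr_ge0 ?subr_ge0// mulr_ge0// ltW.
rewrite ler_pdivrMr ?mulr_gt0//.
have h1 : sin x <= x by apply: sin_le_id; exact: ltW.
apply: (@le_trans _ _ (x * (1 - cos x))); first by lra.
rewrite ler_wpM2l ?(ltW x0)//.
(* With s = sin y and c = cos y, 1 - cos x = 2 s^2 and x sin x = 4 y s c. The claim reduces to s <=
   2 y c, a consequence of s <= y and c >= 1/2. *)
rewrite xy cos_mulr2n sin_mulr2n -!xy; have := cos2Dsin2 y.
have : sin y <= y by apply: sin_le_id; rewrite /y; lra.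
have : 0 < y by rewrite /y; lra.
rewrite [in X in _ -> _ -> _ -> X]xy !mulr2n.
move: (sin y) (cos y) sy cy2 => s c s0 c2 y0 sy1 cs.
have -> : 1 - (c ^+ 2 + c ^+ 2 - 1) = 2 * s * s.
  transitivity (2 * (1 - c ^+ 2)); first by ring.
  by rewrite -cs; ring.
have -> : (y + y) * (c * s + c * s) = 2 * s * (2 * y * c) by ring.
by rewrite ler_wpM2l ?mulr_ge0//; nra.
Qed.

(** The difference [D] of the two sides is O(b) near 0 and inherits the duplication formula. The
    classical end of Herglotz' trick takes a point where the maximum of |D| is attained, which needs
    continuity. Here the linear bound makes the contraction of the supremum quantitative, and
    continuity of [cotint] is never established. *)
Lemma cotintE (a : R) : 0 < a -> a <= 1 / 2 ->
  cotint a = (pi * cos (pi * a) / sin (pi * a))%:E.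
Proof.
pose D (a : R) := fine (cotint a) - pi * cos (pi * a) / sin (pi * a).
have pi0 : 0 < pi :> R := pi_gt0 R.
(* 32 comes from [cotint_bound], and pi^2 from [cot_bound] at pi b multiplied by the outer factor
   pi. *)
pose K : R := 32 + pi ^+ 2.
have K0 : 0 < K by rewrite /K; nra.
have DK (b : R) : 0 < b -> b <= 1 / 2 -> `|D b| <= K * b.
  move=> b0 b2; have [c cE cb] := cotint_bound b0 b2.
  rewrite /D cE /=.
  have sb : sin (pi * b) != 0 by rewrite gt_eqF// sin_gt0_pi//; nra.
  have -> : c - pi * cos (pi * b) / sin (pi * b) = (c - b^-1) -
     pi * (cos (pi * b) / sin (pi * b) - (pi * b)^-1).
    by rewrite mulrBr invfM (mulrA pi pi^-1) mulfV ?gt_eqF// mul1r; ring.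
  apply: (le_trans (ler_normB _ _)).
  rewrite (_ : K * b = 32 * b + pi ^+ 2 * b); last by rewrite /K; ring.
  apply: lerD => //.
  rewrite normrM gtr0_norm// expr2 -mulrA ler_pM2l//; apply: cot_bound; nra.
have Ddup (b : R) : 0 < b -> b <= 1 / 2 -> D b + D b + D ((1 - b) / 2) = D (b / 2).
  move=> b0 b2.
  have [c cE _] := cotint_bound b0 b2.
  have [c1 c1E _] : exists2 c1 : R, cotint (b / 2) = c1%:E & `|c1 - (b / 2)^-1| <= 32 * (b / 2).
    by apply: cotint_bound; lra.
  have [c2 c2E _] : exists2 c1 : R, cotint ((1 - b) / 2) = c1%:E &
      `|c1 - ((1 - b) / 2)^-1| <= 32 * ((1 - b) / 2).
    by apply: cotint_bound; lra.
  have := cotint_dup b0 b2; rewrite /D cE c1E c2E /= => -[->].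
  pose y := pi * b / 2.
  have e1 : pi * b = y *+ 2 by rewrite /y mulr2n; field.
  have e2 : pi * (b / 2) = y by rewrite /y; field.
  have e3 : pi * ((1 - b) / 2) = - y + pi / 2 by rewrite /y; field.
  have sy : sin y != 0 by rewrite gt_eqF//; apply: sin_gt0_pi; rewrite /y; nra.
  have cy : cos y != 0 by rewrite gt_eqF//; apply: cos_gt0_pihalf; rewrite /y; nra.
  rewrite e2 e3 e1 sinDpihalf cosDpihalf sinN cosN opprK cos_mulr2n sin_mulr2n.
  rewrite cos2sin2 !mulr2n.
  have cs : cos y ^+ 2 = 1 - sin y ^+ 2 by rewrite cos2sin2.
  apply/eqP; rewrite -subr_eq0; apply/eqP.
  rewrite (_ : cos y * sin y + cos y * sin y = 2 * (sin y * cos y)); last by ring.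
  transitivity (pi * (cos y ^+ 2 - (1 - sin y ^+ 2)) / (sin y * cos y)).
    by field; rewrite sy cy.
  by rewrite cs subrr mulr0 mul0r.
pose S := [set `|D b| | b in [set b : R | 0 < b <= 1 / 2]].
have supS : has_sup S.
  split; first by exists `|D (1 / 2)|; exists (1 / 2) => //=; lra.
  exists K => _ [b /= /andP[b0 b2] <-]; apply: (le_trans (DK _ b0 b2)); nra.
pose M := sup S.
have DM (b : R) : 0 < b -> b <= 1 / 2 -> `|D b| <= M.
  by move=> b0 b2; apply: sup_upper_bound => //; exists b => //=; rewrite b0.
(* Iterating D b = (D (b/2) - D ((1 - b)/2)) / 2 on its first term: each second term is bounded by
   the supremum [M], and the first, at b / 2^n, by the linear bound. *)
have iterD n (b : R) : 0 < b -> b <= 1 / 2 ->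
    `|D b| <= (1 / 2) ^+ n * (K * (b * (1 / 2) ^+ n)) + (1 - (1 / 2) ^+ n) * M.
  elim: n b => [|n IH] b b0 b2.
    by rewrite !expr0 subrr mul0r addr0 mul1r mulr1 (le_trans (DK _ b0 b2)).
  have h : `|D b| <= 1 / 2 * `|D (b / 2)| + 1 / 2 * M.
    have -> : D b = 1 / 2 * (D (b / 2) - D ((1 - b) / 2)) by rewrite -Ddup//; field.
    rewrite normrM [X in X * _]ger0_norm; last by lra.
    have : `|D ((1 - b) / 2)| <= M by apply: DM; lra.
    have := ler_normB (D (b / 2)) (D ((1 - b) / 2)); lra.
  have := IH (b / 2).
  have b20 : 0 < b / 2 by lra.
  have b22 : b / 2 <= 1 / 2 by lra.
  move=> /(_ b20 b22); rewrite !exprS; set e := (1 / 2) ^+ n; move=> h2.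
  rewrite (_ : 1 / 2 * e * (K * (b * (1 / 2 * e))) + (1 - 1 / 2 * e) * M =
    1 / 2 * (e * (K * (b / 2 * e)) + (1 - e) * M) + 1 / 2 * M); last by field.
  by apply: (le_trans h); rewrite lerD2r ler_pM2l//; lra.
have M0 : M <= 0.
  rewrite leNgt; apply/negP => M0.
  (* For this [n] the first term of [iterD] is at most 2^(-n) M / 2, since b <= 1/2. All |D b| are
     then at most (1 - 2^(-n) / 2) M, less than their supremum. The choice works because K / M < n +
     1 <= 2^n. *)
  have [n nP] : exists n, K * (1 / 2) ^+ n <= M.
    exists (truncn (K / M)); rewrite div1r exprVn ler_pdivrMr ?exprn_gt0// -ler_pdivrMl//.
    rewrite mulrC ltW// (lt_le_trans (truncnS_gt _))// -natrX ler_nat.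
    exact: ltn_expl.
  have e0 : 0 < (1 / 2 : R) ^+ n by rewrite exprn_gt0//; lra.
  have : M <= (1 - (1 / 2) ^+ n / 2) * M.
    apply: ge_sup; first by case: supS.
    move=> _ [b /= /andP[b0 b2] <-]; apply: (le_trans (iterD n b b0 b2)).
    move: e0 nP; set e := (1 / 2) ^+ n => e0 nP.
    suff : e * (K * (b * e)) <= e * (M / 2) by lra.
    by rewrite ler_pM2l//; nra.
  nra.
move=> a0 a2; have [c cE _] := cotint_bound a0 a2.
have : `|D a| <= 0 by apply: le_trans M0; exact: DM.
by rewrite normr_le0 /D cE/= subr_eq0 => /eqP ->.
Qed.

Lemma cscintE (a : R) : 0 < a -> a < 1 -> cscint a = (pi / sin (pi * a))%:E.
Proof.
move=> a0 a1; have := @cscint_cotint a a0 a1.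
rewrite !cotintE; [|by lra..].
have pi0 : 0 < pi :> R := pi_gt0 R.
pose y := pi * a / 2.
have e1 : pi * a = y *+ 2 by rewrite /y mulr2n; field.
have e2 : pi * (a / 2) = y by rewrite /y; field.
have e3 : pi * ((1 - a) / 2) = - y + pi / 2 by rewrite /y; field.
have sy : sin y != 0 by rewrite gt_eqF//; apply: sin_gt0_pi; rewrite /y; nra.
have cy : cos y != 0 by rewrite gt_eqF//; apply: cos_gt0_pihalf; rewrite /y; nra.
rewrite e2 e3 e1 sinDpihalf cosDpihalf sinN cosN opprK sin_mulr2n mulr2n.
have : (0 <= cscint a)%E.
  apply: integral_ge0 => t; rewrite /= in_itv/= lee_fin => /andP[t0 _].
  by rewrite divr_ge0 ?addr_ge0 ?powR_ge0// ltW.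
case: (cscint a) => [c| |]// _ [h]; congr (_%:E).
have -> : c = (c + c) / 2 by field.
rewrite h.
transitivity (pi * (cos y ^+ 2 + sin y ^+ 2) / (2 * sin y * cos y)).
  by field; rewrite sy cy.
rewrite cos2Dsin2 mulr1 (_ : cos y * sin y + _ = 2 * sin y * cos y)//; ring.
Qed.

Lemma integral0y_csc (a : R) : 0 < a -> a < 1 ->
  (\int[mu]_(t in `]0%R, +oo[) (t `^ (a - 1) / (1 + t))%:E =
   (pi / sin (pi * a))%:E)%E.
Proof.
move=> a0 a1; rewrite -cscintE// /cscint.
have m1 (D : set R) : measurable D -> D `<=` `]0%R, +oo[%classic ->
    measurable_fun D (fun t : R => (1 + t)^-1).
  by move=> _ _; apply: measurable_funV; exact: measurable_funD.
have m2 (D : set R) q : measurable D -> D `<=` `]0%R, +oo[%classic ->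
    measurable_fun D (fun t : R => (t `^ q / (1 + t))%:E).
  move=> mD D0; apply/measurable_EFinP; apply: measurable_funM; last exact: m1.
  exact: measurable_powR_itv.
have g0 (q t : R) : 0 < t -> 0 <= t `^ q / (1 + t).
  by move=> t0; rewrite divr_ge0 ?powR_ge0 ?addr_ge0// ltW.
have oi : `]0%R, 1%R[%classic `<=` (`]0%R, +oo[%classic : set R).
  by move=> x /=; rewrite !in_itv/= andbT => /andP[].
have yi : `[1%R, +oo[%classic `<=` (`]0%R, +oo[%classic : set R).
  by move=> x /=; rewrite !in_itv/= !andbT; exact: lt_le_trans.
have zi : `]1%R, +oo[%classic `<=` (`]0%R, +oo[%classic : set R).
  by move=> x /=; rewrite !in_itv/= !andbT; exact: lt_trans.
rewrite (@itv_bndbnd_setU _ _ (BRight (0:R)) (BLeft (1:R)) +oo%O) ?bnd_simp//.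
rewrite ge0_integral_setU//; last 3 first.
- rewrite -itv_bndbnd_setU ?bnd_simp//; exact: m2.
- by move=> x; rewrite -itv_bndbnd_setU ?bnd_simp//= in_itv/= andbT lee_fin; exact: g0.
- apply/disj_setPS => x [/=]; rewrite !in_itv/= => /andP[_ x1] /andP[/(lt_le_trans x1)].
  by rewrite ltxx.
rewrite -integral_itv_obnd_cbnd; last exact: m2.
(* The inversion t -> 1/t sends the part beyond 1 to the unit interval and produces the t^(-a) term
   of [cscint]. *)
rewrite (@integral1y_powR_subst _ 1)//; last 2 first.
- exact: m2.
- by move=> r r1; rewrite lee_fin g0// (lt_trans _ r1).
rewrite -ge0_integralD//.
- apply: eq_integral => t; rewrite inE/= in_itv/= => /andP[t0 t1].
  rewrite -EFinM -EFinD; congr (_%:E); rewrite mul1r.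
  rewrite -powRrM (_ : -1 - 1 = - 2%:R); last by ring.
  rewrite powR_invn ?(ltW t0)// powR_inv1 ?(ltW t0)//.
  rewrite (_ : -1 * (a - 1) = - a + 1); last by ring.
  rewrite (@powRD_gt0 _ t (- a) 1 t0) powRr1 ?(ltW t0)//.
  by field; rewrite !gt_eqF// addr_gt0.
- by move=> t; rewrite /= in_itv/= lee_fin => /andP[/g0].
- exact: m2.
- move=> t; rewrite /= in_itv/= -EFinM lee_fin => /andP[t0 _].
  by apply: mulr_ge0; [apply: g0; exact: powR_gt0|rewrite mul1r powR_ge0].
- apply: emeasurable_funM; last first.
    by apply/measurable_EFinP; apply: measurable_funM => //; exact: measurable_powR_itv.
  apply: (@eq_measurable_fun _ _ _ _ _ (fun t : R => (t `^ (- (a - 1) + 1) / (1 + t))%:E)).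
    move=> t; rewrite inE/= in_itv/= => /andP[t0 _]; congr (_%:E).
    rewrite -powRrM mulN1r powR_inv1 ?(ltW t0)// (@powRD_gt0 _ t (- (a - 1)) 1 t0) powRr1 ?(ltW t0)//.
    by field; rewrite !gt_eqF// addr_gt0.
  exact: m2.
Qed.

End reflection.

(** * Gamma and hypergeometric functions *)

Section integration_tools.
Context (R : realType).
Notation mu := (@lebesgue_measure R).

Lemma integral_scale (c : R) (D D' : set R) (g : R -> \bar R) :
  0 < c -> measurable D -> measurable D' ->
  D `<=` `]0%R, +oo[%classic -> D' `<=` `]0%R, +oo[%classic ->
  (forall t, 0 < t -> D' t <-> D (c * t)) ->
  measurable_fun D g -> (forall r, D r -> 0 <= g r)%E ->
  (\int[mu]_(x in D) g x = \int[mu]_(t in D') (g (c * t)%R * c%:E))%E.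
Proof.
move=> c0 mD mD' D0 D'0 DD' mg g0.
pose phi (x : R) := c^-1 * x.
have phiP (a b : R) : phi @^-1` `]a, b]%classic = `](c * a), (c * b)]%classic.
  apply/seteqP; split => x; rewrite /phi /= !in_itv/=.
    by rewrite ltr_pdivlMl// ler_pdivrMl.
  by rewrite ltr_pdivlMl// ler_pdivrMl.
have phi0 : phi @^-1` `]0%R, +oo[%classic = `]0%R, +oo[%classic.
  by apply/seteqP; split => x; rewrite /phi /= !in_itv/= !andbT pmulr_rgt0// invr_gt0.
have mE (a b : R) : a < b -> mu (phi @^-1` `]a, b]%classic) = (c * b - c * a)%:E.
  by move=> ab; rewrite phiP lebesgue_measure_itv/= lte_fin ltr_pM2l// ab EFinB.
have gD0 : (forall r, 0 <= (g \_ D) r)%E.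
  by move=> r; rewrite patchE; case: ifPn => // /set_mem; exact: g0.
have mgD : measurable_fun setT (g \_ D) by apply/(measurable_restrictT g mD).
have h : (\int[mu]_(x in phi @^-1` `]0%R, +oo[) (g \_ D) (c * phi x)%R =
    \int[mu]_(r in `]0%R, +oo[) ((g \_ D) (c * r)%R * (cst c r)%:E))%E.
  apply: (@integral_comp_half_line R _ _ mu phi (cst c) (fun t => (g \_ D) (c * t)%R)) => //.
  - exact: mulrl_measurable.
  - by move=> r; exact: ltW.
  - move=> a b a0 ab; apply: (eq_trans (mE _ _ ab)).
    apply/esym; apply: (eq_trans (integral_cst mu _ c%:E)); first exact: measurable_itv.
    have := @lebesgue_measure_itv R `]a, b]; rewrite /= lte_fin ab => ->.
    by rewrite -EFinB -EFinM mulrBr.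
  - move=> a b a0 ab; rewrite [X in (X < _)%E](_ : _ = (c * b - c * a)%:E) ?ltry//.
    exact: mE.
  - by apply: measurableT_comp => //; exact: mulrl_measurable.
rewrite phi0 in h.
transitivity (\int[mu]_(x in `]0%R, +oo[) (g \_ D) (c * phi x)%R)%E.
  rewrite [LHS]integral_mkcond [RHS]integral_mkcond; apply: eq_integral => x _.
  rewrite [RHS]patchE /phi mulrA mulfV ?gt_eqF// mul1r !patchE.
  case: ifPn => // xD; case: ifPn => //.
  by rewrite notin_setE => /(_ (D0 _ (set_mem xD))).
rewrite h [LHS]integral_mkcond [RHS]integral_mkcond; apply: eq_integral => x _.
rewrite !patchE; case: ifPn => x0; last first.
  case: ifPn => // /set_mem /D'0 xD'; by move: x0; rewrite notin_setE.
have {}x0 : 0 < x by move: x0; rewrite inE/= in_itv/= andbT.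
have [xD|xD] := pselect (D' x).
  by rewrite !mem_set//; exact/DD'.
rewrite [in RHS]memNset// memNset ?mul0e//; by move=> /(DD' _ x0).
Qed.

Lemma integral_if d (T : measurableType d) (m : {measure set T -> \bar R})
    (P : T -> bool) (f : T -> R) :
  (\int[m]_x (if P x then f x else 0)%:E = \int[m]_(x in [set x | P x]) (f x)%:E)%E.
Proof.
rewrite [RHS]integral_mkcond; apply: eq_integral => x _; rewrite patchE.
have [h|h] := boolP (P x); first by rewrite mem_set.
by rewrite memNset//; exact/negP.
Qed.

Lemma tonelli_region (P : R -> R -> bool) (g k : R -> R) :
  measurable_fun setT (fun x : R * R => P x.1 x.2) ->
  measurable_fun setT g -> measurable_fun setT k ->
  (forall x, 0 <= g x) -> (forall x, 0 <= k x) ->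
  (\int[mu]_x \int[mu]_y (if P x y then g x * k y else 0)%:E =
   \int[mu]_y \int[mu]_x (if P x y then g x * k y else 0)%:E)%E.
Proof.
move=> mP mg mk g0 k0.
pose f (z : R * R) := (if P z.1 z.2 then g z.1 * k z.2 else 0)%:E.
have mf : measurable_fun setT f.
  apply/measurable_EFinP; apply: measurable_fun_ifT => //.
  apply: measurable_funM.
    exact: (measurableT_comp mg).
  exact: (measurableT_comp mk).
apply: (@fubini_tonelli _ _ (measurableTypeR R) (measurableTypeR R) R mu mu f mf).
by move=> z; rewrite lee_fin /f; case: ifPn => // _; rewrite mulr_ge0.
Qed.

Lemma integral_expR_tail (c u : R) : 0 < c -> 0 <= u ->
  (\int[mu]_(t in `]u, +oo[) (c * expR (- (c * t)))%:E = (expR (- (c * u)))%:E)%E.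
Proof.
move=> c0 u0.
have dF (t : R) : is_derive t 1 (- (@expR R \o -%R)) (expR (- t)).
  have h : is_derive t 1 (@expR R \o -%R) (expR (- t) * -1).
    exact: (is_derive1_comp (is_derive_expR _) (is_deriveNid _ _)).
  by apply: is_derive_eq; rewrite mulrN1 opprK.
have cE : continuous (@expR R \o -%R).
  move=> t; apply: continuous_comp; first exact: continuousN.
  exact: continuous_expR.
have tail1 v : (\int[mu]_(t in `]v, +oo[) (expR (- t))%:E = (expR (- v))%:E)%E.
  rewrite integral_itv_obnd_cbnd; last first.
    apply/measurable_EFinP; apply: (measurableT_comp (f := @expR R)) => //.
  rewrite (@ge0_continuous_FTC2y _ _ (- (@expR R \o -%R)) v (- 0))//.
  - by rewrite oppr0 sub0e -EFinN opprK.
  - exact: continuous_subspaceT cE.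
  - apply: cvgN; exact: cvgr_expR.
  - by apply: cvg_at_right_filter; apply: cvgN; exact: cE.
  - by move=> t _; rewrite derive1E derive_val.
rewrite -(tail1 (c * u)) [RHS](@integral_scale c _ `]u, +oo[%classic)//.
- by apply: eq_integral => t _; rewrite -EFinM mulrC.
- by move=> t /=; rewrite !in_itv/= !andbT; apply: le_lt_trans; rewrite mulr_ge0// ltW.
- by move=> t /=; rewrite !in_itv/= !andbT; exact: le_lt_trans.
- by move=> t t0; rewrite /= !in_itv/= !andbT ltr_pM2l.
- apply/measurable_EFinP; apply: (measurableT_comp (f := @expR R)) => //.
Qed.

Lemma integral_expR_tail1 (u : R) : 0 <= u ->
  (\int[mu]_(t in `]u, +oo[) (expR (- t))%:E = (expR (- u))%:E)%E.
Proof.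
move=> u0; rewrite -[in RHS](mul1r u) -integral_expR_tail//.
by apply: eq_integral => t _; rewrite !mul1r.
Qed.

End integration_tools.

Section special_functions.
Context (R : realType).
Notation mu := (@lebesgue_measure R).

Lemma measurable_powR_expR (s : R) (D : set R) :
  measurable_fun D (fun t : R => t `^ s * expR (- t)).
Proof.
apply: measurable_funM; first exact: measurable_powR_itv.
apply: (measurableT_comp (f := @expR R)) => //.
Qed.

Lemma integral_powR_primitive (b t : R) : 0 < b -> 0 < t ->
  (\int[mu]_(u in `]0%R, t[) (b * u `^ (b - 1))%:E = (t `^ b)%:E)%E.
Proof.
move=> b0 t0.
have <- : (\int[mu]_(x in `]0%R, (t `^ b)%R[) (cst 1%E) x = (t `^ b)%:E)%E.
  rewrite integral_cst; last exact: measurable_itv.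
  rewrite mul1e; have := @lebesgue_measure_itv R `]0, (t `^ b)[.
  by rewrite /= lte_fin powR_gt0// oppr0 adde0.
rewrite [RHS](@integral_powR_subst_set _ b _ `]0%R, t[%classic)//.
- by apply: eq_integral => u _; rewrite mul1e gtr0_norm.
- by rewrite gt_eqF.
- by move=> x /=; rewrite !in_itv/= andbT => /andP[].
- by move=> x /=; rewrite !in_itv/= andbT => /andP[].
- move=> u u0; rewrite /= !in_itv/= u0 powR_gt0//=; split.
    by move=> ut; apply: gt0_ltr_powR => //; rewrite nnegrE ltW.
  apply: contraTT; rewrite -!leNgt => tu.
  by apply: ge0_ler_powR => //; rewrite ?nnegrE ltW.
Qed.

(** Tonelli replaces integration by parts: t^b is the integral of b u^(b-1) over u < t, and after
    the exchange the integral of exp(-t) over t > u is exp(-u). No boundary terms or prior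
    finiteness are involved. *)
Lemma Gamma_recurrence (b : R) : 0 < b ->
  (\int[mu]_(t in `]0%R, +oo[) (t `^ (b + 1 - 1) * expR (- t))%:E =
   b%:E * \int[mu]_(t in `]0%R, +oo[) (t `^ (b - 1) * expR (- t))%:E)%E.
Proof.
move=> b0; rewrite addrK.
have me : measurable_fun setT (fun t : R => expR (- t)).
  by apply: (measurableT_comp (f := @expR R)).
have mP : measurable_fun setT (fun x : R * R => (0 < x.2) && (x.2 < x.1)).
  by apply: measurable_and; apply: measurable_fun_ltr.
have mk : measurable_fun setT (fun u : R => b * u `^ (b - 1)).
  by apply: measurable_funM => //; exact: measurable_powR_itv.
transitivity (\int[mu]_x \int[mu]_y
    (if (0 < y)%R && (y < x)%R then expR (- x) * (b * y `^ (b - 1)) else 0)%:E)%E.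
  rewrite [LHS]integral_mkcond; apply: eq_integral => t _.
  rewrite integral_if patchE; case: ifPn; rewrite ?notin_setE ?inE /= in_itv/= andbT.
    move=> t0; rewrite (_ : [set x | _] = `]0%R, t[%classic); last first.
      by apply/seteqP; split => x /=; rewrite in_itv.
    under eq_integral do rewrite EFinM.
    rewrite ge0_integralZl_EFin.
    - transitivity ((expR (- t))%:E * (t `^ b)%:E)%E; first by rewrite -EFinM mulrC.
      by congr (_ * _)%E; apply/esym; exact: (integral_powR_primitive b0 t0).
    - exact: measurable_itv.
    - by move=> x _; rewrite lee_fin mulr_ge0 ?powR_ge0// ltW.
    - by apply/measurable_EFinP; apply: measurable_funM => //; exact: measurable_powR_itv.
    - exact: expR_ge0.
  move=> t0; rewrite (_ : [set x | _] = set0) ?integral_set0//.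
  by apply/seteqP; split => x //= /andP[x0 /(lt_trans x0)].
transitivity (\int[mu]_y \int[mu]_x
    (if (0 < y)%R && (y < x)%R then expR (- x) * (b * y `^ (b - 1)) else 0)%:E)%E; last first.
  apply/esym.
  rewrite -ge0_integralZl_EFin//; last 3 first.
  - by move=> t _; rewrite lee_fin mulr_ge0 ?powR_ge0 ?expR_ge0.
  - by apply/measurable_EFinP; exact: measurable_powR_expR.
  - exact: ltW.
  rewrite [LHS]integral_mkcond; apply: eq_integral => u _.
  rewrite integral_if patchE; case: ifPn; rewrite ?notin_setE ?inE /= in_itv/= andbT.
    move=> u0; rewrite (_ : [set x | _] = `]u, +oo[%classic); last first.
      by apply/seteqP; split => x /=; rewrite in_itv/= andbT u0.
    under eq_integral do rewrite mulrC EFinM.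
    rewrite ge0_integralZl_EFin//.
    - transitivity ((b * u `^ (b - 1))%:E * (expR (- u))%:E)%E; first by rewrite -!EFinM mulrA.
      by congr (_ * _)%E; apply/esym; exact: (integral_expR_tail1 (ltW u0)).
    - by apply/measurable_EFinP; exact: measurable_funTS.
    - by rewrite mulr_ge0 ?powR_ge0// ltW.
  move=> u0; rewrite (_ : [set x | _] = set0) ?integral_set0//.
  by apply/seteqP; split => x //= /andP[].
exact: (@tonelli_region R (fun t u => (0 < u) && (u < t)) (fun t => expR (- t))
  (fun u => b * u `^ (b - 1)) mP me mk (fun x => expR_ge0 _)
  (fun x => mulr_ge0 (ltW b0) (powR_ge0 _ _))).
Qed.

Lemma integral_Gamma1 :
  (\int[mu]_(t in `]0%R, +oo[) (t `^ (1 - 1) * expR (- t))%:E = 1)%E.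
Proof.
have := @integral_expR_tail R 1 0 ltr01 (lexx _); rewrite mulr0 oppr0 expR0 => <-.
by apply: eq_integral => t _; rewrite subrr powRr0 !mul1r.
Qed.

(** [Gammaf] reads 0 on an infinite integral, so the quotient of Gamma values in [hyp2F1] can be
    simplified only once this integral is known to be finite and nonzero. *)
Lemma Gamma_fin_pos (b : R) : 0 < b -> b < 1 ->
  exists2 c : R, 0 < c &
    (\int[mu]_(t in `]0%R, +oo[) (t `^ (b - 1) * expR (- t))%:E = c%:E)%E.
Proof.
move=> b0 b1; set I := (\int[mu]_(_ in _) _)%E.
have mI (D : set R) : measurable_fun D (fun t : R => (t `^ (b - 1) * expR (- t))%:E).
  by apply/measurable_EFinP; exact: measurable_powR_expR.
have up : (I <= (b^-1)%:E + 1)%E.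
  rewrite /I -(integral01_powR b0) -integral_Gamma1.
  rewrite (_ : (\int[mu]_(t in `]0%R, 1%R[) (t `^ (b - 1))%:E)%E =
    (\int[mu]_(t in `]0%R, +oo[) (if t < 1 then t `^ (b - 1) else 0)%:E)%E); last first.
    rewrite [LHS]integral_mkcond [RHS]integral_mkcond; apply: eq_integral => t _.
    rewrite !patchE; case: ifPn; rewrite ?notin_setE ?inE /= in_itv/= => h;
      (case: ifPn; rewrite ?notin_setE ?inE /= in_itv/= andbT => h2) => //.
    - by case/andP: h => _ ->.
    - by case/andP: h => h; rewrite h in h2.
    - by case: ifPn => // t1; rewrite h2 t1 in h.
  rewrite -ge0_integralD//.
  - apply: ge0_le_integral => //.
    + by move=> t _; rewrite lee_fin mulr_ge0 ?powR_ge0 ?expR_ge0.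
    + exact: mI.
    + apply: emeasurable_funD; apply/measurable_EFinP; last exact: measurable_powR_expR.
      apply: measurable_funTS; apply: measurable_fun_ifT.
      * exact: measurable_fun_ltr.
      * exact: measurable_powR.
      * exact: measurable_cst.
    + move=> t; rewrite /= in_itv/= andbT -EFinD lee_fin => t0.
      rewrite subrr powRr0 mul1r; case: ifPn => t1.
        have : expR (- t) <= 1 by rewrite expR_le1 oppr_le0 ltW.
        have := powR_ge0 t (b - 1); have := expR_ge0 (- t); nra.
      rewrite add0r ler_piMl ?expR_ge0//; rewrite -leNgt in t1.
      by rewrite -[X in _ <= X](powRr0 t) ler_powR//; lra.
  - by move=> t _; rewrite lee_fin; case: ifPn => // _; rewrite powR_ge0.
  - apply/measurable_EFinP; apply: measurable_funTS; apply: measurable_fun_ifT.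
    + exact: measurable_fun_ltr.
    + exact: measurable_powR.
    + exact: measurable_cst.
  - by move=> t _; rewrite lee_fin mulr_ge0 ?powR_ge0 ?expR_ge0.
  - by apply/measurable_EFinP; exact: measurable_powR_expR.
have low : ((expR (-1))%:E <= I)%E.
  apply: (@le_trans _ _ (\int[mu]_(t in `]0%R, 1%R[) (t `^ (b - 1) * expR (- t))%:E)%E); last first.
    apply: ge0_subset_integral => //.
    - exact: mI.
    - by move=> t _; rewrite lee_fin mulr_ge0 ?powR_ge0 ?expR_ge0.
    - by move=> x /=; rewrite !in_itv/= andbT => /andP[].
  have <- : (\int[mu]_(t in `]0%R, 1%R[) (cst (expR (-1))%:E) t = (expR (-1))%:E)%E.
    rewrite integral_cst; last exact: measurable_itv.
    by have := @lebesgue_measure_itv R `]0, 1[; rewrite /= lte_fin ltr01 oppr0 adde0 => ->; rewrite mule1.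
  apply: ge0_le_integral => //; first by move=> t _; rewrite lee_fin expR_ge0.
    exact: mI.
  move=> t; rewrite /= in_itv/= lee_fin => /andP[t0 t1].
  rewrite -[X in X <= _]mul1r; apply: ler_pM; rewrite ?expR_ge0//.
    by rewrite -[X in X <= _](powRr0 t); apply: ger_powR; [rewrite t0 ltW|lra].
  by rewrite ler_expR lerN2 ltW.
move: I low up => [c| |] //; rewrite ?lee_fin.
- by move=> low _; exists c => //; apply: lt_le_trans low; exact: expR_gt0.
Qed.

Lemma Gammaf_ratio (b : R) : 0 < b -> b < 1 ->
  Gammaf (b + 1) / (Gammaf b * Gammaf 1) = b.
Proof.
move=> b0 b1; rewrite /Gammaf /Rintegral.
have [c c0 cE] := Gamma_fin_pos b0 b1.
rewrite Gamma_recurrence// cE integral_Gamma1 /= mulr1.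
by rewrite mulfK// gt_eqF.
Qed.

(** For these parameters c - b = 1: the factor in 1 - t disappears and the Gamma prefactor is b = 1
    - 2/eta. Bounding the integrand by t^(-2/eta) shows that the real-valued integral in [hyp2F1]
    loses nothing. *)
Lemma Fhyp_integral (eta s : R) : 2 < eta -> 0 <= s ->
  (\int[mu]_(t in `]0%R, 1%R[) (t `^ (- (2 / eta)) / (1 + s * t))%:E =
   (Fhyp eta (- s) / (1 - 2 / eta))%:E)%E.
Proof.
move=> eta2 s0; have eta0 : 0 < eta by lra.
have e0 : 0 < 2 / eta by rewrite divr_gt0.
have e1 : 2 / eta < 1 by rewrite ltr_pdivrMr// mul1r.
set I := (\int[mu]_(_ in _) _)%E.
have I0 : (0 <= I)%E.
  apply: integral_ge0 => t; rewrite /= in_itv/= => /andP[t0 _].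
  by rewrite lee_fin divr_ge0 ?powR_ge0// addr_ge0// mulr_ge0// ltW.
have Ifin : (I <= ((1 - 2 / eta)^-1)%:E)%E.
  rewrite -integral01_powR ?subr_gt0//; apply: ge0_le_integral => //.
  - move=> t; rewrite /= in_itv/= => /andP[t0 _].
    by rewrite lee_fin divr_ge0 ?powR_ge0// addr_ge0// mulr_ge0// ltW.
  - apply/measurable_EFinP; apply: measurable_funM; first exact: measurable_powR_itv.
    by apply: measurable_funV; apply: measurable_funD => //; exact: measurable_funM.
  - by apply/measurable_EFinP; exact: measurable_powR_itv.
  - move=> t; rewrite /= in_itv/= => /andP[t0 _]; rewrite lee_fin.
    rewrite (_ : 1 - 2 / eta - 1 = - (2 / eta)); last by ring.
    by rewrite ler_piMr ?powR_ge0// invf_le1 ?ler_wpDr ?ltr_wpDr// ?mulr_ge0// ltW.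
have IE : I = (fine I)%:E.
  by rewrite fineK// ge0_fin_numE// (le_lt_trans Ifin)// ltry.
rewrite IE; congr (_%:E); rewrite /Fhyp /hyp2F1.
rewrite (_ : 2 - 2 / eta - (1 - 2 / eta) = 1); last by ring.
rewrite (_ : 2 - 2 / eta = 1 - 2 / eta + 1); last by ring.
rewrite Gammaf_ratio ?subr_gt0//; last by lra.
rewrite mulrAC mulfV ?mul1r; last by rewrite gt_eqF// subr_gt0.
rewrite /Rintegral; congr fine; apply: eq_integral => t; rewrite inE/= in_itv/= => /andP[t0 t1].
rewrite subrr powRr0 mulr1 (_ : 1 - 2 / eta - 1 = - (2 / eta)); last by ring.
by rewrite powR_inv1 ?mulNr ?opprK// addr_ge0// mulr_ge0// ltW.
Qed.

End special_functions.

(** * Radial integrals over the plane and over the exterior of a disk *)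

Section radial_integrals.
Context (R : realType).
Notation mu := (@lebesgue_measure R).
Variable eta : R.
Hypothesis eta2 : 2 < eta.

Let eta0 : 0 < eta. Proof. exact: lt_trans eta2. Qed.

(** 1 - E exp(- s t h) for [h] exponential of mean 1: the loss due to one point of mean received
    power [t]. *)
Let sat (s t : R) := 1 - (1 + s * t)^-1.

Let satE (s t : R) : 0 <= s -> 0 <= t -> sat s t = s * t / (1 + s * t).
Proof.
move=> s0 t0; rewrite /sat; field.
by rewrite gt_eqF// ltr_wpDr// mulr_ge0.
Qed.

Let sat_ge0 (s t : R) : 0 <= s -> 0 <= t -> 0 <= sat s t.
Proof. by move=> s0 t0; rewrite satE// divr_ge0 ?addr_ge0 ?mulr_ge0. Qed.

Let measurable_sat (D : set R) (s q : R) :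
  measurable_fun D (fun r : R => sat s (r `^ q)).
Proof.
rewrite /sat; apply: measurable_funB => //; apply: measurable_funV.
apply: measurable_funD => //; apply: measurable_funM => //.
exact: measurable_powR_itv.
Qed.

(** Scaling the radius by [r0] extracts r0^2, and u = t^(-1/eta) maps the exterior to the unit
    interval. The factor 1/(eta - 2) is 1/eta from the Jacobian times 1/(1 - 2/eta) from
    [Fhyp_integral]. *)
Lemma integral_sat_outside (r0 s : R) : 0 < r0 -> 0 <= s ->
  (\int[(mu \x mu)%E]_x (if r0 < norm2 x
     then 1 - (1 + s * (r0 `^ eta * norm2 x `^ (- eta)))^-1 else 0)%:E =
   (2 * pi * r0 ^+ 2 * s / (eta - 2) * Fhyp eta (- s))%:E)%E.
Proof.
move=> r00 s0.
pose g (r : R) := if r0 < r then sat s (r0 `^ eta * r `^ (- eta)) else 0.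
have mg : measurable_fun setT g.
  apply: measurable_fun_ifT; [exact: measurable_fun_ltr| |exact: measurable_cst].
  apply: (eq_measurable_fun (fun r : R => sat (s * r0 `^ eta) (r `^ (- eta)))).
    by move=> r _; rewrite /sat mulrA.
  exact: measurable_sat.
have g0 r : 0 <= g r.
  by rewrite /g; case: ifPn => // _; rewrite sat_ge0// mulr_ge0 ?powR_ge0.
transitivity (\int[(mu \x mu)%E]_x (EFin \o g) (norm2 x))%E; first by [].
rewrite integral_polar; [|exact/measurable_EFinP|by move=> r; rewrite lee_fin].
pose G (r : R) := (sat s (r0 `^ eta * r `^ (- eta)) * (2 * pi * r))%:E.
have mG (D : set R) : measurable_fun D G.
  apply/measurable_EFinP; apply: measurable_funM.
    apply: (eq_measurable_fun (fun r : R => sat (s * r0 `^ eta) (r `^ (- eta)))).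
      by move=> r _; rewrite /sat mulrA.
    exact: measurable_sat.
  by apply: measurable_funM.
have pi0 : 0 <= pi :> R := pi_ge0 R.
transitivity (\int[mu]_(r in `]r0, +oo[) G r)%E.
  rewrite [LHS]integral_mkcond [RHS]integral_mkcond; apply: eq_integral => r _.
  rewrite !patchE /=; case: ifPn; rewrite ?notin_setE ?inE /= in_itv/= andbT => h;
    case: ifPn; rewrite ?notin_setE ?inE /= in_itv/= andbT => h2 //.
  - by rewrite /g h2 -EFinM.
  - by rewrite /g (negbTE (introN idP h2)) mul0e.
  - by case: h; exact: lt_trans h2.
rewrite (@integral_scale _ r0 _ `]1%R, +oo[%classic)//; last 4 first.
- by move=> t /=; rewrite !in_itv/= !andbT; exact: lt_trans.
- by move=> t /=; rewrite !in_itv/= !andbT; exact: lt_trans.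
- by move=> t t0; rewrite /= !in_itv/= !andbT -[X in X < r0 * t]mulr1 ltr_pM2l.
- move=> r; rewrite /= in_itv/= andbT => r1; rewrite lee_fin mulr_ge0 ?sat_ge0//.
    by rewrite mulr_ge0 ?powR_ge0.
  by rewrite !mulr_ge0// ltW// (lt_trans r00).
transitivity (\int[mu]_(u in `]1%R, +oo[)
    ((2 * pi * r0 ^+ 2)%:E * (sat s (u `^ (- eta)) * u)%:E))%E.
  apply: eq_integral => u; rewrite inE/= in_itv/= andbT => u1.
  have u0 : 0 < u by exact: lt_trans u1.
  rewrite /G -!EFinM; congr (_%:E).
  rewrite powRM ?(ltW r00) ?(ltW u0)// mulrA -powRD_gt0// subrr powRr0 mul1r.
  by ring.
have mS (D : set R) : measurable_fun D (fun u : R => (sat s (u `^ (- eta)) * u)%:E).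
  by apply/measurable_EFinP; apply: measurable_funM => //; exact: measurable_sat.
rewrite ge0_integralZl_EFin//; last 3 first.
- move=> u; rewrite /= in_itv/= andbT => u1; rewrite lee_fin mulr_ge0 ?sat_ge0 ?powR_ge0//.
  by rewrite (ltW (lt_trans _ u1)).
- exact: mS.
- by rewrite mulr_ge0 ?sqr_ge0// mulr_ge0.
rewrite (@integral1y_powR_subst _ eta^-1) ?invr_gt0//; last first.
  move=> u u1; rewrite lee_fin mulr_ge0 ?sat_ge0 ?powR_ge0//.
  by rewrite (ltW (lt_trans _ u1)).
transitivity ((2 * pi * r0 ^+ 2)%:E * \int[mu]_(t in `]0%R, 1%R[)
    ((s / eta)%:E * (t `^ (- (2 / eta)) / (1 + s * t))%:E))%E.
  congr (_ * _)%E; apply: eq_integral => t; rewrite inE/= in_itv/= => /andP[t0 t1].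
  rewrite -!EFinM; congr (_%:E).
  rewrite -powRrM mulrNN mulVf ?gt_eqF// powRr1 ?(ltW t0)// satE ?(ltW t0)//.
  rewrite (_ : - (2 / eta) = (- eta^-1) + (- eta^-1 - 1) + 1); last by ring.
  rewrite !(@powRD_gt0 _ t _ _ t0) powRr1 ?(ltW t0)//.
  set D := (1 + s * t)^-1; set w := t `^ _; set v := t `^ (-1).
  by ring.
rewrite ge0_integralZl_EFin//; last 3 first.
- move=> t; rewrite /= in_itv/= => /andP[t0 _].
  by rewrite lee_fin divr_ge0 ?powR_ge0// addr_ge0// mulr_ge0// ltW.
- apply/measurable_EFinP; apply: measurable_funM; first exact: measurable_powR_itv.
  by apply: measurable_funV; apply: measurable_funD => //; exact: measurable_funM.
- by rewrite divr_ge0// ltW.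
rewrite Fhyp_integral// -!EFinM; congr (_%:E).
field; rewrite (gt_eqF eta0)/=.
by rewrite !subr_eq0 ?gt_eqF.
Qed.

Lemma integral_sat_plane (s : R) : 0 <= s ->
  (\int[(mu \x mu)%E]_x (1 - (1 + s * norm2 x `^ (- eta))^-1)%:E =
   (2 * pi ^+ 2 / eta * s `^ (2 / eta) * csc (2 * pi / eta))%:E)%E.
Proof.
(* The case s = 0 is separate because the scaling factor used below would vanish. *)
rewrite le_eqVlt => /predU1P[<-|s0].
  rewrite powR0; last by rewrite gt_eqF// divr_gt0.
  rewrite mulr0 mul0r.
  by apply: integral0_eq => x _; rewrite mul0r addr0 invr1 subrr.
have s0' := ltW s0.
have mg : measurable_fun setT (fun r : R => sat s (r `^ (- eta))) by exact: measurable_sat.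
transitivity (\int[(mu \x mu)%E]_x (EFin \o (fun r : R => sat s (r `^ (- eta)))) (norm2 x))%E; first by [].
rewrite integral_polar; [|exact/measurable_EFinP|by move=> r; rewrite lee_fin sat_ge0 ?powR_ge0].
have pi0 : 0 <= pi :> R := pi_ge0 R.
(* Scaling the radius by s^(1/eta) normalises [s] to 1 and extracts c^2 = s^(2/eta). The
   substitution u = t^(1/eta) then gives the reflection integral at 2/eta, which lies in the unit
   interval because eta > 2. *)
pose c := s `^ eta^-1; have c0 : 0 < c by rewrite powR_gt0.
pose G (r : R) := (sat s (r `^ (- eta)) * (2 * pi * r))%:E.
have mG (D : set R) : measurable_fun D G.
  apply/measurable_EFinP; apply: measurable_funM; first exact: measurable_sat.
  by apply: measurable_funM.
transitivity (\int[mu]_(r in `]0%R, +oo[) G r)%E.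
  by apply: eq_integral => r _; rewrite /= -EFinM.
rewrite (@integral_scale _ c _ `]0%R, +oo[%classic)//; last 2 first.
- by move=> t t0; rewrite /= !in_itv/= !andbT pmulr_rgt0.
- move=> r; rewrite /= in_itv/= andbT => r1; rewrite lee_fin mulr_ge0 ?sat_ge0 ?powR_ge0//.
  by rewrite !mulr_ge0// ltW.
transitivity (\int[mu]_(u in `]0%R, +oo[)
    ((2 * pi * c ^+ 2)%:E * (sat 1 (u `^ (- eta)) * u)%:E))%E.
  apply: eq_integral => u; rewrite inE/= in_itv/= andbT => u0.
  rewrite /G -!EFinM; congr (_%:E).
  rewrite powRM ?(ltW c0) ?(ltW u0)// /sat mulrA [in s * _](_ : c `^ (- eta) = s^-1); last first.
    by rewrite /c -powRrM mulrN mulVf ?gt_eqF// powR_inv1.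
  by rewrite mulfV ?gt_eqF// mul1r; ring.
have mS (D : set R) : measurable_fun D (fun u : R => (sat 1 (u `^ (- eta)) * u)%:E).
  by apply/measurable_EFinP; apply: measurable_funM => //; exact: measurable_sat.
rewrite ge0_integralZl_EFin//; last 3 first.
- move=> u; rewrite /= in_itv/= andbT => u1; rewrite lee_fin mulr_ge0 ?sat_ge0 ?powR_ge0//.
  exact: ltW.
- exact: mS.
- by rewrite mulr_ge0 ?sqr_ge0// mulr_ge0.
rewrite (@integral_powR_subst_set _ eta^-1 _ `]0%R, +oo[%classic)//; last 3 first.
- by rewrite gt_eqF// invr_gt0.
- by move=> t t0; rewrite /= !in_itv/= !andbT powR_gt0.
- move=> u; rewrite /= in_itv/= andbT => u1; rewrite lee_fin mulr_ge0 ?sat_ge0 ?powR_ge0//.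
  exact: ltW.
transitivity ((2 * pi * c ^+ 2)%:E * \int[mu]_(t in `]0%R, +oo[)
    ((eta^-1)%:E * (t `^ (2 / eta - 1) / (1 + t))%:E))%E.
  congr (_ * _)%E; apply: eq_integral => t; rewrite inE/= in_itv/= andbT => t0.
  rewrite -!EFinM; congr (_%:E).
  rewrite -powRrM mulrN mulVf ?gt_eqF// powR_inv1 ?(ltW t0)// gtr0_norm ?invr_gt0//.
  rewrite satE ?invr_ge0 ?(ltW t0)//.
  rewrite (_ : 2 / eta - 1 = eta^-1 + (eta^-1 - 1)); last by ring.
  rewrite (@powRD_gt0 _ t eta^-1 (eta^-1 - 1) t0).
  set w := t `^ _; set v := t `^ (_ - 1).
  by field; rewrite !gt_eqF// addr_gt0.
rewrite ge0_integralZl_EFin//; last 3 first.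
- move=> t; rewrite /= in_itv/= andbT => t0.
  by rewrite lee_fin divr_ge0 ?powR_ge0// addr_ge0// ltW.
- apply/measurable_EFinP; apply: measurable_funM; first exact: measurable_powR_itv.
  by apply: measurable_funV; exact: measurable_funD.
- by rewrite invr_ge0 ltW.
rewrite integral0y_csc; last 2 first.
- by rewrite divr_gt0.
- by rewrite ltr_pdivrMr// mul1r.
rewrite -!EFinM; congr (_%:E); rewrite /csc.
rewrite (_ : c ^+ 2 = s `^ (2 / eta)); last first.
  by rewrite -powR_mulrn ?(ltW c0)// /c -powRrM; congr (_ `^ _); ring.
rewrite (_ : pi * (2 / eta) = 2 * pi / eta); last by ring.
by ring.
Qed.

End radial_integrals.

(** * The complementary error function *)

Section error_function.
Context (R : realType).
Notation mu := (@lebesgue_measure R).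

Let gauss_tail_fin (x : R) :
  (\int[mu]_(t in `[x, +oo[) (gauss_fun t)%:E)%E \is a fin_num.
Proof.
rewrite ge0_fin_numE; last by apply: integral_ge0 => t _; rewrite lee_fin gauss_fun_ge0.
apply: (@le_lt_trans _ _ (\int[mu]_t (gauss_fun t)%:E)%E); last first.
  by rewrite integralT_gauss ltry.
apply: ge0_subset_integral => //.
- by apply/measurable_EFinP; exact: measurable_gauss_fun.
- by move=> t _; rewrite lee_fin gauss_fun_ge0.
Qed.

Let sqrtpi0 : 0 < Num.sqrt pi :> R. Proof. by rewrite sqrtr_gt0 pi_gt0. Qed.

Lemma erfc_nonincreasing (x y : R) : x <= y -> erfc y <= erfc x.
Proof.
move=> xy; rewrite /erfc ler_wpM2l ?divr_ge0 ?(ltW sqrtpi0)//.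
apply: fine_le; try exact: gauss_tail_fin.
apply: ge0_subset_integral => //.
- by apply/measurable_EFinP; apply: measurable_funTS; exact: measurable_gauss_fun.
- by move=> t /=; rewrite !in_itv/= !andbT; exact: le_trans.
Qed.

Lemma measurable_erfc : measurable_fun setT (@erfc R).
Proof.
by apply: nonincreasing_measurable => // x y; exact: erfc_nonincreasing.
Qed.

Lemma erfc_ge0 (x : R) : 0 <= erfc x.
Proof.
rewrite mulr_ge0 ?divr_ge0 ?(ltW sqrtpi0)// fine_ge0//.
by apply: integral_ge0 => t _; rewrite lee_fin expR_ge0.
Qed.

Lemma erfc_compl (x : R) : 0 <= x ->
  ((1 - erfc x)%:E =
   \int[mu]_(t in `[0%R, x[) (2 / Num.sqrt pi * expR (- (t ^+ 2)))%:E)%E.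
Proof.
move=> x0.
have mg (D : set R) : measurable_fun D (fun t : R => (expR (- (t ^+ 2)))%:E).
  by apply/measurable_EFinP; apply: measurable_funTS; exact: measurable_gauss_fun.
under eq_integral do rewrite EFinM.
rewrite ge0_integralZl_EFin ?divr_ge0 ?(ltW sqrtpi0)//; last first.
  exact: mg.
have := @integral0y_gauss R.
rewrite (@itv_bndbnd_setU _ _ (BLeft (0:R)) (BLeft x) +oo%O) ?bnd_simp//.
rewrite ge0_integral_setU//; last 3 first.
- exact: mg.
- by move=> t _; rewrite lee_fin gauss_fun_ge0.
- apply/disj_setPS => t [/=]; rewrite !in_itv/= => /andP[_ x1] /andP[/(lt_le_trans x1)].
  by rewrite ltxx.
rewrite /erfc /Rintegral -(fineK (gauss_tail_fin x)) /=.
have : (0 <= \int[mu]_(t in `[0%R, x[) (gauss_fun t)%:E)%E.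
  by apply: integral_ge0 => t _; rewrite lee_fin gauss_fun_ge0.
rewrite /gauss_fun.
case: (\int[mu]_(t in `[0%R, x[) _)%E => [a| |]//= _ [h].
rewrite -EFinM; congr (_%:E).
have h1 : 2 / Num.sqrt pi * (Num.sqrt pi / 2) = 1 :> R.
  by field; rewrite gt_eqF.
by rewrite -[X in X - _]h1 -h; ring.
Qed.

Lemma erfc_compl01 (x : R) : 0 <= x -> 0 <= 1 - erfc x <= 1.
Proof.
move=> x0; rewrite -lee_fin erfc_compl// gerBl erfc_ge0 andbT.
apply: integral_ge0 => t _; rewrite lee_fin mulr_ge0 ?expR_ge0//.
Qed.

Lemma expected_erfc (om2 Y : R) : 0 < om2 -> 0 < Y ->
  (\int[mu]_h (exponential_pdf 1 h * (1 - erfc (Num.sqrt (om2 * (h / Y)))))%:E =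
   \int[mu]_(z in `]0%R, +oo[)
     ((Num.sqrt (pi * z))^-1 * expR (- (z * (1 + Y / om2))))%:E)%E.
Proof.
move=> om20 Y0; pose ka := om2 / Y; have ka0 : 0 < ka by rewrite divr_gt0.
(* The Gaussian integral for 1 - erfc runs over t < sqrt (ka h). Written as t^2 < ka h, the same
   region can be solved for [h], and the exponential tail beyond t^2 / ka is exp(- t^2 / ka). *)
pose P (h t : R) := [&& 0 <= h, 0 <= t & t ^+ 2 < ka * h].
pose k (t : R) := 2 / Num.sqrt pi * expR (- (t ^+ 2)).
have mP : measurable_fun setT (fun x : R * R => P x.1 x.2).
  apply: measurable_and; first exact: measurable_fun_ler.
  apply: measurable_and; first exact: measurable_fun_ler.
  by apply: measurable_fun_ltr; [exact: measurable_funX|exact: measurable_funM].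
have me : measurable_fun setT (fun h : R => expR (- h)) by exact: (measurableT_comp (f := @expR R)).
have mk : measurable_fun setT k by apply: measurable_funM => //; exact: measurable_gauss_fun.
have k0 t : 0 <= k t by rewrite mulr_ge0 ?expR_ge0// divr_ge0// ltW.
transitivity (\int[mu]_h \int[mu]_t (if P h t then expR (- h) * k t else 0)%:E)%E.
  apply: eq_integral => h _; rewrite integral_if.
  have [h0|h0] := leP 0 h; last first.
    rewrite lt0_exponential_pdf// mul0r (_ : [set x | _] = set0) ?integral_set0//.
    by apply/seteqP; split => t //= /and3P[/(lt_le_trans h0)]; rewrite ltxx.
  rewrite (_ : [set x | _] = `[0%R, Num.sqrt (om2 * (h / Y))[%classic); last first.
    have kh : om2 * (h / Y) = ka * h by rewrite /ka; ring.
    have sE t : 0 <= t -> (t < Num.sqrt (ka * h)) = (t ^+ 2 < ka * h).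
      move=> t0; rewrite -[X in X < _](ger0_norm t0) -sqrtr_sqr.
      have [->|n0] := eqVneq h 0.
        by rewrite mulr0 sqrtr0 !ltNge sqrtr_ge0 sqr_ge0.
      by rewrite ltr_sqrt// mulr_gt0// lt_neqAle eq_sym n0.
    apply/seteqP; split => t /=; rewrite in_itv/= kh.
      by move=> /and3P[_ t0 th]; rewrite t0 sE.
    by move=> /andP[t0]; rewrite sE// /P h0 t0.
  under eq_integral do rewrite EFinM.
  rewrite ge0_integralZl_EFin ?expR_ge0//; last 2 first.
  - by move=> t _; rewrite lee_fin.
  - by apply/measurable_EFinP; exact: measurable_funTS.
  rewrite exponential_pdfE// mulN1r mul1r EFinM; congr (_ * _)%E.
  by apply: erfc_compl; exact: sqrtr_ge0.
transitivity (\int[mu]_t \int[mu]_h (if P h t then expR (- h) * k t else 0)%:E)%E.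
  exact: (@tonelli_region R P (fun h => expR (- h)) k mP me mk (fun h => expR_ge0 _) k0).
transitivity (\int[mu]_(t in `[0%R, +oo[) (2 / Num.sqrt pi * expR (- (t ^+ 2 * (1 + Y / om2))))%:E)%E.
  rewrite [RHS]integral_mkcond; apply: eq_integral => t _; rewrite integral_if patchE.
  case: ifPn; rewrite ?notin_setE ?inE /= in_itv/= andbT => t0; last first.
    rewrite (_ : [set x | _] = set0) ?integral_set0//.
    by apply/seteqP; split => h //= /and3P[_ t1 _].
  have tk0 : 0 <= t ^+ 2 / ka by rewrite divr_ge0 ?sqr_ge0// ltW.
  rewrite (_ : [set x | _] = `](t ^+ 2 / ka), +oo[%classic); last first.
    apply/seteqP; split => h; rewrite /P /= in_itv/= andbT.
      by move=> /and3P[_ _]; rewrite ltr_pdivrMr// mulrC.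
    move=> th; rewrite (ltW (le_lt_trans tk0 th)) t0/=.
    by move: th; rewrite ltr_pdivrMr// mulrC.
  under eq_integral do rewrite mulrC EFinM.
  rewrite ge0_integralZl_EFin//; last first.
    by apply/measurable_EFinP; exact: measurable_funTS.
  transitivity ((k t)%:E * (expR (- (t ^+ 2 / ka)))%:E)%E.
    by congr (_ * _)%E; exact: (integral_expR_tail1 tk0).
  rewrite -EFinM /k; congr (_%:E); rewrite -[LHS]mulrA; congr (_ * _).
  by rewrite -[LHS]expRD /ka invf_div; congr expR; ring.
have mR (D : set R) : measurable_fun D (fun t : R =>
    (2 / Num.sqrt pi * expR (- (t ^+ 2 * (1 + Y / om2))))%:E).
  apply/measurable_EFinP; apply: measurable_funM => //.
  apply: (measurableT_comp (f := @expR R)) => //; apply: measurable_funN.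
  by apply: measurable_funM => //; exact: measurable_funX.
rewrite -integral_itv_obnd_cbnd; last exact: mR.
(* The substitution z = t^2 absorbs the factor 1 / sqrt (pi z). *)
rewrite [RHS](@integral_powR_subst _ 2)//; last first.
  apply/measurable_EFinP; apply: measurable_funM.
    apply: measurable_funV; apply: (measurableT_comp (f := @Num.sqrt R)).
      apply: continuous_measurable_fun; exact: sqrt_continuous.
    exact: measurable_funM.
  apply: (measurableT_comp (f := @expR R)) => //; apply: measurable_funN.
  exact: measurable_funM.
apply: eq_integral => t; rewrite inE/= in_itv/= andbT => t0.
rewrite -EFinM; congr (_%:E).
rewrite (_ : 2 - 1 = 1); last by ring.
rewrite powRr1 ?(ltW t0)// (powR_mulrn 2) ?(ltW t0)// gtr0_norm//.
rewrite sqrtrM ?pi_ge0// sqrtr_sqr gtr0_norm//.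
set E := expR _; set s := Num.sqrt pi.
by field; rewrite (gt_eqF t0) gt_eqF.
Qed.

End error_function.

(** * Second moment of the truncated distance law *)

Section power_moment.
Context (R : realType).
Notation mu := (@lebesgue_measure R).
Variables (lam rmx : R).
Hypothesis lam0 : 0 < lam.
Hypothesis rmx0 : 0 < rmx.

Let X := pi * lam * rmx ^+ 2.

Lemma fR_den_gt0 : 0 < 1 - expR (- (pi * lam * rmx ^+ 2)).
Proof. by rewrite subr_gt0 expR_lt1 oppr_lt0 !mulr_gt0// ?pi_gt0// exprn_gt0. Qed.

Lemma fR_ge0 r : 0 <= fR lam rmx r.
Proof.
rewrite /fR; case: ifPn => // /andP[r0 _].
by rewrite divr_ge0 ?(ltW fR_den_gt0)// !mulr_ge0 ?expR_ge0 ?pi_ge0// ltW.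
Qed.

Lemma measurable_fR : measurable_fun setT (fR lam rmx).
Proof.
apply: measurable_fun_ifT; last exact: measurable_cst.
  by apply: measurable_and; exact: measurable_fun_ler.
apply: measurable_funM => //; apply: measurable_funM; first exact: measurable_funM.
apply: (measurableT_comp (f := @expR R)) => //; apply: measurable_funN.
by apply: measurable_funM => //; exact: measurable_funX.
Qed.

(** Under t = pi lam r^2 the distance law becomes a truncated exponential law, whose mean is an
    incomplete gamma integral divided by the truncated mass. *)
Lemma second_moment :
  (\int[mu]_r (r ^+ 2 * fR lam rmx r)%:E =
   (lower_gamma 2 X / (pi * lam * (1 - expR (- X))))%:E)%E.
Proof.
have pl0 : 0 < pi * lam by rewrite mulr_gt0// pi_gt0.
have X0 : 0 < X by rewrite mulr_gt0// exprn_gt0.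
have den0 := fR_den_gt0.
have mg (D : set R) : measurable_fun D (fun t : R => (t `^ (2 - 1) * expR (- t))%:E).
  by apply/measurable_EFinP; exact: measurable_powR_expR.
pose I := (\int[mu]_(t in `]0%R, X[) (t `^ (2 - 1) * expR (- t))%:E)%E.
have I0 : (0 <= I)%E.
  by apply: integral_ge0 => t _; rewrite lee_fin mulr_ge0 ?powR_ge0 ?expR_ge0.
have IE : I = (fine I)%:E.
  rewrite fineK// ge0_fin_numE//.
  apply: (@le_lt_trans _ _ (\int[mu]_(t in `]0%R, X[) (cst 1%E) t)%E); last first.
    rewrite integral_cst; last exact: measurable_itv.
    by have := @lebesgue_measure_itv R `]0, X[; rewrite /= lte_fin X0 oppr0 adde0 mul1e => ->; rewrite ltry.
  apply: ge0_le_integral => //.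
  - by move=> t _; rewrite lee_fin mulr_ge0 ?powR_ge0 ?expR_ge0.
  - exact: mg.
  - move=> t; rewrite /= in_itv/= => /andP[t0 _]; rewrite lee_fin.
    rewrite (_ : 2 - 1 = 1); last by ring.
    rewrite powRr1 ?(ltW t0)// expRN ler_pdivrMr ?expR_gt0// mul1r.
    by have := expR_ge1Dx t; lra.
(* The change t = (c r)^2 is made in two moves: the power substitution with exponent 2, then a
   scaling by [c]. *)
pose c := Num.sqrt (pi * lam); have c0 : 0 < c by rewrite sqrtr_gt0.
have c2 : c ^+ 2 = pi * lam by rewrite sqr_sqrtr// ltW.
have I2 : (I = \int[mu]_(r in `]0%R, rmx[)
    ((pi * lam * (1 - expR (- X)))%:E * (r ^+ 2 * fR lam rmx r)%:E))%E.
  rewrite /I (@integral_powR_subst_set _ 2 _ `]0%R, (c * rmx)[%classic)//; first last.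
  - by move=> t _; rewrite lee_fin mulr_ge0 ?powR_ge0 ?expR_ge0.
  - move=> t t0; rewrite /= !in_itv/= t0 powR_gt0//= (powR_mulrn 2) ?(ltW t0)//.
    by rewrite /X -c2 -exprMn ltr_sqr ?nnegrE ?(ltW t0)// ltW// mulr_gt0.
  - by move=> x /=; rewrite !in_itv/= andbT => /andP[].
  - by move=> x /=; rewrite !in_itv/= andbT => /andP[].
  rewrite (@integral_scale _ c _ `]0%R, rmx[%classic)//; first last.
  - by move=> t _; rewrite mule_ge0// lee_fin mulr_ge0 ?powR_ge0 ?expR_ge0.
  - apply: emeasurable_funM; apply/measurable_EFinP; last first.
      by apply: measurable_funM => //; exact: measurable_powR_itv.
    have m2 : measurable_fun setT (fun t : R => t `^ 2) by exact: measurable_powR.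
    apply: measurable_funTS.
    apply: (measurableT_comp (f := fun s : R => s `^ (2 - 1) * expR (- s)) _ m2).
    exact: measurable_powR_expR.
  - by move=> t t0; rewrite /= !in_itv/= t0 mulr_gt0//= ltr_pM2l.
  - by move=> x /=; rewrite !in_itv/= andbT => /andP[].
  - by move=> x /=; rewrite !in_itv/= andbT => /andP[].
  apply: eq_integral => r; rewrite inE/= in_itv/= => /andP[r0 r1].
  rewrite -!EFinM; congr (_%:E).
  rewrite (_ : 2 - 1 = 1); last by ring.
  have cr0 : 0 < c * r by rewrite mulr_gt0.
  rewrite !powRr1 ?powR_ge0 ?(ltW cr0)// (powR_mulrn 2) ?(ltW cr0)//.
  rewrite /fR (ltW r0) (ltW r1)/= exprMn c2 gtr0_norm//.
  rewrite (_ : _ * c = pi * lam * r ^+ 2 * expR (- (pi * lam * r ^+ 2)) * (2 * r) * c ^+ 2); last by ring.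
  rewrite c2 /X; set E := expR (- (pi * lam * r ^+ 2)).
  by field; rewrite gt_eqF.
have I3 : (I = (pi * lam * (1 - expR (- X)))%:E * \int[mu]_r (r ^+ 2 * fR lam rmx r)%:E)%E.
  rewrite I2 ge0_integralZl_EFin//; last 3 first.
  - by move=> r _; rewrite lee_fin mulr_ge0 ?sqr_ge0 ?fR_ge0.
  - apply/measurable_EFinP; apply: measurable_funM; first exact: measurable_funX.
    by apply: measurable_funTS; exact: measurable_fR.
  - by rewrite mulr_ge0// ltW.
  congr (_ * _)%E.
  rewrite -(@integral_itv_bndoo _ _ _ _ true false); last first.
    apply/measurable_EFinP; apply: measurable_funM; first exact: measurable_funX.
    by apply: measurable_funTS; exact: measurable_fR.
  rewrite integral_mkcond; apply: eq_integral => r _; rewrite patchE /fR.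
  case: ifPn; rewrite ?notin_setE ?inE /= in_itv/= => h; first by rewrite h.
  by rewrite ifN ?mulr0//; exact/negP.
rewrite (_ : lower_gamma 2 X = fine I)//.
have k0 : pi * lam * (1 - expR (- X)) != 0 by rewrite gt_eqF// mulr_gt0.
have I4 : (I * ((pi * lam * (1 - expR (- X)))^-1)%:E)%E = (fine I / (pi * lam * (1 - expR (- X))))%:E.
  by rewrite {1}IE -EFinM.
by rewrite -I4 I3 muleAC -EFinM mulfV// mul1e.
Qed.

End power_moment.

(** * Integration against independent sigma-algebras *)

Lemma bigsetI_seqP (I : eqType) T (J : seq I) (C : I -> set T) (w : T) :
  (\big[setI/setT]_(i <- J) C i) w <-> (forall i, i \in J -> C i w).
Proof.
elim: J => [|j J IH]; first by rewrite big_nil.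
rewrite big_cons; split.
  by move=> [Cj /IH CJ] i; rewrite inE => /predU1P[->|/CJ].
move=> CJ; split; first exact: CJ (mem_head _ _).
by apply/IH => i iJ; apply: CJ; rewrite inE iJ orbT.
Qed.

Lemma bounded_convergence d (Omega : measurableType d) (R : realType)
    (P : probability Omega R) (f_ : nat -> Omega -> R) (f : Omega -> R) :
  (forall n, measurable_fun setT (f_ n)) -> measurable_fun setT f ->
  {ae P, forall w, f_ ^~ w @ \oo --> f w} ->
  (forall n w, 0 <= f_ n w <= 1) ->
  (\int[P]_w (f_ n w)%:E)%E @[n --> \oo] --> (\int[P]_w (f w)%:E)%E.
Proof.
move=> mf_ mf ff f01.
have h1 n : measurable_fun setT (fun w => (f_ n w)%:E) by exact/measurable_EFinP.
have h2 : measurable_fun setT (fun w => (f w)%:E) by exact/measurable_EFinP.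
have h3 : {ae P, forall w, setT w -> (f_ n w)%:E @[n --> \oo] --> (f w)%:E}.
  by apply: filterS ff => w fw _; apply: cvg_EFin fw; exact: nearW.
have h4 : P.-integrable setT (cst 1%E) by exact: finite_measure_integrable_cst.
have h5 : {ae P, forall w, forall n, setT w -> (`|(f_ n w)%:E| <= cst 1 w)%E}.
  by apply: aeW => w n _; have /andP[f0 f1] := f01 n w; rewrite gee0_abs ?lee_fin.
by have [_ _] := dominated_convergence measurableT h1 h2 h3 h4 h5.
Qed.

Lemma integral_unit_fin d (Omega : measurableType d) (R : realType)
    (P : probability Omega R) (f : Omega -> R) :
  measurable_fun setT f -> (forall w, 0 <= f w <= 1) ->
  (\int[P]_w (f w)%:E = (fine (\int[P]_w (f w)%:E))%:E)%E.
Proof.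
move=> mf f01; rewrite fineK// ge0_fin_numE; last first.
  by apply: integral_ge0 => w _; rewrite lee_fin; have /andP[] := f01 w.
apply: (@le_lt_trans _ _ (\int[P]_w (cst 1 w))%E); last first.
  by rewrite integral_cst// mul1e (le_lt_trans (probability_le1 _ _)) ?ltry.
apply: ge0_le_integral => //.
- by move=> w _; rewrite lee_fin; have /andP[] := f01 w.
- exact/measurable_EFinP.
- by move=> w _; rewrite lee_fin; have /andP[] := f01 w.
Qed.

Section independence.
Context d (Omega : measurableType d) (R : realType) (P : probability Omega R).

(** Independence on rectangles identifies the law of the pair with the product of the two laws. *)
Lemma indep_fubini d1 d2 (T1 : measurableType d1) (T2 : measurableType d2)
    (V : Omega -> T1) (W : Omega -> T2) (f : T1 * T2 -> \bar R) :
  measurable_fun setT V -> measurable_fun setT W ->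
  (forall A B, measurable A -> measurable B ->
    P (V @^-1` A `&` W @^-1` B) = (P (V @^-1` A) * P (W @^-1` B))%E) ->
  measurable_fun setT f -> (forall x, 0 <= f x)%E ->
  (\int[P]_w f (V w, W w) = \int[P]_w \int[P]_w' f (V w, W w'))%E.
Proof.
move=> mV mW VW mf f0.
pose V' : {mfun Omega >-> T1} := HB.pack V (isMeasurableFun.Build _ _ _ _ V mV).
pose W' : {mfun Omega >-> T2} := HB.pack W (isMeasurableFun.Build _ _ _ _ W mW).
have mVW : measurable_fun setT (fun w => (V w, W w)).
  by apply: measurable_fun_pair.
pose m1 := distribution P V'; pose m2 := distribution P W'.
pose VW' : {mfun Omega >-> (T1 * T2)%type} :=
  HB.pack (fun w => (V w, W w)) (isMeasurableFun.Build _ _ _ _ _ mVW).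
pose m := distribution P VW'.
have mE X : measurable X -> (m1 \x m2)%E X = m X.
  apply: product_measure_unique => A B mA mB.
  rewrite /m /m1 /m2 /distribution /pushforward/= -VW//.
transitivity (\int[m]_x f x)%E.
  by rewrite /m ge0_integral_distribution.
transitivity (\int[(m1 \x m2)%E]_x f x)%E.
  by apply: eq_measure_integral => A mA _; apply/esym; exact: mE.
rewrite fubini_tonelli1//.
rewrite /m1 ge0_integral_distribution//; last 2 first.
- exact: measurable_fun_fubini_tonelli_F.
- by move=> x; exact: integral_ge0.
apply: eq_integral => w _ /=; rewrite /fubini_F /m2 ge0_integral_distribution//.
exact: measurable_fun_pair2.
Qed.

Section family.
Context (I : eqType) (F : I -> set (set Omega)).
Hypothesis Fm : forall i, F i `<=` measurable.
Hypothesis FT : forall i, F i setT.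
Hypothesis FI : forall i, setI_closed (F i).
Hypothesis Find : mutually_independent P F.

Definition sigma_join (S : set I) : set (set Omega) :=
  <<s \bigcup_(i in S) F i >>.

(** [Omega] with a coarser sigma-algebra: measurability on [joinType S] says that a function depends
    only on the sources in [S], without building a product space of their values. *)
Definition joinType (S : set I) := g_sigma_algebraType (\bigcup_(i in S) F i).

Lemma sigma_join_measurable S : sigma_join S `<=` measurable.
Proof.
apply: smallest_sub; first exact: sigma_algebra_measurable.
by move=> A [i _]; exact: Fm.
Qed.

Lemma sigma_join_sub (S : set I) i : S i -> F i `<=` sigma_join S.
Proof. by move=> Si A FA; apply: sub_gen_smallest; exists i. Qed.

Lemma sigma_join_mono (S S' : set I) : S `<=` S' -> sigma_join S `<=` sigma_join S'.
Proof.
move=> SS'; apply: sub_smallest2r; first exact: smallest_sigma_algebra.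
by move=> A [i Si FA]; exists i => //; exact: SS'.
Qed.

Lemma sigma_join_indep (S : set I) (j : I) (A B : set Omega) :
  ~ S j -> sigma_join S A -> F j B -> P (A `&` B) = (P A * P B)%E.
Proof.
move=> Sj SA FB; have mB := Fm FB.
(* Finite intersections of events from the sources in [S] form a pi-system generating
   [sigma_join S]. Padding with [setT] outside [J] lets two of them be intersected index by
   index. *)
pose G := [set E | exists (J : seq I) (C : I -> set Omega),
  [/\ uniq J, forall i, i \in J -> S i, forall i, F i (C i),
      forall i, i \notin J -> C i = setT & E = \bigcap_i C i]].
have GE (J : seq I) (C : I -> set Omega) : (forall i, i \notin J -> C i = setT) ->
    \bigcap_i C i = \big[setI/setT]_(i <- J) C i.
  move=> CT; apply/seteqP; split => w Cw.
    by apply/bigsetI_seqP => i _; exact: Cw.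
  move/bigsetI_seqP : Cw => Cw i _.
  by have [iJ|iJ] := boolP (i \in J); [exact: Cw|rewrite CT].
have Gm : G `<=` measurable.
  move=> E [J [C [_ _ FC CT ->]]]; rewrite (GE J)//.
  by apply: bigsetI_measurable => i _; exact: Fm (FC i).
have GT : G setT.
  exists [::], (fun=> setT); split => //.
  by apply/esym; rewrite -subTset.
have GI : setI_closed G.
  move=> _ _ [J1 [C1 [u1 S1 F1 T1 ->]]] [J2 [C2 [u2 S2 F2 T2 ->]]].
  exists (undup (J1 ++ J2)), (fun i => C1 i `&` C2 i); split.
  - exact: undup_uniq.
  - by move=> i; rewrite mem_undup mem_cat => /orP[/S1|/S2].
  - by move=> i; exact: FI.
  - move=> i; rewrite mem_undup mem_cat negb_or => /andP[i1 i2].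
    by rewrite T1// T2// setTI.
  - by rewrite bigcapI.
have PB : (P B = (fine (P B))%:E) by rewrite fineK// fin_num_measure.
have k0 : 0 <= fine (P B) by rewrite fine_ge0.
(* Two finite measures, the trace of [P] on [B] and the multiple of [P] by the mass of [B]. They
   agree on the pi-system, hence on the sigma-algebra it generates. *)
pose m1 := mrestr P mB.
pose m2 := mscale (NngNum k0) P.
have m2E C : m2 C = (P C * P B)%E by rewrite /m2 /mscale /= -PB muleC.
suff : m1 A = m2 A by rewrite m2E.
apply: (@g_sigma_algebra_measure_unique _ _ _ G Gm (fun=> setT) (fun=> GT) _ m1 m2) => //.
- by rewrite bigcup_const.
- move=> _ [J [C [uJ SJ FC CT ->]]]; apply: eq_trans; last exact/esym/m2E.
  change (P (\bigcap_i C i `&` B) = (P (\bigcap_i C i) * P B)%E).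
  have jJ : j \notin J by apply/negP => /SJ.
  pose C' i := if i == j then B else C i.
  have -> : \bigcap_i C i `&` B = \big[setI/setT]_(i <- j :: J) C' i.
    rewrite big_cons (GE J)// setIC /C' eqxx; congr (_ `&` _).
    apply: eq_big_seq => i iJ; case: eqP => // ij; by rewrite -ij iJ in jJ.
  have -> : \bigcap_i C i = \big[setI/setT]_(i <- J) C' i.
    rewrite (GE J)//; apply: eq_big_seq => i iJ; rewrite /C'.
    by case: eqP => // ij; rewrite -ij iJ in jJ.
  have FC' i : F i (C' i) by rewrite /C'; case: eqP => [->|].
  rewrite !Find//; first by rewrite big_cons /C' eqxx muleC.
  by rewrite /= jJ.
- by move=> k; rewrite (le_lt_trans (probability_le1 _ _)) ?ltry// setTI.
- move: SA; apply: sub_smallest2r; first exact: smallest_sigma_algebra.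
  move=> E [i Si FE]; exists [:: i], (fun k => if k == i then E else setT).
  split => //.
  - by move=> k; rewrite inE => /eqP ->.
  - by move=> k; case: eqP => [->|].
  - by move=> k; rewrite inE => /negbTE ->.
  - apply/seteqP; split => w Ew; first by move=> k _; case: eqP.
    by have := Ew i Logic.I; rewrite eqxx.
Qed.

Lemma measurable_fun_join d' (T : measurableType d') (S : set I) i (X : Omega -> T) :
  S i -> (forall B, measurable B -> F i (X @^-1` B)) ->
  measurable_fun setT (X : joinType S -> T).
Proof.
by move=> Si FX _ B mB; rewrite setTI; apply: (sigma_join_sub Si); exact: FX.
Qed.

Lemma measurable_fun_joinW d' (T : measurableType d') (S : set I) (X : joinType S -> T) :
  measurable_fun setT X -> measurable_fun setT (X : Omega -> T).
Proof.
move=> mX _ B mB; rewrite setTI; apply: (@sigma_join_measurable S).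
by have := mX measurableT B mB; rewrite setTI.
Qed.

Lemma measurable_id_join (S S' : set I) : S `<=` S' ->
  measurable_fun setT (id : joinType S' -> joinType S).
Proof.
by move=> SS' _ B mB; rewrite setTI preimage_id; exact: (sigma_join_mono SS').
Qed.

Lemma measurable_id_joinT (S : set I) :
  measurable_fun setT (id : Omega -> joinType S).
Proof. by move=> _ B mB; rewrite setTI preimage_id; exact: (@sigma_join_measurable S). Qed.

(** The identity, seen as a map to [joinType S], plays the role of the vector of all sources in
    [S]. *)
Lemma indep_fubini_join d' (T : measurableType d') (S : set I) j (X : Omega -> T)
    (f : joinType S * T -> \bar R) :
  ~ S j -> (forall B, measurable B -> F j (X @^-1` B)) ->
  measurable_fun setT f -> (forall x, 0 <= f x)%E ->
  (\int[P]_w f (w, X w) = \int[P]_w \int[P]_w' f (w, X w'))%E.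
Proof.
move=> Sj FX mf f0.
apply: (@indep_fubini _ _ (joinType S) T id X f) => //.
- exact: measurable_id_joinT.
- by move=> _ B mB; rewrite setTI; exact: Fm (FX _ mB).
- move=> A B mA mB; rewrite preimage_id; apply: (sigma_join_indep Sj) => //.
  exact: FX.
Qed.

(** One factor is averaged at a time, with the later ones frozen. The average depends on [S] alone,
    so it can be absorbed into the weight [A], over which the induction generalises. *)
Lemma integrate_out (S : set I) (X : I -> Omega -> R) (f : I -> joinType S * R -> R)
    (fbar : I -> joinType S -> R) (A : joinType S -> R) (L : seq I) :
  uniq L -> (forall j, j \in L -> ~ S j) ->
  (forall j B, j \in L -> measurable B -> F j (X j @^-1` B)) ->
  (forall j, j \in L -> measurable_fun setT (f j)) ->
  (forall j, j \in L -> measurable_fun setT (fbar j)) ->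
  (forall j x, j \in L -> 0 <= f j x) ->
  (forall j x, j \in L -> 0 <= fbar j x) ->
  (forall j w, j \in L -> (\int[P]_w' (f j (w, X j w'))%:E = (fbar j w)%:E)%E) ->
  measurable_fun setT A -> (forall w, 0 <= A w) ->
  (\int[P]_w (A w * \prod_(j <- L) f j (w, X j w))%:E =
   \int[P]_w (A w * \prod_(j <- L) fbar j w)%:E)%E.
Proof.
elim: L A => [|j L IH] A; first by move=> *; under eq_integral do rewrite big_nil;
  under [RHS]eq_integral do rewrite big_nil.
move=> /= /andP[jL uL] SL FX mf mfb f0 fb0 fE mA A0.
have subL i : i \in L -> i \in j :: L by move=> iL; rewrite inE iL orbT.
(* While the head index is integrated out, the sources still in the tail count as frozen together
   with [S]. *)
pose S' := S `|` [set` L].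
have SS' : S `<=` S' by move=> i; left.
have S'j : ~ S' j.
  by case=> [/(SL j (mem_head _ _))|/= h]//; rewrite h in jL.
have mid := measurable_id_join SS'.
pose B (w : joinType S') := A w * \prod_(i <- L) f i (w, X i w).
have mB : measurable_fun setT B.
  apply: measurable_funM; first exact: (measurableT_comp mA mid).
  apply: measurable_prod => i iL.
  apply: (measurableT_comp (mf i (subL _ iL))).
  apply: measurable_fun_pair => //.
  apply: (@measurable_fun_join _ _ S' i); first by right.
  by move=> C mC; apply: FX => //; exact: subL.
have B0 w : 0 <= B w.
  rewrite mulr_ge0// big_seq; apply: prodr_ge0 => i iL; exact: f0 (subL _ iL).
pose g (x : joinType S' * R) := (B x.1 * f j x)%:E.
transitivity (\int[P]_w g (w, X j w))%E.
  apply: eq_integral => w _; rewrite /g /B big_cons; congr (_%:E).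
  by rewrite /= [f j _ * _]mulrC mulrA.
rewrite (@indep_fubini_join _ _ S' j (X j) g)//; last 3 first.
- by move=> C mC; apply: FX => //; exact: mem_head.
- apply/measurable_EFinP; apply: measurable_funM.
    exact: (measurableT_comp mB).
  have -> : f j = (fun x : joinType S' * R => f j ((x.1 : joinType S), x.2)).
    by apply/funext => -[].
  apply: (measurableT_comp (mf j (mem_head _ _))).
  apply: measurable_fun_pair => //.
  exact: (measurableT_comp mid (@measurable_fst _ _ (joinType S') R)).
- by move=> x; rewrite lee_fin mulr_ge0// f0// mem_head.
transitivity (\int[P]_w (A w * fbar j w * \prod_(i <- L) f i (w, X i w))%:E)%E.
  apply: eq_integral => w _; rewrite /g /=.
  under eq_integral do rewrite EFinM.
  rewrite ge0_integralZl_EFin//; last 2 first.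
  - by move=> w' _; rewrite lee_fin f0// mem_head.
  - apply/measurable_EFinP.
    have h := @measurable_fun_pair2 _ _ _ (joinType S) R R (f j) w (mf j (mem_head _ _)).
    apply: (measurableT_comp h).
    by move=> _ C mC; rewrite setTI; apply: Fm (FX j _ (mem_head _ _) mC).
  by rewrite fE ?mem_head// -EFinM /B mulrAC.
rewrite (IH (fun w => A w * fbar j w))//.
- apply: eq_integral => w _; rewrite big_cons; congr (_%:E).
  by rewrite mulrA.
- by move=> i iL; exact: SL (subL _ iL).
- by move=> i C iL; exact: FX (subL _ iL).
- by move=> i iL; exact: mf (subL _ iL).
- by move=> i iL; exact: mfb (subL _ iL).
- by move=> i x iL; exact: f0 (subL _ iL).
- by move=> i x iL; exact: fb0 (subL _ iL).
- by move=> i w iL; exact: fE (subL _ iL).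
- by apply: measurable_funM => //; exact: mfb (mem_head _ _).
- by move=> w; rewrite mulr_ge0// fb0// mem_head.
Qed.

End family.
End independence.

(** * The Laplace functional of a Poisson process *)

Section nat_series.
Context (R : realType).

Lemma nneseries_expR (x : R) : 0 <= x ->
  (\sum_(0 <= k <oo) (x ^+ k / k`!%:R)%:E = (expR x)%:E)%E.
Proof.
move=> x0; rewrite expRE -EFin_lim; last first.
  rewrite /pseries/=; under eq_fun do rewrite mulrC.
  exact: is_cvg_series_exp_coeff.
apply/congr_lim/funext => n/=; rewrite /pseries/= /series/= -sumEFin//.
by under [in RHS]eq_bigr do rewrite mulrC.
Qed.

Lemma poisson_generating (m v : R) : 0 <= m -> 0 <= v ->
  (\sum_(0 <= k <oo) (v ^+ k)%:E * (poisson_mass m k)%:E =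
   (expR (- (m * (1 - v))))%:E)%E.
Proof.
move=> m0 v0.
transitivity (\sum_(0 <= k <oo) ((expR (- m))%:E * ((v * m) ^+ k / k`!%:R)%:E))%E.
  apply: eq_eseriesr => k _; rewrite -!EFinM; congr (_%:E).
  by rewrite /poisson_mass exprMn; ring.
rewrite nneseriesZl; last first.
  by move=> k _; rewrite lee_fin divr_ge0// exprn_ge0// mulr_ge0.
rewrite nneseries_expR ?mulr_ge0// -EFinM -expRD; congr (expR _)%:E; ring.
Qed.

(** The partial sums are integers, so being within distance 1 of the limit [k] already means being
    equal to it. *)
Lemma indic_series_eventually (u : nat -> bool) (k : nat) :
  (\sum_(0 <= n <oo) ((u n)%:R : R)%:E = k%:R%:E)%E ->
  exists N0, forall N, (N0 <= N)%N -> (\sum_(n < N) u n)%N = k.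
Proof.
move=> uk; pose c N := (\sum_(0 <= n < N) u n)%N.
have cE N : (\sum_(0 <= n < N) ((u n)%:R : R)%:E = (c N)%:R%:E)%E.
  by rewrite sumEFin /c natr_sum.
have cv : (c N)%:R%:E @[N --> \oo] --> (k%:R%:E : \bar R).
  rewrite -uk; have := @is_cvg_nneseries R (fun n => ((u n)%:R)%:E) xpredT 0.
  move=> h; have {h} : cvg (\sum_(0 <= n < N) ((u n)%:R : R)%:E @[N --> \oo])%E.
    by apply: h => n _ _; rewrite lee_fin ler0n.
  by rewrite (_ : (fun N => _) = (fun N => (c N)%:R%:E))//; apply/funext => N; exact: cE.
have {}cv : ((c N)%:R : R) @[N --> \oo] --> (k%:R : R) by apply: (@fine_cvg _ _ _ _ (fun N => (c N)%:R%:E)).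
have /cvgrPdist_lt/(_ 1 ltr01)[N0 _ N0P] := cv.
exists N0 => N N0N; have := N0P N N0N; rewrite /= -(big_mkord xpredT (fun n => nat_of_bool (u n))) -/(c N).
move: (c N) => c' {cE cv N0P}.
have [ck|ck|//] := ltngtP c' k.
  by rewrite ger0_norm ?subr_ge0 ?ler_nat ?(ltnW ck)// -natrB ?(ltnW ck)// -[1]/(1%:R) ltr_nat ltnS leqn0 subn_eq0 leqNgt ck.
by rewrite distrC ger0_norm ?subr_ge0 ?ler_nat ?(ltnW ck)// -natrB ?(ltnW ck)// -[1]/(1%:R) ltr_nat ltnS leqn0 subn_eq0 leqNgt ck.
Qed.

End nat_series.

Section poisson_process.
Context d (Omega : measurableType d) (R : realType) (P : probability Omega R).
Variables (lam : R) (X : nat -> Omega -> R * R).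
Hypothesis lam0 : 0 < lam.
Hypothesis PPP : is_PPP P lam X.

Let mX n : measurable_fun setT (X n). Proof. by case: PPP. Qed.

Lemma measurable_count (B : set (R * R)) : measurable B -> measurable_fun setT (Defs.count X B).
Proof.
move=> mB; apply: ge0_emeasurable_sum => [n w _ _|n _]; first by rewrite lee_fin.
by apply/measurable_EFinP; apply: measurableT_comp.
Qed.

Let countset (B : set (R * R)) (k : nat) := [set w | Defs.count X B w = (k%:R)%:E].

Let mcountset (B : set (R * R)) k : measurable B -> measurable (countset B k).
Proof.
move=> mB; rewrite -[countset B k]setTI.
exact: (measurable_count mB measurableT (emeasurable_set1 (k%:R)%:E)).
Qed.

Section regions.
Variables (M : nat) (B : nat -> set (R * R)) (v : nat -> R).
Hypothesis mB : forall i, (i < M)%N -> measurable (B i).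
Hypothesis bB : forall i, (i < M)%N -> bounded2 (B i).
Hypothesis tB : forall i j, (i < M)%N -> (j < M)%N -> i != j -> B i `&` B j = set0.
Hypothesis v0 : forall i, 0 <= v i.
Hypothesis v1 : forall i, v i <= 1.

(** [v i] to the power of the number of points in [B i], and 0 when that number is infinite. It is
    expanded over the events that the count equals [k], the only events whose probabilities [is_PPP]
    provides. *)
Let Z i w : \bar R := (\sum_(0 <= k <oo) ((v i ^+ k)%:E * (\1_(countset (B i) k) w)%:E))%E.

Let z i w := fine (Z i w).

Let Q m w : R := \prod_(i < m) z i w.

Let e i := expR (- (lam * fine (area2 (B i)) * (1 - v i))).

Let countset_eq i j k w : countset (B i) j w -> countset (B i) k w -> j = k.
Proof. by rewrite /countset /= => -> [] /eqP; rewrite eqr_nat => /eqP. Qed.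

Let Z_count i k w : countset (B i) k w -> Z i w = (v i ^+ k)%:E.
Proof.
move=> ck; rewrite /Z (nneseriesD1 (n := k))//; last first.
  by move=> j _; rewrite mule_ge0// lee_fin ?exprn_ge0.
rewrite eseries0 ?adde0; last first.
  move=> j _ /= jk; rewrite indicE memNset ?mule0//.
  by move=> /countset_eq - /(_ _ ck) /eqP; rewrite (negbTE jk).
by rewrite indicE mem_set// mule1.
Qed.

Let Z_nocount i w : (forall k, ~ countset (B i) k w) -> Z i w = 0%E.
Proof.
by move=> ck; rewrite /Z eseries0// => j _ _; rewrite indicE memNset// mule0.
Qed.

Let zE i w : Z i w = (z i w)%:E.
Proof.
rewrite /z; have [[k ck]|ck] := pselect (exists k, countset (B i) k w).
  by rewrite (Z_count ck).
by rewrite Z_nocount// => k ckw; apply: ck; exists k.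
Qed.

Let z_ge0 i w : 0 <= z i w.
Proof.
by rewrite fine_ge0//; apply: nneseries_ge0 => k _ _; rewrite mule_ge0// lee_fin ?exprn_ge0.
Qed.

Let Q_ge0 m w : 0 <= Q m w.
Proof. by apply: prodr_ge0. Qed.

Let mz i : (i < M)%N -> measurable_fun setT (z i).
Proof.
move=> iM; apply/measurable_EFinP; apply: (eq_measurable_fun (Z i)) => [w _|].
  by rewrite zE.
apply: ge0_emeasurable_sum => [k w _ _|k _].
  by rewrite mule_ge0// lee_fin ?exprn_ge0.
apply: emeasurable_funM => //; apply/measurable_EFinP.
by apply: measurable_indic; apply: mcountset; exact: mB.
Qed.

Let mQ m : (m <= M)%N -> measurable_fun setT (Q m).
Proof.
by move=> mM; apply: measurable_prod => -[i im] _ /=; apply: mz; exact: leq_trans mM.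
Qed.

Let tail m k := \bigcap_(i in [set i | (m <= i < M)%N]) countset (B i) (k i).

Let mtail m k : measurable (tail m k).
Proof.
apply: bigcap_measurableType => i /= /andP[_ iM]; exact: mcountset (mB iM).
Qed.

Let pmass i k := poisson_mass (lam * fine (area2 (B i))) k.

(** Independence of the regions is given only for joint events prescribing all counts. The induction
    interpolates: regions below [m] carry their generating variable, the others a prescribed count.
    The base case is the hypothesis itself, and the step sums over the count of region [m]. *)
Let expectation_regions m (k : nat -> nat) : (m <= M)%N ->
  (\int[P]_w (Q m w * \1_(tail m k) w)%:E =
   (\prod_(i < m) e i * \prod_(m <= i < M) pmass i (k i))%:E)%E.
Proof.
elim: m k => [k _|m IH k mM].
  rewrite big_ord0 mul1r.
  transitivity (\int[P]_w (\1_(tail 0 k) w)%:E)%E.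
    by apply: eq_integral => w _; rewrite /Q big_ord0 mul1r.
  rewrite integral_indic// setIT.
  have [_ [PM PI]] := PPP.
  have := PI M B k (fun i iM => conj (mB iM) (bB iM)) tB.
  rewrite (_ : \bigcap_(i < M) _ = tail 0 k); last first.
    by apply/seteqP; split => w h i /= iM; apply: h.
  move=> h; apply: (eq_trans h); rewrite big_mkord (big_morph EFin (@EFinM R) (erefl _)).
  by apply: eq_bigr => -[i iM] _ /=; apply: PM; [exact: mB|exact: bB].
(* Fixing the count of region [m] to be [j] turns the term of index [j] in the expansion of [z m]
   into an instance of the induction hypothesis. *)
pose k' j i := if i == m then j else k i.
have tailS j : tail m (k' j) = countset (B m) j `&` tail m.+1 k.
  apply/seteqP; split => w.
    move=> h; split; first by have := h m; rewrite /= /k' eqxx; apply; rewrite leqnn.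
    by move=> i /= /andP[mi iM]; have := h i; rewrite /= /k' gtn_eqF//; apply; rewrite (ltnW mi).
  move=> [h0 h] i /= /andP[mi iM]; rewrite /k'; case: eqP => [->//|/eqP im].
  by apply: h; rewrite /= iM andbT ltn_neqAle eq_sym im.
transitivity (\int[P]_w \sum_(0 <= j <oo)
    ((v m ^+ j)%:E * (Q m w * \1_(tail m (k' j)) w)%:E))%E.
  apply: eq_integral => w _; rewrite /Q big_ord_recr /= -/(Q m w).
  rewrite (_ : _ * _ * _ = (Q m w * \1_(tail m.+1 k) w) * z m w); last by ring.
  rewrite EFinM -zE /Z -nneseriesZl; last first.
    by move=> j _; rewrite mule_ge0// lee_fin ?exprn_ge0.
  apply: eq_eseriesr => j _; rewrite tailS indicI /= -!EFinM; congr (_%:E); ring.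
rewrite integral_nneseries//; last 2 first.
- move=> j; apply: emeasurable_funM => //; apply/measurable_EFinP; apply: measurable_funM.
    exact: mQ (ltnW mM).
  by apply: measurable_indic.
- by move=> j w _; rewrite mule_ge0// lee_fin ?exprn_ge0// mulr_ge0.
transitivity (\sum_(0 <= j <oo) ((\prod_(i < m) e i * \prod_(m.+1 <= i < M) pmass i (k i))%:E *
   ((v m ^+ j)%:E * (pmass m j)%:E)))%E.
  apply: eq_eseriesr => j _.
  rewrite ge0_integralZl_EFin ?exprn_ge0//; last 2 first.
  - by move=> w _; rewrite lee_fin mulr_ge0.
  - apply/measurable_EFinP; apply: measurable_funM; first exact: mQ (ltnW mM).
    by apply: measurable_indic.
  rewrite IH ?(ltnW mM)// -!EFinM; congr (_%:E).
  rewrite (big_ltn (n := M))// {1}/k' eqxx.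
  rewrite (eq_big_nat _ _ (F2 := fun i => pmass i (k i))); last first.
    by move=> i /andP[mi _]; rewrite /k' gtn_eqF.
  by ring.
have a0 i : 0 <= lam * fine (area2 (B i)) by rewrite mulr_ge0 ?(ltW lam0)// fine_ge0.
have pm0 j : 0 <= pmass m j.
  by rewrite /pmass /poisson_mass divr_ge0// mulr_ge0 ?expR_ge0// exprn_ge0.
rewrite nneseriesZl; last first.
  by move=> j _; rewrite mule_ge0// lee_fin ?exprn_ge0.
rewrite poisson_generating// -EFinM big_ord_recr /= /e; congr (_%:E); ring.
Qed.

Let H (x : R * R) : R := \prod_(i < M) (if x \in B i then v i else 1).

(** The generating function at v = 1 says that the Poisson masses sum to 1, which leaves no mass for
    an infinite count. *)
Lemma ae_count_finite i : (i < M)%N -> {ae P, forall w, exists k, countset (B i) k w}.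
Proof.
move=> iM; have mC k : measurable (countset (B i) k) by exact: mcountset (mB iM).
have mU : measurable (\bigcup_k countset (B i) k) by exact: bigcup_measurable.
exists (~` \bigcup_k countset (B i) k); split; first exact: measurableC.
- rewrite probability_setC// measure_semi_bigcup//; last first.
    apply/trivIsetP => j k _ _ /eqP jk; apply/seteqP; split => w // -[cj ck].
    exact: jk (countset_eq cj ck).
  have [_ [PM _]] := PPP.
  have := @poisson_generating R (lam * fine (area2 (B i))) 1.
  rewrite subrr mulr0 oppr0 expR0 => h.
  rewrite (_ : (\sum_(0 <= k <oo) _)%E = 1%E) ?subee//.
  rewrite -h ?mulr_ge0 ?(ltW lam0) ?fine_ge0//.
  by apply: eq_eseriesr => k _; rewrite expr1n mul1e; exact: (PM _ (mB iM) (bB iM)).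
- by move=> w h [k _ ck]; apply: h; exists k.
Qed.

(** Almost surely every region holds finitely many points, so the product over the first [N] points
    is eventually constant in [N], equal to the product of the powers v_i^count. Bounded convergence
    transfers this to expectations. *)
Lemma laplace_regions :
  (\int[P]_w (\prod_(n < N) H (X n w))%:E)%E @[N --> \oo] -->
  (\prod_(i < M) e i)%:E.
Proof.
have QE : (\int[P]_w (Q M w)%:E = (\prod_(i < M) e i)%:E)%E.
  have := @expectation_regions M (fun=> 0%N) (leqnn _).
  rewrite big_geq// mulr1 => <-; apply: eq_integral => w _.
  rewrite indicE mem_set ?mulr1// => i /= /andP[Mi iM].
  by move: (leq_trans iM Mi); rewrite ltnn.
rewrite -QE.
have mH : measurable_fun setT H.
  apply: measurable_prod => -[i iM] _ /=.
  apply: measurable_fun_ifT; [|exact: measurable_cst|exact: measurable_cst].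
  apply: (@measurable_fun_bool _ _ _ _ true) => /=.
  rewrite setTI (_ : _ @^-1` _ = B i); first exact: mB.
  by apply/seteqP; split => x /=; [move/set_mem|move/mem_set].
have H0 x : 0 <= H x by apply: prodr_ge0 => i _; case: ifPn.
have H1 x : H x <= 1.
  by apply: prodr_ile1 => i _; case: ifPn => // _; rewrite ?v0 ?v1 ?ler01 ?lexx.
apply: (@bounded_convergence _ _ _ P (fun N w => \prod_(n < N) H (X n w)) (Q M)).
- by move=> N; apply: measurable_prod => n _; exact: measurableT_comp.
- exact: mQ.
- have : {ae P, forall w, forall i, (i < M)%N -> exists k, countset (B i) k w}.
    apply: ae_foralln => i; have [iM|iM] := ltnP i M; last by apply: aeW.
    by apply: filterS (ae_count_finite iM) => w h _.
  apply: filterS => w hw.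
  have /choice[k kP] : forall i, exists k, (i < M)%N -> countset (B i) k w.
    by move=> i; have [/hw[k ck]|_] := ltnP i M; [exists k|exists 0%N].
  have /choice[N0 N0P] : forall i, exists N0, (i < M)%N ->
      forall N, (N0 <= N)%N -> (\sum_(n < N) (X n w \in B i))%N = k i.
    move=> i; have [iM|_] := ltnP i M; last by exists 0%N.
    by have [N0 h] := indic_series_eventually (kP i iM); exists N0.
  apply: cvg_near_cst; exists (\max_(i < M) N0 i)%N => // N /= NN.
  rewrite /H exchange_big /= /Q; apply: eq_bigr => -[i iM] _ /=.
  rewrite /z (Z_count (kP i iM)) /= -(N0P i iM N); last first.
    by apply: leq_trans NN; exact: (leq_bigmax (Ordinal iM)).
  elim: N {NN} => [|N IH]; first by rewrite !big_ord0.
  rewrite !big_ord_recr /= IH; case: ifPn => _; first by rewrite addn1 exprSr.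
  by rewrite addn0 mulr1.
- by move=> N w; rewrite prodr_ge0//= prodr_ile1// => n _; rewrite H0 H1.
Qed.

End regions.

Lemma bounded_area_fin (B : set (R * R)) : measurable B -> bounded2 B ->
  area2 B \is a fin_num.
Proof.
move=> mB [K BK]; rewrite ge0_fin_numE ?measure_ge0//.
have mI : measurable (`[(- K), K]%classic : set (measurableTypeR R)) by exact: measurable_itv.
apply: (@le_lt_trans _ _ (area2 (`[(- K), K]%classic `*` `[(- K), K]%classic))).
  apply: le_measure; rewrite ?inE; [exact: mB|exact: measurableX|].
  by move=> p /BK[p1 p2]; split; rewrite /= in_itv/= -ler_norml.
rewrite /area2 product_measure1E//.
have h : (lebesgue_measure (`[(- K)%R, K]%classic : set (measurableTypeR R)) < +oo)%E.
  by rewrite lebesgue_measure_itv/=; case: ifPn => // _; rewrite -EFinB ltry.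
by rewrite lte_mul_pinfty// ge0_fin_numE.
Qed.

Import HBNNSimple.

(** Level sets of a simple function need not be bounded, whereas the counts are controlled on
    bounded regions only. *)
Let box (n : nat) := [set p : R * R | (`|p.1| <= n%:R) && (`|p.2| <= n%:R)].

Let mbox n : measurable (box n).
Proof.
rewrite -[box n]setTI.
have : measurable_fun setT (fun p : R * R => (`|p.1| <= n%:R) && (`|p.2| <= n%:R)).
  apply: measurable_and; apply: measurable_fun_ler => //.
    exact: (measurableT_comp (@normr_measurable R setT)).
  exact: (measurableT_comp (@normr_measurable R setT)).
by move=> /(_ measurableT [set true]); apply.
Qed.

Let laplace_nnsfun (f : {nnsfun (R * R)%type >-> R}) n : (forall x, f x <= 1) ->
  exists2 l : R, (\int[(lebesgue_measure \x lebesgue_measure)%E]_x (f x * \1_(box n) x)%:E = l%:E)%E &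
  (\int[P]_w (\prod_(i < N) (1 - f (X i w) * \1_(box n) (X i w)))%:E)%E @[N --> \oo] -->
    (expR (- (lam * l)))%:E.
Proof.
move=> f1; have /finite_seqP[s0 s0E] : finite_set (range f) by exact: fimfunP.
pose s : seq R := undup s0; pose M := size s.
have us : uniq s by exact: undup_uniq.
have ss x : f x \in s.
  by rewrite mem_undup; have : [set` s0] (f x) by rewrite -s0E; exists x.
pose B i := f @^-1` [set s`_i] `&` box n.
(* Beyond the [M] values the weight is 1, so that 0 <= v i <= 1 holds at every index. *)
pose v i := 1 - (if (i < M)%N then s`_i else 0).
have mB i : (i < M)%N -> measurable (B i) by move=> _; exact: measurableI.
have bB i : (i < M)%N -> bounded2 (B i).
  by move=> _; exists n%:R => p [_ /= /andP[]].
have tB i j : (i < M)%N -> (j < M)%N -> i != j -> B i `&` B j = set0.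
  move=> iM jM ij; apply/seteqP; split => x //= -[[/= e1 _] [/= e2 _]].
  by move: ij; rewrite -(nth_uniq 0 iM jM us) -e1 -e2 eqxx.
have sP i : (i < M)%N -> exists x, f x = s`_i.
  move=> iM; have := mem_nth 0 iM; rewrite mem_undup => h.
  by have : range f s`_i; [rewrite s0E|move=> [x _ <-]; exists x].
have v0 i : 0 <= v i.
  by rewrite /v; case: ifPn => [/sP[x <-]|_]; rewrite ?subr0// subr_ge0.
have v1 i : v i <= 1.
  by rewrite /v; case: ifPn => [/sP[x <-]|_]; rewrite ?subr0// gerBl.
have := laplace_regions mB bB tB v0 v1.
pose l := \sum_(i < M) s`_i * fine (area2 (B i)).
have -> : \prod_(i < M) expR (- (lam * fine (area2 (B i)) * (1 - v i))) = expR (- (lam * l)).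
  rewrite -expR_sum; congr expR; rewrite /l mulr_sumr -sumrN; apply: eq_bigr => -[i iM] _ /=.
  by rewrite /v iM; ring.
have fE x : f x * \1_(box n) x = \sum_(i < M) s`_i * \1_(B i) x.
  have iM : (index (f x) s < M)%N by rewrite index_mem.
  rewrite (bigD1 (Ordinal iM))//= big1 ?addr0; last first.
    move=> -[i jM] /= /eqP ij; rewrite indicE memNset ?mulr0// => -[/= e _].
    by apply: ij; apply/val_inj => /=; rewrite e index_uniq.
  rewrite nth_index// /B indicI /= [X in _ = _ * (X * _)]indicE mem_set ?mul1r//=.
  by rewrite nth_index.
have HE x : \prod_(i < M) (if x \in B i then v i else 1) = 1 - f x * \1_(box n) x.
  have iM : (index (f x) s < M)%N by rewrite index_mem.
  rewrite (bigD1 (Ordinal iM))//= big1 ?mulr1; last first.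
    move=> -[i jM] /= /eqP ij; rewrite memNset// => -[/= e _].
    by apply: ij; apply/val_inj => /=; rewrite e index_uniq.
  rewrite /B in_setI (_ : x \in _ @^-1` _) /=; last by rewrite mem_set//= nth_index.
  by rewrite indicE /v iM nth_index//; case: ifPn => _; rewrite ?mulr1// mulr0 subr0.
move=> h; exists l; last first.
  by move: h; under [X in X @ _ --> _ -> _]eq_fun do under eq_integral do under eq_bigr do rewrite HE.
under eq_integral do rewrite fE -sumEFin.
rewrite ge0_integral_sum//; last 2 first.
- by move=> i; apply/measurable_EFinP; apply: measurable_funM => //; apply: measurable_indic; exact: mB.
- by move=> i x _; rewrite lee_fin mulr_ge0//; have [y <-] := sP i (ltn_ord i).
rewrite -sumEFin; apply: eq_bigr => -[i iM] _ /=.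
under eq_integral do rewrite EFinM.
rewrite ge0_integralZl_EFin//; last 2 first.
- by apply/measurable_EFinP; apply: measurable_indic; exact: mB.
- by have [y <-] := sP i iM.
rewrite integral_indic ?setIT//; last exact: mB.
rewrite EFinM; congr (_ * _)%E; apply/esym/fineK; apply: bounded_area_fin.
  exact: mB.
exact: bB.
Qed.

(** Two limits must be exchanged: [N] points, and simple functions [psi n] increasing to 1 - G.
    Monotonicity in both indices replaces uniform convergence, as each limit gives one side of a
    squeeze. *)
Lemma laplace_functional (G : R * R -> R) (l : R) :
  measurable_fun setT G -> (forall x, 0 <= G x <= 1) ->
  (\int[(lebesgue_measure \x lebesgue_measure)%E]_x (1 - G x)%:E = l%:E)%E ->
  (\int[P]_w (\prod_(n < N) G (X n w))%:E)%E @[N --> \oo] --> (expR (- (lam * l)))%:E.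
Proof.
move=> mG G01 Gl; pose phi (x : R * R) := (1 - G x)%:E.
have phi0 x : (0 <= phi x)%E by rewrite lee_fin subr_ge0; have /andP[] := G01 x.
have mphi : measurable_fun setT phi.
  by apply/measurable_EFinP; exact: measurable_funB.
pose f := nnsfun_approx measurableT mphi.
have nd_f x : nondecreasing_seq (fun n => f n x).
  by move=> m n mn; exact/lefP/nd_nnsfun_approx.
have cv_f x : f n x @[n --> \oo] --> 1 - G x.
  apply: (@fine_cvg _ _ _ _ (fun n => (f n x)%:E)).
  exact: (cvg_nnsfun_approx measurableT mphi (fun x _ => phi0 x) (x := x) Logic.I).
have f_le n x : f n x <= 1 - G x.
  rewrite -(cvg_lim _ (cv_f x))//; apply: nondecreasing_cvgn_le => //.
  by apply/cvg_ex; exists (1 - G x).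
pose psi n x := f n x * \1_(box n) x.
have psi0 n x : 0 <= psi n x by rewrite mulr_ge0.
have psi_le n x : psi n x <= 1 - G x.
  by apply: le_trans (f_le n x); rewrite ler_piMr// indicE; case: (_ \in _).
have nd_psi x : nondecreasing_seq (psi ^~ x).
  move=> m n mn; rewrite /psi ler_pM//; first exact: nd_f.
  rewrite !indicE ler_nat.
  have [/set_mem /= /andP[x1 x2]|//] := boolP (x \in box m).
  rewrite mem_set//=; apply/andP; split.
    by rewrite (le_trans x1)// ler_nat.
  by rewrite (le_trans x2)// ler_nat.
have cv_psi x : psi n x @[n --> \oo] --> 1 - G x.
  apply: cvg_trans (cv_f x); apply: near_eq_cvg.
  exists (maxn (truncn `|x.1|).+1 (truncn `|x.2|).+1) => // n /=; rewrite geq_max => /andP[n1 n2].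
  rewrite /psi indicE mem_set ?mulr1//=; apply/andP; split.
    by rewrite (le_trans (ltW (truncnS_gt _)))// ler_nat.
  by rewrite (le_trans (ltW (truncnS_gt _)))// ler_nat.
have mpsi n : measurable_fun setT (psi n).
  by apply: measurable_funM => //; apply: measurable_indic.
have psi1 n x : psi n x <= 1.
  by apply: (le_trans (psi_le n x)); rewrite gerBl; have /andP[] := G01 x.
have f1 n x : f n x <= 1.
  by apply: (le_trans (f_le n x)); rewrite gerBl; have /andP[] := G01 x.
have /choice[ln lnP] : forall n, exists l : R,
    (\int[(lebesgue_measure \x lebesgue_measure)%E]_x (psi n x)%:E = l%:E)%E /\
    (\int[P]_w (\prod_(i < N) (1 - psi n (X i w)))%:E)%E @[N --> \oo] --> (expR (- (lam * l)))%:E.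
  by move=> n; have [l' h1 h2] := @laplace_nnsfun (f n) n (f1 n); exists l'.
have ln_l : ln n @[n --> \oo] --> l.
  apply: (@fine_cvg _ _ _ _ (fun n => (ln n)%:E)).
  have -> : (fun n => (ln n)%:E) =
      (fun n => (\int[(lebesgue_measure \x lebesgue_measure)%E]_x (psi n x)%:E)%E).
    by apply/funext => n; have [] := lnP n.
  have -> : l%:E = (\int[(lebesgue_measure \x lebesgue_measure)%E]_x
      (limn (fun n => (psi n x)%:E)))%E.
    rewrite -Gl; apply: eq_integral => x _; apply/esym/cvg_lim => //.
    by apply: cvg_EFin; [exact: nearW|exact: cv_psi].
  apply: cvg_monotone_convergence => //.
  - by move=> n; apply/measurable_EFinP; exact: mpsi.
  - by move=> n x _; rewrite lee_fin.
  - by move=> x _ m n mn; rewrite lee_fin; exact: nd_psi.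
pose u n N := fine (\int[P]_w (\prod_(i < N) (1 - psi n (X i w)))%:E)%E.
pose a N := fine (\int[P]_w (\prod_(i < N) G (X i w))%:E)%E.
have mu n N : measurable_fun setT (fun w => \prod_(i < N) (1 - psi n (X i w))).
  apply: measurable_prod => i _; apply: measurable_funB => //.
  exact: measurableT_comp.
have ma N : measurable_fun setT (fun w => \prod_(i < N) G (X i w)).
  by apply: measurable_prod => i _; exact: measurableT_comp.
have u01 n N w : 0 <= \prod_(i < N) (1 - psi n (X i w)) <= 1.
  by rewrite prodr_ge0 ?prodr_ile1//= => i _; rewrite ?subr_ge0 ?psi1 ?gerBl ?psi0.
have a01 N w : 0 <= \prod_(i < N) G (X i w) <= 1.
  by rewrite prodr_ge0/= ?prodr_ile1// => i _; have /andP[] := G01 (X i w).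
have uE n N := integral_unit_fin P (mu n N) (u01 n N).
have aE N := integral_unit_fin P (ma N) (a01 N).
have un_cv n : u n N @[N --> \oo] --> expR (- (lam * ln n)).
  apply: (@fine_cvg _ _ _ _ (fun N => (\int[P]_w (\prod_(i < N) (1 - psi n (X i w)))%:E)%E)).
  by have [] := lnP n.
(* The upper side: psi n <= 1 - G means that each factor G is at most 1 - psi n. *)
have a_u n N : a N <= u n N.
  rewrite -lee_fin /a /u -aE -uE; apply: ge0_le_integral => //.
  - by move=> w _; rewrite lee_fin; have /andP[] := a01 N w.
  - by apply/measurable_EFinP; exact: ma.
  - by apply/measurable_EFinP; exact: mu.
  - move=> w _; rewrite lee_fin; apply: ler_prod => i _.
    have /andP[-> _] := G01 (X i w) => /=.
    by have := psi_le n (X i w); rewrite lerBrDr addrC -lerBrDr.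
(* Adding a point only decreases the product, so the limit in [N] is a lower bound at every finite
   [N]. *)
have u_e n N : expR (- (lam * ln n)) <= u n N.
  rewrite -(cvg_lim _ (un_cv n))//; apply: nonincreasing_cvgn_ge; last first.
    by apply/cvg_ex; eexists; exact: un_cv.
  apply/nonincreasing_seqP => k; rewrite -lee_fin /u -!uE; apply: ge0_le_integral => //.
  - by move=> w _; rewrite lee_fin; have /andP[] := u01 n k.+1 w.
  - by apply/measurable_EFinP; exact: mu.
  - by apply/measurable_EFinP; exact: mu.
  - move=> w _; rewrite lee_fin big_ord_recr /= ler_piMr//; last by rewrite gerBl psi0.
    by have /andP[] := u01 n k w.
have e_cv : expR (- (lam * ln n)) @[n --> \oo] --> expR (- (lam * l)).
  apply: continuous_cvg; first exact: continuous_expR.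
  by apply: cvgN; apply: cvgM => //; exact: cvg_cst.
have u_a N : u n N @[n --> \oo] --> a N.
  have h := @bounded_convergence _ _ _ P (fun n w => \prod_(i < N) (1 - psi n (X i w)))
    (fun w => \prod_(i < N) G (X i w)) (mu^~ N) (ma N) _ (u01^~ N).
  apply: (@fine_cvg _ _ _ _ (fun n => (\int[P]_w (\prod_(i < N) (1 - psi n (X i w)))%:E)%E)).
  rewrite -aE; apply: h; apply: aeW => w.
  elim: N => [|N IH]; first by under eq_fun do rewrite big_ord0; rewrite big_ord0; exact: cvg_cst.
  under eq_fun do rewrite big_ord_recr; rewrite big_ord_recr /=.
  apply: cvgM => //; rewrite -[X in _ --> X](subKr 1); apply: cvgB; first exact: cvg_cst.
  exact: cv_psi.
(* Letting n go to infinity at fixed [N] in the previous bound gives the lower side of the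
   squeeze. *)
have e_a N : expR (- (lam * l)) <= a N.
  rewrite -(cvg_lim _ e_cv)// -(cvg_lim _ (u_a N))//; apply: ler_lim.
  - by apply/cvg_ex; eexists; exact: e_cv.
  - by apply/cvg_ex; eexists; exact: u_a.
  - by apply: nearW => n; exact: u_e.
rewrite (_ : (fun N => _) = (fun N => (a N)%:E)); last by apply/funext => N; rewrite aE.
apply: cvg_EFin; first exact: nearW.
apply/cvgrPdist_lt => eps eps0.
have eps2 : 0 < eps / 2 by rewrite divr_gt0.
have /cvgrPdist_lt/(_ _ eps2)[n _ nP] := e_cv.
have {nP} := nP n (leqnn _) => /= h1.
have /cvgrPdist_lt/(_ _ eps2)[N0 _ N0P] := un_cv n.
exists N0 => // N /= N0N; have /= h2 := N0P N N0N.
rewrite distrC ger0_norm ?subr_ge0//.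
have h3 := a_u n N; have h4 := u_e n N.
move: h1 h2; rewrite !ltr_norml => /andP[h1 _] /andP[h2 _].
by rewrite ltrBlDr; move: h1 h2 h3; rewrite -/(u n N); lra.
Qed.

End poisson_process.

(** * Densities and Laplace transforms *)

Section integral_extra.
Context d (T : measurableType d) (R : realType).

(** The scalar may be negative, as [om1] may be; integrability comes from the finite value of the
    nonnegative integral. *)
Lemma integralZ_real (m : {measure set T -> \bar R}) (D : set T) (f : T -> R) (c e : R) :
  measurable D -> measurable_fun D f -> (forall x, D x -> 0 <= f x) ->
  (\int[m]_(x in D) (f x)%:E = e%:E)%E ->
  (\int[m]_(x in D) (c * f x)%:E = (c * e)%:E)%E.
Proof.
move=> mD mf f0 fe; under eq_integral do rewrite EFinM.
rewrite integralZl ?fe//; apply/integrableP; split; first exact/measurable_EFinP.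
suff -> : (\int[m]_(x in D) `|(f x)%:E| = e%:E)%E by rewrite ltry.
by rewrite -fe; apply: eq_integral => x /set_mem Dx; rewrite gee0_abs// lee_fin f0.
Qed.

Import HBNNSimple.

(* No measurability is needed: modifying a simple function on a negligible set
   does not change its integral. *)
Lemma ge0_integral_ae (m : {measure set T -> \bar R}) (f g : T -> \bar R) :
  (forall x, 0 <= f x)%E -> (forall x, 0 <= g x)%E -> {ae m, forall x, f x = g x} ->
  (\int[m]_x f x = \int[m]_x g x)%E.
Proof.
suff h : forall f g : T -> \bar R, (forall x, 0 <= f x)%E -> (forall x, 0 <= g x)%E ->
    {ae m, forall x, f x = g x} -> (\int[m]_x f x <= \int[m]_x g x)%E.
  move=> f0 g0 fg; apply/eqP; rewrite eq_le h//= h//.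
  by apply: filterS fg => x ->.
move=> {}f {}g f0 g0 [N [mN N0 fgN]].
rewrite ge0_integralTE// ge0_integralTE//; apply: ge_ereal_sup => _ [k kf <-].
pose k' := proj_nnsfun k (measurableC mN).
have k'E x : k' x = if x \in ~` N then k x else 0.
  by have /(congr1 (fun u => u x)) <- := mrestrict k (measurableC mN); rewrite patchE.
have -> : sintegral m k = sintegral m k'.
  rewrite -!integralT_nnsfun; apply: ae_eq_integral => //.
  - by apply/measurable_EFinP.
  - by apply/measurable_EFinP.
  - exists N; split => // x /=; apply: contra_notP => Nx _.
    by congr (_%:E); apply/esym/(eq_trans (k'E x)); rewrite mem_set.
apply: ereal_sup_ubound; exists k' => // x; rewrite k'E.
case: ifPn => [/set_mem Nx|_]; last exact: g0.
rewrite (_ : g x = f x) ?kf//; apply/esym; apply: contrapT => h.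
by apply: Nx; exact: fgN.
Qed.

Lemma integral_ae (m : {measure set T -> \bar R}) (f g : T -> \bar R) :
  {ae m, forall x, f x = g x} -> (\int[m]_x f x = \int[m]_x g x)%E.
Proof.
move=> fg; rewrite integralE [RHS]integralE.
congr (_ - _)%E; apply: ge0_integral_ae => //; apply: filterS fg => x fgx.
- by rewrite !funeposE fgx.
- by rewrite !funenegE fgx.
Qed.

Lemma nneseries_gt0 (u : nat -> R) : (forall n, 0 <= u n) -> (exists n, 0 < u n) ->
  (0 < \sum_(0 <= n <oo) (u n)%:E)%E.
Proof.
move=> u0 [k uk]; rewrite (nneseriesD1 (n := k))//; last by move=> n _; rewrite lee_fin.
rewrite (@lt_le_trans _ _ (u k)%:E) ?lte_fin// leeDl//.
by apply: nneseries_ge0 => n _ _; rewrite lee_fin.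
Qed.

End integral_extra.

Section densities.
Context d (Omega : measurableType d) (R : realType) (P : probability Omega R).
Notation mu := (@lebesgue_measure R).

Lemma expectation_density (X : Omega -> R) (p : R -> R) (f : R -> \bar R) :
  has_density P X p -> measurable_fun setT p -> (forall x, 0 <= p x) ->
  measurable_fun setT f -> (forall x, 0 <= f x)%E ->
  (\int[P]_w f (X w) = \int[mu]_x (f x * (p x)%:E))%E.
Proof.
move=> [mX XP] mp p0 mf f0.
pose X' : Omega -> measurableTypeR R := X.
have mX' : measurable_fun setT X' by exact: mX.
have mf' : measurable_fun (setT : set (measurableTypeR R)) f by exact: mf.
have h1 := @ge0_integral_pushforward _ _ _ _ R X' mX' P setT f measurableT mf' (fun x _ => f0 x).
apply: eq_trans; first exact/esym/h1.
have mp' : measurable_fun (setT : set (measurableTypeR R)) p by exact: mp.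
have h2 := @integral_density _ (measurableTypeR R) R mu p mp' p0 setT f measurableT mf (fun x _ => f0 x).
apply: eq_trans; last exact: h2.
by apply: eq_measure_integral => A mA _; exact: XP.
Qed.

Lemma ae_density (X : Omega -> R) (p : R -> R) (D : set R) :
  has_density P X p -> measurable D -> (forall x, ~ D x -> p x = 0) ->
  {ae P, forall w, D (X w)}.
Proof.
move=> [mX XP] mD pD; exists (X @^-1` (~` D)); split.
- by rewrite -[_ @^-1` _]setTI; apply: mX => //; exact: measurableC.
- rewrite XP; last exact: measurableC.
  by apply: integral0_eq => x Dx; rewrite pD.
- by move=> w.
Qed.

(** The absolute value keeps the integrand in the unit interval for every [h]; the density charges
    only h >= 0, where it changes nothing. *)
Lemma laplace_exponential (b : R) : 0 <= b ->
  (\int[mu]_h ((expR (- (b * `|h|)))%:E * (exponential_pdf 1 h)%:E) = ((1 + b)^-1)%:E)%E.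
Proof.
move=> b0; have b1 : 0 < 1 + b by rewrite ltr_wpDr.
transitivity (\int[mu]_(h in `]0%R, +oo[) ((1 + b)^-1%:E * ((1 + b) * expR (- ((1 + b) * h)))%:E))%E.
  transitivity (\int[mu]_(h in `[0%R, +oo[) ((1 + b)^-1%:E * ((1 + b) * expR (- ((1 + b) * h)))%:E))%E.
    rewrite [RHS]integral_mkcond; apply: eq_integral => h _; rewrite patchE.
    case: ifPn; rewrite ?notin_setE ?inE/= in_itv/= andbT => h0.
      rewrite exponential_pdfE// ger0_norm// -!EFinM mulKf ?gt_eqF// mul1r -expRD.
      by congr (expR _)%:E; ring.
    by rewrite lt0_exponential_pdf ?mule0// ltNge; exact/negP.
  rewrite -integral_itv_obnd_cbnd//.
  apply/measurable_EFinP => /=; apply: measurable_funM => //; apply: measurable_funM => //.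
  apply: (measurableT_comp (f := @expR R)) => //; apply: measurable_funN.
  by apply: measurable_funM.
rewrite ge0_integralZl_EFin ?invr_ge0 ?(ltW b1)//; last 2 first.
- by move=> h _; rewrite lee_fin mulr_ge0 ?expR_ge0// ltW.
- apply/measurable_EFinP => /=; apply: measurable_funM => //.
  apply: (measurableT_comp (f := @expR R)) => //; apply: measurable_funN.
  by apply: measurable_funM.
transitivity ((1 + b)^-1%:E * (expR (- ((1 + b) * 0)))%:E)%E.
  by congr (_ * _)%E; exact: (integral_expR_tail b1 (lexx _)).
by rewrite mulr0 oppr0 expR0 mule1.
Qed.

Lemma ae_exponential_gt0 (X : Omega -> R) :
  has_density P X (exponential_pdf 1) -> {ae P, forall w, 0 < X w}.
Proof.
move=> [mX XP]; exists (X @^-1` (`]-oo, 0%R]%classic)); split.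
- by rewrite -[_ @^-1` _]setTI; exact: mX.
- rewrite XP//.
  (* The density equals 1 at 0, so that point is split off as a Lebesgue null set. *)
  rewrite -(@setUitv1 _ _ -oo%O (0:R) true)// ge0_integral_setU//; last 3 first.
  - by apply/measurable_EFinP; apply: measurable_funTS; exact: measurable_exponential_pdf.
  - by move=> x _; rewrite lee_fin exponential_pdf_ge0.
  - by apply/disj_setPS => x [/=]; rewrite in_itv/= => x0 xE; move: x0; rewrite xE ltxx.
  rewrite integral_set1 adde0.
  by apply: integral0_eq => x /=; rewrite in_itv/= => x0; rewrite lt0_exponential_pdf.
- by move=> w /= /negP; rewrite -leNgt in_itv.
Qed.

End densities.

Section laplace_weight.
Context (R : realType).

(* [exp (- s e)] with the convention [exp (- oo) = 0]; the value at [-oo] is junk. *)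
Definition elap (s : R) (e : \bar R) : R := if e is r%:E then expR (- (s * r)) else 0.

(** The convention exp(- oo) = 0 keeps this convergence true for a divergent series, so finiteness
    of the interference is not an issue. *)
Lemma cvg_elap (s : R) (u : nat -> R) : 0 < s -> (forall n, 0 <= u n) ->
  expR (- (s * \sum_(0 <= n < N) u n)) @[N --> \oo] --> elap s (\sum_(0 <= n <oo) (u n)%:E)%E.
Proof.
move=> s0 u0; pose S N := \sum_(0 <= n < N) u n.
have : (S N)%:E @[N --> \oo] --> (\sum_(0 <= n <oo) (u n)%:E)%E.
  rewrite (_ : (fun N => (S N)%:E) = (fun N => \sum_(0 <= n < N) (u n)%:E)%E); last first.
    by apply/funext => N; rewrite sumEFin.
  by apply: is_cvg_nneseries => n _ _; rewrite lee_fin.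
have : (0 <= \sum_(0 <= n <oo) (u n)%:E)%E.
  by apply: nneseries_ge0 => n _ _; rewrite lee_fin.
case: (\sum_(0 <= n <oo) _)%E => [r| |] //= _ Sr.
  have {}Sr : S N @[N --> \oo] --> r by apply: (@fine_cvg _ _ _ _ (fun N => (S N)%:E)).
  apply: continuous_cvg; first exact: continuous_expR.
  by apply: cvgN; apply: cvgM => //; exact: cvg_cst.
have sS : s * S N @[N --> \oo] --> +oo.
  apply/cvgryPge => A; have /cvgeyPge/(_ (A / s)) := Sr.
  by apply: filterS => N; rewrite lee_fin ler_pdivrMr// mulrC.
exact: (cvg_comp _ _ sS (@cvgr_expR R)).
Qed.

Lemma measurable_elap d (T : measurableType d) (s : T -> R) (e : T -> \bar R) :
  measurable_fun setT s -> measurable_fun setT e -> (forall x, 0 <= e x)%E ->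
  measurable_fun setT (fun x => elap (s x) (e x)).
Proof.
move=> ms me e0.
rewrite (_ : (fun x => _) = (fun x => if (e x < +oo)%E then expR (- (s x * fine (e x))) else 0)); last first.
  by apply/funext => x; have := e0 x; case: (e x) => [r| |] //= _; rewrite ltry.
have mf : measurable_fun setT (fun x => fine (e x)) by exact: measurableT_comp.
apply: measurable_fun_ifT; [exact: measurable_fun_lte| |exact: measurable_cst].
apply: (measurableT_comp (f := @expR R)) => //.
by apply: measurable_funN; exact: measurable_funM.
Qed.

Lemma measurable_sinr d (T : measurableType d) (h c : T -> R) (e : T -> \bar R) :
  measurable_fun setT h -> measurable_fun setT c -> measurable_fun setT e ->
  (forall x, 0 <= e x)%E -> measurable_fun setT (fun x => sinr (h x) (e x) (c x)).
Proof.
move=> mh mc me e0.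
rewrite (_ : (fun x => _) = (fun x => if (e x < +oo)%E then h x / (fine (e x) + c x) else 0)); last first.
  by apply/funext => x; have := e0 x; case: (e x) => [r| |] //= _; rewrite ltry.
have mf : measurable_fun setT (fun x => fine (e x)) by exact: measurableT_comp.
apply: measurable_fun_ifT; [exact: measurable_fun_lte| |exact: measurable_cst].
by apply: measurable_funM => //; apply: measurable_funV; exact: measurable_funD.
Qed.

End laplace_weight.

(** * Laplace transform of the interference *)

Section product_measure_tonelli.
Context d0 d1 d2 (T0 : measurableType d0) (T1 : measurableType d1) (T2 : measurableType d2).
Context (R : realType).
Variables (m0 : {sigma_finite_measure set T0 -> \bar R}).
Variables (m1 : {sigma_finite_measure set T1 -> \bar R}).
Variables (m2 : {sigma_finite_measure set T2 -> \bar R}).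

Lemma measurable_integral_product (f : T0 * (T1 * T2) -> \bar R) :
  measurable_fun setT f -> (forall x, 0 <= f x)%E ->
  measurable_fun setT (fun r => \int[(m1 \x m2)%E]_x f (r, x))%E.
Proof.
move=> mf f0.
pose g (z : T0 * T1 * T2) := f (z.1.1, (z.1.2, z.2)).
have mg : measurable_fun setT g.
  apply: (measurableT_comp mf).
  have h1 := measurableT_comp (@measurable_fst _ _ T0 T1) (@measurable_fst _ _ (T0 * T1)%type T2).
  have h2 := measurableT_comp (@measurable_snd _ _ T0 T1) (@measurable_fst _ _ (T0 * T1)%type T2).
  by apply: measurable_fun_pair => //; exact: measurable_fun_pair.
have g0 z : (0 <= g z)%E by exact: f0.
have mG := measurable_fun_fubini_tonelli_F (m2 := m2) g mg g0.
have G0 z : (0 <= fubini_F m2 g z)%E by exact: integral_ge0.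
have mH := measurable_fun_fubini_tonelli_F (m2 := m1) _ mG G0.
apply: (eq_measurable_fun _ _ mH) => r _.
rewrite fubini_tonelli1//; exact: (@measurable_fun_pair2 _ _ _ T0 (T1 * T2)%type _ f r mf).
Qed.

Lemma tonelli_product (f : (T1 * T2) * T0 -> \bar R) :
  measurable_fun setT f -> (forall x, 0 <= f x)%E ->
  (\int[(m1 \x m2)%E]_x \int[m0]_q f (x, q) = \int[m0]_q \int[(m1 \x m2)%E]_x f (x, q))%E.
Proof.
move=> mf f0.
have mF := measurable_fun_fubini_tonelli_F (m2 := m0) f mf f0.
have F0 z : (0 <= fubini_F m0 f z)%E by exact: integral_ge0.
transitivity (\int[m1]_x \int[m2]_y \int[m0]_q f ((x, y), q))%E.
  exact: (@fubini_tonelli1 _ _ T1 T2 R m1 m2 _ mF F0).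
pose g (z : T1 * T0 * T2) := f ((z.1.1, z.2), z.1.2).
have mg : measurable_fun setT g.
  apply: (measurableT_comp mf).
  have h1 := measurableT_comp (@measurable_fst _ _ T1 T0) (@measurable_fst _ _ (T1 * T0)%type T2).
  have h2 := measurableT_comp (@measurable_snd _ _ T1 T0) (@measurable_fst _ _ (T1 * T0)%type T2).
  by apply: measurable_fun_pair => //; exact: measurable_fun_pair.
have g0 z : (0 <= g z)%E by exact: f0.
have mG := measurable_fun_fubini_tonelli_F (m2 := m2) g mg g0.
have G0 z : (0 <= fubini_F m2 g z)%E by exact: integral_ge0.
transitivity (\int[m1]_x \int[m0]_q \int[m2]_y f ((x, y), q))%E.
  apply: eq_integral => x _.
  apply: (@fubini_tonelli _ _ T2 T0 R m2 m0 (fun z => f ((x, z.1), z.2))) => [|z]; last exact: f0.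
  apply: (measurableT_comp mf); apply: measurable_fun_pair => //.
  by apply: measurable_fun_pair.
apply: (eq_trans (@fubini_tonelli _ _ T1 T0 R m1 m0 _ mG G0)).
apply: eq_integral => q _; rewrite fubini_tonelli1//.
exact: (@measurable_fun_pair1 _ _ _ (T1 * T2)%type T0 _ f q mf).
Qed.

End product_measure_tonelli.

(* The exponent in the Laplace functional of a unit-intensity Poisson process on the plane. *)
Definition area_loss (R : realType) (G : R * (R * R) -> R) (r : R) : \bar R :=
  (\int[(@lebesgue_measure R \x @lebesgue_measure R)%E]_x (1 - G (r, x))%:E)%E.

Lemma measurable_area_loss (R : realType) (G : R * (R * R) -> R) :
  measurable_fun setT G -> (forall x, 0 <= G x <= 1) -> measurable_fun setT (area_loss G).
Proof.
move=> mG G01.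
pose f (z : R * (measurableTypeR R * measurableTypeR R)) := (1 - G z)%:E.
have mf : measurable_fun setT f.
  by apply/measurable_EFinP; apply: measurable_funB; [exact: measurable_cst|exact: mG].
have f0 z : (0 <= f z)%E by rewrite lee_fin subr_ge0; have /andP[] := G01 z.
have h := @measurable_integral_product _ _ _ R (measurableTypeR R) (measurableTypeR R) R
  (@lebesgue_measure R) (@lebesgue_measure R) f mf f0.
exact: h.
Qed.

Section average.
Context d (Omega : measurableType d) (R : realType) (P : probability Omega R).
Notation mu := (@lebesgue_measure R).
Context d' (T : measurableType d') (p : R -> R) (g : T * R -> R).
Hypotheses (mp : measurable_fun setT p) (p0 : forall x, 0 <= p x).
Hypotheses (mg : measurable_fun setT g) (g01 : forall x, 0 <= g x <= 1).

Definition average (x : T) : R := fine (\int[mu]_h ((g (x, h))%:E * (p h)%:E))%E.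

Let mgx x : measurable_fun setT (fun h => g (x, h)).
Proof. exact: (@measurable_fun_pair2 _ _ _ T R R g x mg). Qed.

Lemma averageE (X : Omega -> R) x : has_density P X p ->
  (\int[P]_w (g (x, X w))%:E = (average x)%:E)%E.
Proof.
move=> Xp; have [mX _] := Xp.
have h := expectation_density (f := fun h => (g (x, h))%:E) Xp mp p0.
rewrite /average -h//.
- by apply: integral_unit_fin => //; exact: (measurableT_comp (mgx x)).
- by apply/measurable_EFinP; exact: mgx.
- by move=> y; rewrite lee_fin; have /andP[] := g01 (x, y).
Qed.

Lemma average01 (X : Omega -> R) x : has_density P X p -> 0 <= average x <= 1.
Proof.
move=> Xp; have [mX _] := Xp; rewrite -!lee_fin -(averageE x Xp); apply/andP; split.
  by apply: integral_ge0 => w _; rewrite lee_fin; have /andP[] := g01 (x, X w).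
apply: (@le_trans _ _ (\int[P]_w (cst 1 w))%E); last by rewrite integral_cst// mul1e probability_le1.
apply: ge0_le_integral => //.
- by move=> w _; rewrite lee_fin; have /andP[] := g01 (x, X w).
- by apply/measurable_EFinP; exact: (measurableT_comp (mgx x)).
- by move=> w _; rewrite lee_fin; have /andP[] := g01 (x, X w).
Qed.

Lemma measurable_average (X : Omega -> R) : has_density P X p ->
  measurable_fun setT average.
Proof.
move=> Xp; have [mX _] := Xp; apply/measurable_EFinP.
apply: (eq_measurable_fun (fubini_F P (fun z : T * Omega => (g (z.1, X z.2))%:E))).
  by move=> x _; rewrite /fubini_F/= -(averageE x Xp).
apply: measurable_fun_fubini_tonelli_F => [|z]; last by rewrite lee_fin; have /andP[] := g01 (z.1, X z.2).
apply/measurable_EFinP; apply: (measurableT_comp mg).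
apply: measurable_fun_pair => //.
exact: (measurableT_comp mX (@measurable_snd _ _ T Omega)).
Qed.

End average.

Section interference.
Context d (Omega : measurableType d) (R : realType) (P : probability Omega R).
Notation mu := (@lebesgue_measure R).
Variables (lam : R) (fq : R -> R).
Variables (Psi Phi : nat -> Omega -> R * R) (Ry hx hy : nat -> Omega -> R) (ho ro : Omega -> R).
Hypothesis lam0 : 0 < lam.
Hypotheses (mfq : measurable_fun setT fq) (fq0 : forall q, 0 <= fq q).
Hypotheses (Psi_PPP : is_PPP P lam Psi) (Phi_PPP : is_PPP P lam Phi).
Hypotheses (Ry_den : forall n, has_density P (Ry n) fq).
Hypotheses (hx_den : forall n, has_density P (hx n) (exponential_pdf 1)).
Hypotheses (hy_den : forall n, has_density P (hy n) (exponential_pdf 1)).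
Hypotheses (ho_den : has_density P ho (exponential_pdf 1)).
Hypothesis mro : measurable_fun setT ro.
Notation F := (model_family Psi Phi Ry hx hy ho ro).
Hypothesis Find : mutually_independent P F.

Let mPsi n : measurable_fun setT (Psi n). Proof. by case: Psi_PPP. Qed.
Let mPhi n : measurable_fun setT (Phi n). Proof. by case: Phi_PPP. Qed.
Let mRy n : measurable_fun setT (Ry n). Proof. by case: (Ry_den n). Qed.
Let mhx n : measurable_fun setT (hx n). Proof. by case: (hx_den n). Qed.
Let mhy n : measurable_fun setT (hy n). Proof. by case: (hy_den n). Qed.
Let mho : measurable_fun setT ho. Proof. by case: ho_den. Qed.

Let sigma_of_measurable d' (T : measurableType d') (X : Omega -> T) :
  measurable_fun setT X -> sigma_of X `<=` measurable.
Proof.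
move=> mX; apply: smallest_sub; first exact: sigma_algebra_measurable.
by move=> _ [B mB <-]; rewrite -[_ @^-1` _]setTI; exact: mX.
Qed.

Let sigma_of_seq_measurable d' (T : measurableType d') (X : nat -> Omega -> T) :
  (forall n, measurable_fun setT (X n)) -> sigma_of_seq X `<=` measurable.
Proof.
move=> mX; apply: smallest_sub; first exact: sigma_algebra_measurable.
by move=> _ [n _ [B mB <-]]; rewrite -[_ @^-1` _]setTI; exact: mX.
Qed.

Lemma model_family_measurable i : F i `<=` measurable.
Proof.
by case: i => [||n|n|n||] /=; [apply: sigma_of_seq_measurable|apply: sigma_of_seq_measurable
  |apply: sigma_of_measurable..].
Qed.

Lemma model_family_sigma_algebra i : sigma_algebra setT (F i).
Proof. by case: i => [||n|n|n||] /=; exact: smallest_sigma_algebra. Qed.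

Lemma model_familyT i : F i setT.
Proof.
have [F0 FD _] := model_family_sigma_algebra i.
by rewrite -(setD0 setT); exact: FD.
Qed.

Lemma model_familyI i : setI_closed (F i).
Proof.
have : forall G : set (set Omega), setI_closed <<s G >>.
  by move=> G A B GA GB; apply: (@measurableI _ (g_sigma_algebraType G)).
by move=> h; case: i => [||n|n|n||] /=; exact: h.
Qed.

Let F_of d' (T : measurableType d') (X : Omega -> T) B : measurable B -> sigma_of X (X @^-1` B).
Proof. by move=> mB; apply: sub_gen_smallest; exists B. Qed.

Let F_of_seq d' (T : measurableType d') (X : nat -> Omega -> T) n B :
  measurable B -> sigma_of_seq X (X n @^-1` B).
Proof. by move=> mB; apply: sub_gen_smallest; exists n => //; exists B. Qed.

Notation joinT := (joinType F).

Lemma measurable_Psi_join (S : set idx) n : S iPsi -> measurable_fun setT (Psi n : joinT S -> R * R).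
Proof. by move=> SP; apply: (measurable_fun_join SP) => B; exact: (@F_of_seq _ _ Psi). Qed.

Lemma measurable_Phi_join (S : set idx) n : S iPhi -> measurable_fun setT (Phi n : joinT S -> R * R).
Proof. by move=> SP; apply: (measurable_fun_join SP) => B; exact: (@F_of_seq _ _ Phi). Qed.

Lemma measurable_Ry_join (S : set idx) n : S (iMark n) -> measurable_fun setT (Ry n : joinT S -> R).
Proof. by move=> SP; apply: (measurable_fun_join SP) => B; exact: (@F_of _ _ (Ry n)). Qed.

Lemma measurable_hx_join (S : set idx) n : S (iHx n) -> measurable_fun setT (hx n : joinT S -> R).
Proof. by move=> SP; apply: (measurable_fun_join SP) => B; exact: (@F_of _ _ (hx n)). Qed.

Lemma measurable_hy_join (S : set idx) n : S (iHy n) -> measurable_fun setT (hy n : joinT S -> R).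
Proof. by move=> SP; apply: (measurable_fun_join SP) => B; exact: (@F_of _ _ (hy n)). Qed.

Lemma measurable_ro_join (S : set idx) : S iRo -> measurable_fun setT (ro : joinT S -> R).
Proof. by move=> SP; apply: (measurable_fun_join SP) => B; exact: (@F_of _ _ ro). Qed.

(** A singleton join adds no events. This allows a whole process, as the identity map to [joinT
    [set i]], to be integrated out in one move. *)
Let join1 i (B : set Omega) : sigma_join F [set i] B -> F i B.
Proof.
suff: sigma_join F [set i] `<=` F i by apply.
apply: smallest_sub; first exact: model_family_sigma_algebra.
by move=> A [_ ->].
Qed.

Section product_form.
Variables (k : R -> R) (gx : R * (R * R) * R -> R) (gy : R * (R * R) * R * R -> R).
Hypotheses (mk : measurable_fun setT k) (k01 : forall r, 0 <= k r <= 1).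
Hypotheses (mgx : measurable_fun setT gx) (gx01 : forall x, 0 <= gx x <= 1).
Hypotheses (mgy : measurable_fun setT gy) (gy01 : forall x, 0 <= gy x <= 1).

Let Gx := average (exponential_pdf 1) gx.
Let Gyh := average (exponential_pdf 1) gy.
Let Gy := average fq Gyh.

Let mpdf : measurable_fun setT (exponential_pdf (1 : R)). Proof. exact: measurable_exponential_pdf. Qed.
Let pdf0 x : 0 <= exponential_pdf (1 : R) x. Proof. exact: exponential_pdf_ge0. Qed.

Let mGx : measurable_fun setT Gx.
Proof. exact: (measurable_average mpdf pdf0 mgx gx01 (hx_den 0)). Qed.
Let mGyh : measurable_fun setT Gyh.
Proof. exact: (measurable_average mpdf pdf0 mgy gy01 (hy_den 0)). Qed.
Let Gx01 x : 0 <= Gx x <= 1.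
Proof. exact: (average01 mpdf pdf0 mgx gx01 x (hx_den 0)). Qed.
Let Gyh01 x : 0 <= Gyh x <= 1.
Proof. exact: (average01 mpdf pdf0 mgy gy01 x (hy_den 0)). Qed.
Let mGy : measurable_fun setT Gy.
Proof. exact: (measurable_average mfq fq0 mGyh Gyh01 (Ry_den 0)). Qed.
Let Gy01 x : 0 <= Gy x <= 1.
Proof. exact: (average01 mfq fq0 mGyh Gyh01 x (Ry_den 0)). Qed.

(** Positions, marks and [ro] are frozen; the [2 N] fadings are then averaged factor by factor. *)
Let integrate_fading N :
  (\int[P]_w (k (ro w) * (\prod_(0 <= n < N) gx (ro w, Psi n w, hx n w) *
     \prod_(0 <= n < N) gy (ro w, Phi n w, Ry n w, hy n w)))%:E =
   \int[P]_w (k (ro w) * (\prod_(0 <= n < N) Gx (ro w, Psi n w) *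
     \prod_(0 <= n < N) Gyh (ro w, Phi n w, Ry n w)))%:E)%E.
Proof.
pose S : set idx := [set i | match i with iHx _ | iHy _ | iHo => False | _ => True end].
pose L := [seq iHx n | n <- iota 0 N] ++ [seq iHy n | n <- iota 0 N].
(* Only fading indices occur in [L]; [ho] here and 0 below are placeholders for the other
   constructors. *)
pose X j := match j with iHx n => hx n | iHy n => hy n | _ => ho end.
pose f j (z : joinT S * R) : R := match j with
  | iHx n => gx (ro z.1, Psi n z.1, z.2)
  | iHy n => gy (ro z.1, Phi n z.1, Ry n z.1, z.2) | _ => 0 end.
pose fbar j (w : joinT S) : R := match j with
  | iHx n => Gx (ro w, Psi n w) | iHy n => Gyh (ro w, Phi n w, Ry n w) | _ => 0 end.
have mfst := @measurable_fst _ _ (joinT S) R.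
have msnd := @measurable_snd _ _ (joinT S) R.
have mr : measurable_fun setT (ro : joinT S -> R) by exact: measurable_ro_join.
have mP n : measurable_fun setT (Psi n : joinT S -> R * R) by exact: measurable_Psi_join.
have mQ n : measurable_fun setT (Phi n : joinT S -> R * R) by exact: measurable_Phi_join.
have mY n : measurable_fun setT (Ry n : joinT S -> R) by exact: measurable_Ry_join.
have out := @integrate_out _ _ _ P _ F model_family_measurable model_familyT model_familyI Find
  S X f fbar (fun w => k (ro w)) L.
have LE (u : idx -> R) : \prod_(j <- L) u j =
    \prod_(0 <= n < N) u (iHx n) * \prod_(0 <= n < N) u (iHy n).
  by rewrite /L big_cat !big_map /index_iota subn0.
have inL j : j \in L -> (exists n, j = iHx n) \/ (exists n, j = iHy n).
  by rewrite mem_cat => /orP[/mapP[n _ ->]|/mapP[n _ ->]]; [left|right]; exists n.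
transitivity (\int[P]_w (k (ro w) * \prod_(j <- L) f j (w, X j w))%:E)%E.
  by apply: eq_integral => w _; rewrite LE.
apply: eq_trans; first apply: out.
- rewrite cat_uniq !map_inj_uniq ?iota_uniq//=; last 2 first.
  + by move=> m n [].
  + by move=> m n [].
  rewrite andbT; apply/hasPn => j /mapP[n _ ->]; apply/negP => /mapP[m _].
  by [].
- by move=> j /inL[[n ->]|[n ->]].
- by move=> j B /inL[[n ->]|[n ->]] mB; [exact: (@F_of _ _ (hx n))|exact: (@F_of _ _ (hy n))].
- move=> j /inL[[n ->]|[n ->]] /=.
    apply: (measurableT_comp mgx); apply: measurable_fun_pair => //.
    apply: measurable_fun_pair; first exact: (measurableT_comp mr mfst).
    exact: (measurableT_comp (mP n) mfst).
  apply: (measurableT_comp mgy); apply: measurable_fun_pair => //.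
  apply: measurable_fun_pair; last exact: (measurableT_comp (mY n) mfst).
  apply: measurable_fun_pair; first exact: (measurableT_comp mr mfst).
  exact: (measurableT_comp (mQ n) mfst).
- move=> j /inL[[n ->]|[n ->]] /=.
    by apply: (measurableT_comp mGx); apply: measurable_fun_pair.
  apply: (measurableT_comp mGyh); apply: measurable_fun_pair => //.
  exact: measurable_fun_pair.
- by move=> j x /inL[[n ->]|[n ->]] /=; [have /andP[] := gx01 (ro x.1, Psi n x.1, x.2)
    |have /andP[] := gy01 (ro x.1, Phi n x.1, Ry n x.1, x.2)].
- by move=> j x /inL[[n ->]|[n ->]] /=; [have /andP[] := Gx01 (ro x, Psi n x)
    |have /andP[] := Gyh01 (ro x, Phi n x, Ry n x)].
- move=> j w /inL[[n ->]|[n ->]] /=.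
    exact: (averageE mpdf pdf0 mgx gx01 _ (hx_den n)).
  exact: (averageE mpdf pdf0 mgy gy01 _ (hy_den n)).
- exact: measurableT_comp.
- by move=> w; have /andP[] := k01 (ro w).
by apply: eq_integral => w _; rewrite LE.
Qed.

(** The marks come after the fadings because the averages [Gyh] are still functions of the mark. *)
Let integrate_marks N :
  (\int[P]_w (k (ro w) * (\prod_(0 <= n < N) Gx (ro w, Psi n w) *
     \prod_(0 <= n < N) Gyh (ro w, Phi n w, Ry n w)))%:E =
   \int[P]_w (k (ro w) * (\prod_(0 <= n < N) Gx (ro w, Psi n w) *
     \prod_(0 <= n < N) Gy (ro w, Phi n w)))%:E)%E.
Proof.
pose S : set idx := [set i | match i with iPsi | iPhi | iRo => True | _ => False end].
pose L := [seq iMark n | n <- iota 0 N].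
pose X j := match j with iMark n => Ry n | _ => ho end.
pose f j (z : joinT S * R) : R := match j with
  | iMark n => Gyh (ro z.1, Phi n z.1, z.2) | _ => 0 end.
pose fbar j (w : joinT S) : R := match j with
  | iMark n => Gy (ro w, Phi n w) | _ => 0 end.
have mfst := @measurable_fst _ _ (joinT S) R.
have msnd := @measurable_snd _ _ (joinT S) R.
have mr : measurable_fun setT (ro : joinT S -> R) by exact: measurable_ro_join.
have mP n : measurable_fun setT (Psi n : joinT S -> R * R) by exact: measurable_Psi_join.
have mQ n : measurable_fun setT (Phi n : joinT S -> R * R) by exact: measurable_Phi_join.
have out := @integrate_out _ _ _ P _ F model_family_measurable model_familyT model_familyI Find
  S X f fbar (fun w => k (ro w) * \prod_(0 <= n < N) Gx (ro w, Psi n w)) L.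
have LE (u : idx -> R) : \prod_(j <- L) u j = \prod_(0 <= n < N) u (iMark n).
  by rewrite /L big_map /index_iota subn0.
have inL j : j \in L -> exists n, j = iMark n by move=> /mapP[n _ ->]; exists n.
transitivity (\int[P]_w (k (ro w) * \prod_(0 <= n < N) Gx (ro w, Psi n w) *
    \prod_(j <- L) f j (w, X j w))%:E)%E.
  by apply: eq_integral => w _; rewrite LE mulrA.
apply: eq_trans; first apply: out.
- by rewrite map_inj_uniq ?iota_uniq// => m n [].
- by move=> j /inL[n ->].
- by move=> j B /inL[n ->] mB; exact: (@F_of _ _ (Ry n)).
- move=> j /inL[n ->] /=.
  apply: (measurableT_comp mGyh); apply: measurable_fun_pair => //.
  apply: measurable_fun_pair; first exact: (measurableT_comp mr mfst).
  exact: (measurableT_comp (mQ n) mfst).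
- move=> j /inL[n ->] /=.
  by apply: (measurableT_comp mGy); apply: measurable_fun_pair.
- by move=> j x /inL[n ->] /=; have /andP[] := Gyh01 (ro x.1, Phi n x.1, x.2).
- by move=> j x /inL[n ->] /=; have /andP[] := Gy01 (ro x, Phi n x).
- move=> j w /inL[n ->] /=; exact: (averageE mfq fq0 mGyh Gyh01 _ (Ry_den n)).
- apply: measurable_funM; first exact: measurableT_comp.
  by apply: measurable_prod => n _; apply: (measurableT_comp mGx); exact: measurable_fun_pair.
- move=> w; apply: mulr_ge0; first by have /andP[] := k01 (ro w).
  by apply: prodr_ge0 => n _; have /andP[] := Gx01 (ro w, Psi n w).
by apply: eq_integral => w _; rewrite LE mulrA.
Qed.

Let ux N r := fine (\int[P]_w (\prod_(n < N) Gx (r, Psi n w))%:E)%E.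
Let uy N r := fine (\int[P]_w (\prod_(n < N) Gy (r, Phi n w))%:E)%E.

Let integrate_process (G : R * (R * R) -> R) (X : nat -> Omega -> R * R) (N : nat) :
  measurable_fun setT G -> (forall x, 0 <= G x <= 1) -> (forall n, measurable_fun setT (X n)) ->
  let u r := fine (\int[P]_w (\prod_(n < N) G (r, X n w))%:E)%E in
  [/\ measurable_fun setT u, forall r, 0 <= u r <= 1 &
      forall r, (\int[P]_w (\prod_(n < N) G (r, X n w))%:E = (u r)%:E)%E].
Proof.
move=> mG G01 mX u.
have mp : measurable_fun setT (fun z : R * Omega => \prod_(n < N) G (z.1, X n z.2)).
  apply: measurable_prod => n _; apply: (measurableT_comp mG).
  apply: measurable_fun_pair => //.
  exact: (measurableT_comp (mX n) (@measurable_snd _ _ R Omega)).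
have p01 r w : 0 <= \prod_(n < N) G (r, X n w) <= 1.
  by rewrite prodr_ge0/= ?prodr_ile1// => n _; have /andP[] := G01 (r, X n w).
have uE r : (\int[P]_w (\prod_(n < N) G (r, X n w))%:E = (u r)%:E)%E.
  by apply: integral_unit_fin => //; exact: (@measurable_fun_pair2 _ _ _ R Omega R _ r mp).
split => //.
- apply/measurable_EFinP.
  apply: (eq_measurable_fun (fubini_F P (fun z : R * Omega => (\prod_(n < N) G (z.1, X n z.2))%:E))).
    by move=> r _; rewrite /fubini_F /= uE.
  apply: measurable_fun_fubini_tonelli_F => [|z]; first exact/measurable_EFinP.
  by rewrite lee_fin; have /andP[] := p01 z.1 z.2.
- move=> r; rewrite -!lee_fin -uE; apply/andP; split.
    by apply: integral_ge0 => w _; rewrite lee_fin; have /andP[] := p01 r w.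
  apply: (@le_trans _ _ (\int[P]_w (cst 1 w))%E); last by rewrite integral_cst// mul1e probability_le1.
  apply: ge0_le_integral => //.
  + by move=> w _; rewrite lee_fin; have /andP[] := p01 r w.
  + by apply/measurable_EFinP; exact: (@measurable_fun_pair2 _ _ _ R Omega R _ r mp).
  + by move=> w _; rewrite lee_fin; have /andP[] := p01 r w.
Qed.

(** [Psi] is averaged with [Phi] and [ro] frozen, then [Phi] with [ro] frozen. Each process is taken
    as a whole, since its points are not independent of one another. *)
Let integrate_points N :
  (\int[P]_w (k (ro w) * (\prod_(0 <= n < N) Gx (ro w, Psi n w) *
     \prod_(0 <= n < N) Gy (ro w, Phi n w)))%:E =
   \int[P]_w (k (ro w) * (ux N (ro w) * uy N (ro w)))%:E)%E.
Proof.
have [mux ux01 uxE] := integrate_process N mGx Gx01 mPsi.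
have [muy uy01 uyE] := integrate_process N mGy Gy01 mPhi.
pose S : set idx := [set i | match i with iPhi | iRo => True | _ => False end].
pose S' : set idx := [set iRo].
pose f (z : joinT S * joinT [set iPsi]) : \bar R :=
  ((k (ro z.1) * \prod_(n < N) Gy (ro z.1, Phi n z.1)) * \prod_(n < N) Gx (ro z.1, Psi n z.2))%:E.
pose f' (z : joinT S' * joinT [set iPhi]) : \bar R :=
  ((k (ro z.1) * ux N (ro z.1)) * \prod_(n < N) Gy (ro z.1, Phi n z.2))%:E.
have k0 r : 0 <= k r by have /andP[] := k01 r.
have ux0 r : 0 <= ux N r by have /andP[] := ux01 r.
have px0 r w : 0 <= \prod_(n < N) Gx (r, Psi n w).
  by apply: prodr_ge0 => n _; have /andP[] := Gx01 (r, Psi n w).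
have py0 r w : 0 <= \prod_(n < N) Gy (r, Phi n w).
  by apply: prodr_ge0 => n _; have /andP[] := Gy01 (r, Phi n w).
have mfst := @measurable_fst _ _ (joinT S) (joinT [set iPsi]).
have msnd := @measurable_snd _ _ (joinT S) (joinT [set iPsi]).
have mfst' := @measurable_fst _ _ (joinT S') (joinT [set iPhi]).
have msnd' := @measurable_snd _ _ (joinT S') (joinT [set iPhi]).
have mr : measurable_fun setT (ro : joinT S -> R) by exact: measurable_ro_join.
have mr' : measurable_fun setT (ro : joinT S' -> R) by exact: measurable_ro_join.
have mP n : measurable_fun setT (Psi n : joinT [set iPsi] -> R * R) by exact: measurable_Psi_join.
have mQ n : measurable_fun setT (Phi n : joinT S -> R * R) by exact: measurable_Phi_join.
have mQ' n : measurable_fun setT (Phi n : joinT [set iPhi] -> R * R) by exact: measurable_Phi_join.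
have h1 : (\int[P]_w f (w, w) = \int[P]_w \int[P]_w' f (w, w'))%E.
  apply: (@indep_fubini_join _ _ _ P _ F model_family_measurable model_familyT model_familyI Find
    _ (joinT [set iPsi]) S iPsi id f).
  - by [].
  - by move=> B mB; exact: (@join1 iPsi).
  - apply/measurable_EFinP; apply: measurable_funM; first apply: measurable_funM.
    + exact: (measurableT_comp mk (measurableT_comp mr mfst)).
    + apply: measurable_prod => n _; apply: (measurableT_comp mGy); apply: measurable_fun_pair.
        exact: (measurableT_comp mr mfst).
      exact: (measurableT_comp (mQ n) mfst).
    + apply: measurable_prod => n _; apply: (measurableT_comp mGx); apply: measurable_fun_pair.
        exact: (measurableT_comp mr mfst).
      exact: (measurableT_comp (mP n) msnd).
  - by move=> z; rewrite lee_fin !mulr_ge0.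
have h2 : (\int[P]_w f' (w, w) = \int[P]_w \int[P]_w' f' (w, w'))%E.
  apply: (@indep_fubini_join _ _ _ P _ F model_family_measurable model_familyT model_familyI Find
    _ (joinT [set iPhi]) S' iPhi id f').
  - by [].
  - by move=> B mB; exact: (@join1 iPhi).
  - apply/measurable_EFinP; apply: measurable_funM; first apply: measurable_funM.
    + exact: (measurableT_comp mk (measurableT_comp mr' mfst')).
    + exact: (measurableT_comp mux (measurableT_comp mr' mfst')).
    + apply: measurable_prod => n _; apply: (measurableT_comp mGy); apply: measurable_fun_pair.
        exact: (measurableT_comp mr' mfst').
      exact: (measurableT_comp (mQ' n) msnd').
  - by move=> z; rewrite lee_fin !mulr_ge0.
transitivity (\int[P]_w f (w, w))%E.
  by apply: eq_integral => w _; rewrite /f /= !big_mkord; congr (_%:E); ring.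
rewrite h1; transitivity (\int[P]_w f' (w, w))%E.
  apply: eq_integral => w _; rewrite /f /f' /=.
  under eq_integral do rewrite EFinM.
  rewrite ge0_integralZl_EFin//; last 3 first.
  - by move=> w' _; rewrite lee_fin.
  - apply/measurable_EFinP; apply: measurable_prod => n _; apply: (measurableT_comp mGx).
    exact: measurable_fun_pair.
  - by rewrite mulr_ge0.
  by rewrite uxE -EFinM; congr (_%:E); rewrite /ux; ring.
rewrite h2; apply: eq_integral => w _; rewrite /f' /=.
under eq_integral do rewrite EFinM.
rewrite ge0_integralZl_EFin//; last 3 first.
- by move=> w' _; rewrite lee_fin.
- apply/measurable_EFinP; apply: measurable_prod => n _; apply: (measurableT_comp mGy).
  exact: measurable_fun_pair.
- by rewrite mulr_ge0.
by rewrite uyE -EFinM; congr (_%:E); rewrite /uy; ring.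
Qed.

Let unit3 (a b c : R) : 0 <= a <= 1 -> 0 <= b <= 1 -> 0 <= c <= 1 -> 0 <= a * (b * c) <= 1.
Proof.
move=> /andP[a0 a1] /andP[b0 b1] /andP[c0 c1].
by rewrite !mulr_ge0//= !mulr_ile1// mulr_ge0.
Qed.

(** For a fixed value of [ro] the averaged products converge by the Laplace functional. They lie in
    the unit interval, so bounded convergence applies under the law of [ro]. *)
Lemma laplace_products :
  {ae P, forall w, area_loss Gx (ro w) \is a fin_num} ->
  {ae P, forall w, area_loss Gy (ro w) \is a fin_num} ->
  (\int[P]_w (k (ro w) * (\prod_(0 <= n < N) gx (ro w, Psi n w, hx n w) *
     \prod_(0 <= n < N) gy (ro w, Phi n w, Ry n w, hy n w)))%:E)%E @[N --> \oo] -->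
  (\int[P]_w (k (ro w) * (expR (- (lam * fine (area_loss Gx (ro w)))) *
     expR (- (lam * fine (area_loss Gy (ro w))))))%:E)%E.
Proof.
move=> finx finy.
under eq_fun do rewrite integrate_fading integrate_marks integrate_points.
have mlx : measurable_fun setT (fun w => expR (- (lam * fine (area_loss Gx (ro w))))).
  apply: (measurableT_comp (f := @expR R)) => //; apply: measurable_funN; apply: measurable_funM => //.
  apply: measurableT_comp => //.
  exact: (measurableT_comp (measurable_area_loss mGx Gx01)).
have mly : measurable_fun setT (fun w => expR (- (lam * fine (area_loss Gy (ro w))))).
  apply: (measurableT_comp (f := @expR R)) => //; apply: measurable_funN; apply: measurable_funM => //.
  apply: measurableT_comp => //.
  exact: (measurableT_comp (measurable_area_loss mGy Gy01)).
have mkr : measurable_fun setT (fun w => k (ro w)) by exact: measurableT_comp.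
apply: bounded_convergence.
- move=> N; have [mux ux01 uxE] := integrate_process N mGx Gx01 mPsi.
  have [muy uy01 uyE] := integrate_process N mGy Gy01 mPhi.
  apply: measurable_funM; [exact: mkr|apply: measurable_funM].
    exact: (measurableT_comp mux).
  exact: (measurableT_comp muy).
- by apply: measurable_funM; [exact: mkr|apply: measurable_funM; [exact: mlx|exact: mly]].
- apply: filterS2 finx finy => w fx fy.
  have cv (G : R * (R * R) -> R) (X : nat -> Omega -> R * R) : is_PPP P lam X ->
      measurable_fun setT G -> (forall x, 0 <= G x <= 1) -> area_loss G (ro w) \is a fin_num ->
      fine (\int[P]_w' (\prod_(n < N) G (ro w, X n w'))%:E)%E @[N --> \oo] -->
      expR (- (lam * fine (area_loss G (ro w)))).
    move=> XP mG G01 fG; apply: (@fine_cvg _ _ _ _ (fun N => (\int[P]_w' (\prod_(n < N) G (ro w, X n w'))%:E)%E)).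
    apply: (laplace_functional lam0 XP (G := fun x => G (ro w, x))) => //.
    - exact: (@measurable_fun_pair2 _ _ _ R (R * R)%type R _ (ro w) mG).
    - by rewrite fineK.
  apply: cvgM; first exact: cvg_cst.
  by apply: cvgM; apply: cv.
- move=> N w; have [_ ux01 _] := integrate_process N mGx Gx01 mPsi.
  have [_ uy01 _] := integrate_process N mGy Gy01 mPhi.
  apply: unit3; [exact: k01|exact: ux01|exact: uy01].
Qed.

End product_form.

End interference.

Section laplace_weight_sum.
Context (R : realType).

Lemma elapD (s : R) (e e' : \bar R) : (0 <= e)%E -> (0 <= e')%E ->
  elap s (e + e')%E = elap s e * elap s e'.
Proof.
case: e => [r| |] //=; case: e' => [r'| |] //= _ _; rewrite ?mulr0 ?mul0r//.
by rewrite -expRD; congr expR; ring.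
Qed.

Lemma ereal_subr (a : \bar R) (u v : R) : (a + u%:E = v%:E)%E -> a = (v - u)%:E.
Proof. by case: a => [a| |] //= [<-]; rewrite addrK. Qed.

End laplace_weight_sum.

Section interference_transform.
Context d (Omega : measurableType d) (R : realType) (P : probability Omega R).
Notation mu := (@lebesgue_measure R).
Variables (lam : R) (fq : R -> R).
Variables (Psi Phi : nat -> Omega -> R * R) (Ry hx hy : nat -> Omega -> R) (ho ro : Omega -> R).
Hypothesis lam0 : 0 < lam.
Hypotheses (mfq : measurable_fun setT fq) (fq0 : forall q, 0 <= fq q).
Hypotheses (Psi_PPP : is_PPP P lam Psi) (Phi_PPP : is_PPP P lam Phi).
Hypotheses (Ry_den : forall n, has_density P (Ry n) fq).
Hypotheses (hx_den : forall n, has_density P (hx n) (exponential_pdf 1)).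
Hypotheses (hy_den : forall n, has_density P (hy n) (exponential_pdf 1)).
Hypotheses (ho_den : has_density P ho (exponential_pdf 1)).
Hypothesis mro : measurable_fun setT ro.
Notation F := (model_family Psi Phi Ry hx hy ho ro).
Hypothesis Find : mutually_independent P F.

Let mPsi n : measurable_fun setT (Psi n). Proof. by case: Psi_PPP. Qed.
Let mPhi n : measurable_fun setT (Phi n). Proof. by case: Phi_PPP. Qed.
Let mRy n : measurable_fun setT (Ry n). Proof. by case: (Ry_den n). Qed.
Let mhx n : measurable_fun setT (hx n). Proof. by case: (hx_den n). Qed.
Let mhy n : measurable_fun setT (hy n). Proof. by case: (hy_den n). Qed.
Let mho : measurable_fun setT ho. Proof. by case: ho_den. Qed.

Variables (bx : R * (R * R) -> R) (bY : R * (R * R) * R -> R).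
Hypotheses (mbx : measurable_fun setT bx) (bx0 : forall x, 0 <= bx x).
Hypotheses (mbY : measurable_fun setT bY) (bY0 : forall x, 0 <= bY x).

(** A common form of both links: [bx] and [bY] are the received powers, per unit of fading, as
    functions of the serving distance, the position and the mark. *)
Definition interference (w : Omega) : \bar R :=
  (\sum_(0 <= n <oo) (bx (ro w, Psi n w) * `|hx n w|)%:E +
   \sum_(0 <= n <oo) (bY (ro w, Phi n w, Ry n w) * `|hy n w|)%:E)%E.

Lemma interference_ge0 w : (0 <= interference w)%E.
Proof.
by rewrite adde_ge0//; apply: nneseries_ge0 => n _ _; rewrite lee_fin mulr_ge0.
Qed.

(** Measurability with [iHo] left out expresses that the interference does not involve the desired
    fading, which is what later allows [ho] to be averaged separately. *)
Lemma measurable_interference_join (S : set idx) : [set~ iHo] `<=` S ->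
  measurable_fun setT (interference : joinType F S -> \bar R).
Proof.
move=> SE; have Sn i : i != iHo -> S i by move=> /eqP; exact: SE.
apply: emeasurable_funD; apply: ge0_emeasurable_sum.
- by move=> n w _ _; rewrite lee_fin mulr_ge0.
- move=> n _; apply/measurable_EFinP; apply: measurable_funM.
    apply: (measurableT_comp mbx); apply: measurable_fun_pair.
      by apply: measurable_ro_join; exact: Sn.
    by apply: measurable_Psi_join; exact: Sn.
  by apply: measurableT_comp => //; apply: measurable_hx_join; exact: Sn.
- by move=> n w _ _; rewrite lee_fin mulr_ge0.
- move=> n _; apply/measurable_EFinP; apply: measurable_funM.
    apply: (measurableT_comp mbY); apply: measurable_fun_pair; first apply: measurable_fun_pair.
    + by apply: measurable_ro_join; exact: Sn.
    + by apply: measurable_Phi_join; exact: Sn.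
    + by apply: measurable_Ry_join; exact: Sn.
  by apply: measurableT_comp => //; apply: measurable_hy_join; exact: Sn.
Qed.

Lemma measurable_interference : measurable_fun setT interference.
Proof.
have mI : measurable_fun setT (interference : joinType F [set~ iHo] -> \bar R).
  by apply: measurable_interference_join.
exact: (measurable_fun_joinW (model_family_measurable Psi_PPP Phi_PPP Ry_den hx_den hy_den ho_den mro) mI).
Qed.

Definition bs_loss (s r : R) : \bar R :=
  (\int[(mu \x mu)%E]_x (1 - (1 + s * bx (r, x))^-1)%:E)%E.

(** The loss, rather than the survival factor, is averaged over the mark. Both give the same
    exponent because [fq] has total mass 1, and in this form the integrals over area and mark can be
    exchanged. *)
Definition ue_loss (s r : R) : \bar R :=
  (\int[(mu \x mu)%E]_y \int[mu]_q (fq q * (1 - (1 + s * bY (r, y, q))^-1))%:E)%E.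

(** The finite products of exponentials have two limits: bounded convergence leads to the transform
    of the full series, and [laplace_products] to the exponentials of the losses. *)
Lemma laplace_interference (s : R) (k : R -> R) : 0 < s ->
  measurable_fun setT k -> (forall r, 0 <= k r <= 1) ->
  {ae P, forall w, bs_loss s (ro w) \is a fin_num} ->
  {ae P, forall w, ue_loss s (ro w) \is a fin_num} ->
  (\int[P]_w (k (ro w) * elap s (interference w))%:E =
   \int[P]_w (k (ro w) * (expR (- (lam * fine (bs_loss s (ro w)))) *
     expR (- (lam * fine (ue_loss s (ro w))))))%:E)%E.
Proof.
move=> s0 mk k01 finx finy.
pose gx (z : R * (R * R) * R) := expR (- (s * bx z.1 * `|z.2|)).
pose gy (z : R * (R * R) * R * R) := expR (- (s * bY z.1 * `|z.2|)).
have e01 (a : R) : 0 <= a -> 0 <= expR (- a) <= 1.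
  by move=> a0; rewrite expR_ge0/= -expR0 ler_expR oppr_le0.
have gx01 z : 0 <= gx z <= 1 by apply: e01; rewrite !mulr_ge0// ltW.
have gy01 z : 0 <= gy z <= 1 by apply: e01; rewrite !mulr_ge0// ltW.
have mgx : measurable_fun setT gx.
  apply: (measurableT_comp (f := @expR R)) => //; apply: measurable_funN; apply: measurable_funM.
    by apply: measurable_funM => //; exact: (measurableT_comp mbx).
  exact: measurableT_comp.
have mgy : measurable_fun setT gy.
  apply: (measurableT_comp (f := @expR R)) => //; apply: measurable_funN; apply: measurable_funM.
    by apply: measurable_funM => //; exact: (measurableT_comp mbY).
  exact: measurableT_comp.
have GxE z : average (exponential_pdf 1) gx z = (1 + s * bx z)^-1.
  exact: (congr1 fine (laplace_exponential (mulr_ge0 (ltW s0) (bx0 z)))).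
have GyhE z : average (exponential_pdf 1) gy z = (1 + s * bY z)^-1.
  exact: (congr1 fine (laplace_exponential (mulr_ge0 (ltW s0) (bY0 z)))).
have sb0 z : 0 < 1 + s * bY z by rewrite ltr_wpDr// mulr_ge0// ltW.
have miq x : measurable_fun setT (fun q => (1 + s * bY (x, q))^-1).
  apply: measurable_funV; apply: measurable_funD => //; apply: measurable_funM => //.
  exact: (@measurable_fun_pair2 _ _ _ (R * (R * R))%type R R bY x mbY).
have i01 z : 0 <= (1 + s * bY z)^-1 <= 1.
  by rewrite invr_ge0 (ltW (sb0 z))/= invf_le1// lerDl mulr_ge0// ltW.
have fqT : (\int[mu]_q (fq q)%:E = 1)%E.
  have [_ h] := Ry_den 0; have := h setT measurableT.
  by rewrite preimage_setT probability_setT => <-.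
have GyE x : (\int[mu]_q (fq q * (1 - (1 + s * bY (x, q))^-1))%:E =
    (1 - average fq (average (exponential_pdf 1) gy) x)%:E)%E.
  set A := (\int[mu]_q _)%E.
  have aE : (\int[mu]_q ((1 + s * bY (x, q))^-1 * fq q)%:E =
      (average fq (average (exponential_pdf 1) gy) x)%:E)%E.
    have h := @averageE _ _ _ P _ _ fq _ mfq fq0
      (measurable_average (measurable_exponential_pdf 1) (exponential_pdf_ge0 ler01) mgy gy01 (hy_den 0))
      (fun z => average01 (measurable_exponential_pdf 1) (exponential_pdf_ge0 ler01) mgy gy01 z (hy_den 0))
      (Ry 0) x (Ry_den 0).
    rewrite -h.
    rewrite (expectation_density (f := fun q => (average (exponential_pdf 1) gy (x, q))%:E) (Ry_den 0))//.
    - by apply: eq_integral => q _; rewrite GyhE.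
    - apply/measurable_EFinP; apply: (eq_measurable_fun (fun q => (1 + s * bY (x, q))^-1)) => //.
    - by move=> q; rewrite GyhE lee_fin; have /andP[] := i01 (x, q).
  have : (A + \int[mu]_q ((1 + s * bY (x, q))^-1 * fq q)%:E = 1)%E.
    rewrite -ge0_integralD//.
    - by rewrite -fqT; apply: eq_integral => q _; rewrite -EFinD; congr (_%:E); ring.
    - move=> q _; rewrite lee_fin mulr_ge0// subr_ge0; by have /andP[] := i01 (x, q).
    - apply/measurable_EFinP; apply: measurable_funM => //; apply: measurable_funB => //.
      exact: miq.
    - by move=> q _; rewrite lee_fin mulr_ge0//; have /andP[] := i01 (x, q).
    - by apply/measurable_EFinP; apply: measurable_funM => //; exact: miq.
  by rewrite aE; exact: ereal_subr.
have lossx r : area_loss (average (exponential_pdf 1) gx) r = bs_loss s r.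
  by apply: eq_integral => x _; rewrite GxE.
have lossy r : area_loss (average fq (average (exponential_pdf 1) gy)) r = ue_loss s r.
  by apply: eq_integral => x _; rewrite GyE.
have cv : (\int[P]_w (k (ro w) * (\prod_(0 <= n < N) gx (ro w, Psi n w, hx n w) *
     \prod_(0 <= n < N) gy (ro w, Phi n w, Ry n w, hy n w)))%:E)%E @[N --> \oo] -->
  (\int[P]_w (k (ro w) * (expR (- (lam * fine (bs_loss s (ro w)))) *
     expR (- (lam * fine (ue_loss s (ro w))))))%:E)%E.
  have h := laplace_products lam0 mfq fq0 Psi_PPP Phi_PPP Ry_den hx_den hy_den ho_den mro Find
    mk k01 mgx gx01 mgy gy01.
  rewrite (_ : (\int[P]_w _)%E = (\int[P]_w (k (ro w) *
    (expR (- (lam * fine (area_loss (average (exponential_pdf 1) gx) (ro w)))) *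
     expR (- (lam * fine (area_loss (average fq (average (exponential_pdf 1) gy)) (ro w))))))%:E)%E).
    apply: h.
      by apply: filterS finx => w; rewrite lossx.
    by apply: filterS finy => w; rewrite lossy.
  by apply: eq_integral => w _; rewrite lossx lossy.
have mI := measurable_interference.
have cv' : (\int[P]_w (k (ro w) * (\prod_(0 <= n < N) gx (ro w, Psi n w, hx n w) *
     \prod_(0 <= n < N) gy (ro w, Phi n w, Ry n w, hy n w)))%:E)%E @[N --> \oo] -->
  (\int[P]_w (k (ro w) * elap s (interference w))%:E)%E.
  apply: bounded_convergence.
  - move=> N; apply: measurable_funM; first exact: measurableT_comp.
    apply: measurable_funM; apply: measurable_prod => n _.
      apply: (measurableT_comp mgx); apply: measurable_fun_pair => //.
      exact: measurable_fun_pair.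
    apply: (measurableT_comp mgy); apply: measurable_fun_pair => //.
    apply: measurable_fun_pair => //; exact: measurable_fun_pair.
  - apply: measurable_funM; first exact: measurableT_comp.
    by apply: measurable_elap => //; exact: interference_ge0.
  - apply: aeW => w; apply: cvgM; first exact: cvg_cst.
    rewrite /interference elapD; last 2 first.
    + by apply: nneseries_ge0 => n _ _; rewrite lee_fin mulr_ge0.
    + by apply: nneseries_ge0 => n _ _; rewrite lee_fin mulr_ge0.
    have E (u : nat -> R) N : \prod_(0 <= n < N) expR (- (s * u n)) =
        expR (- (s * \sum_(0 <= n < N) u n)).
      by rewrite -expR_sum sumrN mulr_sumr.
    apply: cvgM.
    + rewrite (_ : (fun N => _) = (fun N => expR (- (s * \sum_(0 <= n < N) (bx (ro w, Psi n w) * `|hx n w|))))).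
        by apply: cvg_elap => // n; rewrite mulr_ge0.
      by apply/funext => N; rewrite -E; apply: eq_bigr => n _; rewrite /gx /= mulrA.
    + rewrite (_ : (fun N => _) = (fun N => expR (- (s * \sum_(0 <= n < N) (bY (ro w, Phi n w, Ry n w) * `|hy n w|))))).
        by apply: cvg_elap => // n; rewrite mulr_ge0.
      by apply/funext => N; rewrite -E; apply: eq_bigr => n _; rewrite /gy /= mulrA.
  - move=> N w; have /andP[k0 k1] := k01 (ro w).
    have p01 (u : nat -> R) : (forall n, 0 <= u n <= 1) -> 0 <= \prod_(0 <= n < N) u n <= 1.
      by move=> u01; rewrite big_mkord prodr_ge0/= ?prodr_ile1// => n _; have /andP[] := u01 n.
    have /andP[x0 x1] := p01 (fun n => gx (ro w, Psi n w, hx n w)) (fun n => gx01 _).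
    have /andP[y0 y1] := p01 (fun n => gy (ro w, Phi n w, Ry n w, hy n w)) (fun n => gy01 _).
    by rewrite !mulr_ge0//= !mulr_ile1// mulr_ge0.
exact: (cvg_unique _ cv' cv).
Qed.

(** [ho] is averaged first, by [expected_erfc] at Y = interference + c, and Tonelli then brings the
    integral in [z] outside. In exp(- z (1 + Y / om2)) the 1 is the factor exp(- z), and Y splits
    into its noise and interference parts. *)
Lemma transform_fading (om2 : R) (c : R -> R) : 0 < om2 ->
  measurable_fun setT c -> (forall r, 0 <= c r) ->
  {ae P, forall w, (0 < interference w)%E} ->
  (\int[P]_w (1 - erfc (Num.sqrt (om2 * sinr (ho w) (interference w) (c (ro w)))))%:E =
   \int[mu]_z (((Num.sqrt (pi * z))^-1 * expR (- z))%:E *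
     \int[P]_w (expR (- (z / om2 * c (ro w))) * elap (z / om2) (interference w))%:E))%E.
Proof.
move=> om20 mc c0 I0.
pose S : set idx := [set~ iHo].
pose f (z : joinType F S * R) : \bar R :=
  (1 - erfc (Num.sqrt (om2 * sinr z.2 (interference z.1) (c (ro z.1)))))%:E.
have msqrt : measurable_fun setT (@Num.sqrt R).
  by apply: continuous_measurable_fun; exact: sqrt_continuous.
have mfst := @measurable_fst _ _ (joinType F S) R.
have mr : measurable_fun setT (ro : joinType F S -> R) by exact: measurable_ro_join.
have mI : measurable_fun setT (interference : joinType F S -> \bar R).
  by apply: measurable_interference_join.
have mf : measurable_fun setT f.
  apply/measurable_EFinP; apply: measurable_funB => //.
  apply: (measurableT_comp (@measurable_erfc R)); apply: (measurableT_comp msqrt).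
  apply: measurable_funM => //; apply: measurable_sinr => //.
  - exact: (measurableT_comp mc (measurableT_comp mr mfst)).
  - exact: (measurableT_comp mI mfst).
  - by move=> z; exact: interference_ge0.
have f0 z : (0 <= f z)%E.
  by rewrite lee_fin; have /andP[] := erfc_compl01 (sqrtr_ge0 (om2 * sinr z.2 (interference z.1) (c (ro z.1)))).
pose h (w : Omega) (z : R) := (Num.sqrt (pi * z))^-1 * expR (- z) *
  (expR (- (z / om2 * c (ro w))) * elap (z / om2) (interference w)).
have el0 (s : R) w : 0 <= elap s (interference w).
  by rewrite /elap; case: (interference w) => // r; rewrite expR_ge0.
have h0 w z : 0 <= h w z.
  by rewrite /h !mulr_ge0 ?expR_ge0// invr_ge0 sqrtr_ge0.
(* For z <= 0 the square root is 0 and so is its inverse; this extends the integral in [z] to the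
   whole line. *)
have hE w z : z <= 0 -> h w z = 0.
  move=> z0; rewrite /h (_ : Num.sqrt (pi * z) = 0) ?invr0 ?mul0r//.
  by apply: ler0_sqrtr; rewrite mulr_ge0_le0// pi_ge0.
transitivity (\int[P]_w \int[P]_w' f (w, ho w'))%E.
  apply: (@indep_fubini_join _ _ _ P _ F
    (model_family_measurable Psi_PPP Phi_PPP Ry_den hx_den hy_den ho_den mro)
    (@model_familyT _ _ _ _ _ _ _ _ _ _) (@model_familyI _ _ _ _ _ _ _ _ _ _) Find _ R S iHo ho f) => //.
  - by move=> /(_ erefl).
  - by move=> B mB; apply: sub_gen_smallest; exists B.
have mh : measurable_fun setT (fun z : Omega * R => (h z.1 z.2)%:E).
  have msnd := @measurable_snd _ _ Omega R.
  have mfs := @measurable_fst _ _ Omega R.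
  have me (g : Omega * R -> R) : measurable_fun setT g -> measurable_fun setT (fun z => expR (- g z)).
    by move=> mg; apply: (measurableT_comp (f := @expR R)) => //; exact: measurable_funN.
  have mz : measurable_fun setT (fun z : Omega * R => z.2 / om2) by exact: measurable_funM.
  apply/measurable_EFinP; apply: measurable_funM; apply: measurable_funM.
  - apply: measurable_funV; apply: (measurableT_comp msqrt); exact: measurable_funM.
  - exact: me.
  - apply: me; apply: measurable_funM => //.
    exact: (measurableT_comp mc (measurableT_comp mro mfs)).
  - apply: measurable_elap => //; last by move=> z; exact: interference_ge0.
    exact: (measurableT_comp measurable_interference mfs).
transitivity (\int[P]_w \int[mu]_z (h w z)%:E)%E.
  apply: ge0_integral_ae.
  - by move=> w; apply: integral_ge0 => w' _; exact: f0.
  - by move=> w; apply: integral_ge0 => z _; rewrite lee_fin.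
  apply: filterS I0 => w I0.
  rewrite (expectation_density (f := fun y => f (w, y)) ho_den) //; last 3 first.
  - exact: measurable_exponential_pdf.
  - by move=> x; exact: exponential_pdf_ge0.
  - exact: (@measurable_fun_pair2 _ _ _ (joinType F S) R _ f w mf).
  transitivity (\int[mu]_(z in `]0%R, +oo[) (h w z)%:E)%E; last first.
    rewrite integral_mkcond; apply: eq_integral => z _; rewrite patchE.
    case: ifPn => //; rewrite notin_setE/= in_itv/= andbT => /negP; rewrite -leNgt => z0.
    by rewrite hE.
  (* Infinite interference: [sinr] is 0 and [erfc 0 = 1], while [elap] is 0, so both integrals
     vanish. *)
  move: I0; rewrite /f /h /=; case: (interference w) => [r| |] //= r0; last first.
    rewrite mulr0 sqrtr0.
    have -> : erfc 0 = 1 :> R.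
      have := @erfc_compl R 0 (lexx _); rewrite set_itvco0 integral_set0 => -[] /eqP.
      by rewrite subr_eq0 => /eqP.
    rewrite subrr [LHS]integral0_eq ?[RHS]integral0_eq// => x _; rewrite ?mul0e ?mulr0//.
  rewrite lte_fin in r0.
  have Y0 : 0 < r + c (ro w) by rewrite ltr_wpDr.
  transitivity (\int[mu]_y (exponential_pdf 1 y *
      (1 - erfc (Num.sqrt (om2 * (y / (r + c (ro w)))))))%:E)%E.
    by apply: eq_integral => y _; rewrite -EFinM mulrC.
  rewrite expected_erfc//; apply: eq_integral => z _; congr (_%:E).
  rewrite -[RHS]mulrA -!expRD; congr (_ * expR _).
  by field; rewrite gt_eqF.
transitivity (\int[mu]_z \int[P]_w (h w z)%:E)%E.
  have mh' : measurable_fun (setT : set (Omega * measurableTypeR R)) (fun z => (h z.1 z.2)%:E).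
    exact: mh.
  exact: (@fubini_tonelli _ _ Omega (measurableTypeR R) R P mu _ mh' (fun z => h0 z.1 z.2)).
apply: eq_integral => z _; rewrite /h.
under eq_integral do rewrite EFinM.
rewrite ge0_integralZl_EFin//.
- by move=> w _; rewrite lee_fin mulr_ge0 ?expR_ge0.
- apply/measurable_EFinP; apply: measurable_funM.
    apply: (measurableT_comp (f := @expR R)) => //; apply: measurable_funN; apply: measurable_funM => //.
    exact: measurableT_comp.
  apply: measurable_elap => //; first exact: measurable_interference.
  exact: interference_ge0.
Qed.

End interference_transform.

(** * Existence of distant points, and the loss caused by the users *)

Section far_point.
Context d (Omega : measurableType d) (R : realType) (P : probability Omega R).

(** Void probabilities: a region of area M outside the disk is empty with probability exp(- lam M),
    which tends to 0. This is the source of strictly positive interference. *)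
Lemma ae_far_point (lam : R) (X : nat -> Omega -> R * R) (a : R) : 0 < lam ->
  is_PPP P lam X -> {ae P, forall w, exists n, a < norm2 (X n w)}.
Proof.
move=> lam0 XP; have [mX [PM _]] := XP.
(* Unit-height rectangles to the right of the abscissa [a]: their points have norm above [a], and
   their area is [M]. *)
pose B (M : nat) : set (R * R) := `]a, (a + M%:R)]%classic `*` `[0%R, 1%R]%classic.
have mB M : measurable (B M) by apply: measurableX; exact: measurable_itv.
have bB M : bounded2 (B M).
  exists (`|a| + M%:R + 1) => p [/=]; rewrite !in_itv/= => /andP[p1 p2] /andP[q1 q2].
  rewrite !ler_norml; have := ler_norm a; have := ler_norm (- a); rewrite normrN => h1 h2.
  by have M0 : 0 <= M%:R :> R by []; split; apply/andP; split; lra.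
have areaB M : fine (area2 (B M)) = M%:R.
  rewrite /area2 product_measure1E//; [|exact: measurable_itv..].
  have E1 : @lebesgue_measure R `]a, (a + M%:R)]%classic = (M%:R)%:E.
    rewrite lebesgue_measure_itv/= lte_fin ltrDl.
    by case: ltP => [_|]; [rewrite -EFinB addrAC subrr add0r|case: M => //= M; rewrite lern0].
  have E2 : @lebesgue_measure R `[0%R, 1%R]%classic = 1%E.
    by rewrite lebesgue_measure_itv/= lte_fin ltr01 oppr0 adde0.
  transitivity (fine ((M%:R)%:E * (1%:E : \bar R))%E); last by rewrite mule1.
  by congr (fine (_ * _)%E); [exact: E1|exact: E2].
have mE M : measurable [set w | Defs.count X (B M) w = 0%:R%:E].
  have := measurable_count XP (mB M) measurableT (emeasurable_set1 (0%:R%:E : \bar R)).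
  by rewrite setTI.
exists (\bigcap_M [set w | Defs.count X (B M) w = 0%:R%:E]); split.
- exact: bigcap_measurable.
- apply/eqP; rewrite eq_le measure_ge0 andbT; apply/lee_addgt0Pr => e e0; rewrite add0e.
  have : expR (- (lam * M%:R)) @[M --> \oo] --> 0.
    have lM : lam * M%:R @[M --> \oo] --> +oo.
      apply/cvgryPge => A; apply: filterS (@nbhs_infty_ger R (A / lam)) => M.
      by rewrite ler_pdivrMr// mulrC.
    exact: (cvg_comp _ _ lM (@cvgr_expR R)).
  move=> /cvgrPdist_lt/(_ _ e0)[M _ /(_ M (leqnn _))]; rewrite sub0r normrN => /= h.
  apply: (@le_trans _ _ (P [set w | Defs.count X (B M) w = 0%:R%:E])).
    apply: le_measure; rewrite ?inE//; first exact: bigcap_measurable.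
    by move=> w; apply.
  rewrite (PM _ (mB M) (bB M)) areaB /poisson_mass fact0 divr1 expr0 mulr1 lee_fin.
  by rewrite (le_trans (ler_norm _))// ltW.
- move=> w /= h M _ /=; apply: eseries0 => n _ _; rewrite indicE memNset//.
  move=> [/=]; rewrite !in_itv/= => /andP[p1 _] _; apply: h; exists n.
  apply: (lt_le_trans p1); rewrite (le_trans (ler_norm _))// -sqrtr_sqr ler_wsqrtr//.
  by rewrite lerDl sqr_ge0.
Qed.

End far_point.

Section user_loss.
Context (R : realType) (eta lam rmx rho : R).
Hypotheses (eta2 : 2 < eta) (lam0 : 0 < lam) (rmx0 : 0 < rmx) (rho0 : 0 < rho).
Notation mu := (@lebesgue_measure R).

(** Mean received power of a user divided by [rho], its transmit power being rho q^eta, and set to 0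
    when power control rules the position out. For positive [q] and nonzero [y] the test amounts to
    q < norm2 y: a disk of radius [q] is excluded. *)
Definition ue_gain (y : R * R) (q : R) : R :=
  if rho * q `^ eta * norm2 y `^ (- eta) < rho then q `^ eta * norm2 y `^ (- eta) else 0.

Lemma ue_gain_ge0 y q : 0 <= ue_gain y q.
Proof. by rewrite /ue_gain; case: ifPn => // _; rewrite mulr_ge0 ?powR_ge0. Qed.

Lemma measurable_ue_gain : measurable_fun setT (fun z : (R * R) * R => ue_gain z.1 z.2).
Proof.
have m1 : measurable_fun setT (fun z : (R * R) * R => z.2 `^ eta).
  exact: (measurableT_comp (measurable_powR _)).
have m2 : measurable_fun setT (fun z : (R * R) * R => norm2 z.1 `^ (- eta)).
  apply: (measurableT_comp (measurable_powR _)).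
  exact: (measurableT_comp (@measurable_norm2 R)).
apply: measurable_fun_ifT; last exact: measurable_cst.
  apply: measurable_fun_ltr => //; apply: measurable_funM => //; exact: measurable_funM.
exact: measurable_funM.
Qed.

Let eta0 : 0 < eta. Proof. by rewrite (lt_trans _ eta2). Qed.

Lemma ue_gainE (q : R) (y : R * R) : 0 < q -> 0 < norm2 y ->
  ue_gain y q = if q < norm2 y then q `^ eta * norm2 y `^ (- eta) else 0.
Proof.
move=> q0 y0; rewrite /ue_gain -mulrA gtr_pMr//.
suff -> : (q `^ eta * norm2 y `^ (- eta) < 1) = (q < norm2 y) by [].
rewrite powRN ltr_pdivrMr ?powR_gt0// mul1r.
apply/idP/idP => h; last by apply: (gt0_ltr_powR eta0) => //; rewrite nnegrE ltW.
rewrite ltNge; apply: contraTN h => h; rewrite -leNgt.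
by apply: (ge0_ler_powR (ltW eta0)) => //; rewrite nnegrE ltW.
Qed.

(** At the origin 0^(-eta) evaluates to 0, so the power-control test succeeds there instead of
    failing. The gain is 0 all the same, and the description by the excluded disk survives. *)
Lemma ue_gain_region (ka q : R) (y : R * R) : 0 < q ->
  1 - (1 + ka * ue_gain y q)^-1 =
  if q < norm2 y then 1 - (1 + ka * (q `^ eta * norm2 y `^ (- eta)))^-1 else 0.
Proof.
move=> q0; have : 0 <= norm2 y by exact: sqrtr_ge0.
rewrite le_eqVlt => /orP[/eqP y0|y0].
  rewrite /ue_gain -y0 powR0 ?oppr_eq0 ?gt_eqF// !mulr0 rho0 ltNge (ltW q0) /=.
  by rewrite mulr0 addr0 invr1 subrr.
rewrite ue_gainE//.
by case: ifPn => // _; rewrite mulr0 addr0 invr1 subrr.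
Qed.

Lemma user_loss (ka : R) : 0 <= ka ->
  (\int[(mu \x mu)%E]_y \int[mu]_q (fR lam rmx q * (1 - (1 + ka * ue_gain y q)^-1))%:E =
   (2 * pi * ka / (eta - 2) * Fhyp eta (- ka) *
    (lower_gamma 2 (pi * lam * rmx ^+ 2) /
      (pi * lam * (1 - expR (- (pi * lam * rmx ^+ 2))))))%:E)%E.
Proof.
move=> ka0.
pose f (z : (measurableTypeR R * measurableTypeR R) * measurableTypeR R) :=
  (fR lam rmx z.2 * (1 - (1 + ka * ue_gain z.1 z.2)^-1))%:E.
have g01 y q : 0 <= 1 - (1 + ka * ue_gain y q)^-1.
  have h : 0 <= ka * ue_gain y q by rewrite mulr_ge0// ue_gain_ge0.
  by rewrite subr_ge0 invf_le1 ?lerDl// ltr_wpDr.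
have f0 z : (0 <= f z)%E by rewrite lee_fin mulr_ge0// fR_ge0.
have mf : measurable_fun setT f.
  have mf' : measurable_fun setT (fun z : (R * R) * R => (fR lam rmx z.2 * (1 - (1 + ka * ue_gain z.1 z.2)^-1))%:E).
    apply/measurable_EFinP; apply: measurable_funM.
      exact: (measurableT_comp (measurable_fR lam rmx)).
    apply: measurable_funB => //; apply: measurable_funV; apply: measurable_funD => //.
    by apply: measurable_funM => //; exact: measurable_ue_gain.
  exact: mf'.
rewrite (@tonelli_product _ _ _ (measurableTypeR R) (measurableTypeR R) (measurableTypeR R) R mu mu mu f mf f0).
rewrite -(@integralZ_real _ _ _ mu setT (fun q => q ^+ 2 * fR lam rmx q)
  (2 * pi * ka / (eta - 2) * Fhyp eta (- ka))) //; last first.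
- exact: second_moment.
- by move=> q _; rewrite mulr_ge0 ?sqr_ge0 ?fR_ge0.
- by apply: measurable_funM; [exact: measurable_funX|exact: measurable_fR].
apply: eq_integral => q _; rewrite /f /=.
(* The exterior integral needs a positive radius. For q <= 0, including the endpoint 0 where the
   factor r of the density vanishes, both sides are 0. *)
have [q0|q0] := ltP 0 q; last first.
  have -> : fR lam rmx q = 0.
    rewrite /fR; case: ifPn => // /andP[q0' _].
    have -> : q = 0 by (apply/eqP; rewrite eq_le q0).
    by rewrite mulr0 !mul0r.
  by rewrite mulr0 mulr0 integral0_eq// => y _; rewrite mul0r.
transitivity (\int[(mu \x mu)%E]_y ((fR lam rmx q)%:E *
   (if q < norm2 y then 1 - (1 + ka * (q `^ eta * norm2 y `^ (- eta)))^-1 else 0)%:E))%E.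
  by apply: eq_integral => y _; rewrite EFinM ue_gain_region.
rewrite ge0_integralZl_EFin//; last 3 first.
- by move=> y _; rewrite lee_fin -ue_gain_region.
- have my : measurable_fun setT (fun y : R * R => (if q < norm2 y then 1 - (1 + ka * (q `^ eta * norm2 y `^ (- eta)))^-1 else 0)%:E).
    under eq_fun do rewrite -ue_gain_region//.
    apply/measurable_EFinP; apply: measurable_funB => //; apply: measurable_funV; apply: measurable_funD => //.
    apply: measurable_funM => //.
    exact: (@measurable_fun_pair1 _ _ _ (R * R)%type R R _ q measurable_ue_gain).
  exact: my.
- exact: fR_ge0.
transitivity ((fR lam rmx q)%:E * (2 * pi * q ^+ 2 * ka / (eta - 2) * Fhyp eta (- ka))%:E)%E.
  by congr (_ * _)%E; exact: (integral_sat_outside eta2 q0 ka0).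
by rewrite -EFinM; congr (_%:E); field; rewrite subr_eq0 gt_eqF.
Qed.

End user_loss.

(** * Bit error rates *)

Section error_rate.
Context d (Omega : measurableType d) (R : realType) (P : probability Omega R).
Notation mu := (@lebesgue_measure R).
Variables (lam : R) (fq : R -> R).
Variables (Psi Phi : nat -> Omega -> R * R) (Ry hx hy : nat -> Omega -> R) (ho ro : Omega -> R).
Hypothesis lam0 : 0 < lam.
Hypotheses (mfq : measurable_fun setT fq) (fq0 : forall q, 0 <= fq q).
Hypotheses (Psi_PPP : is_PPP P lam Psi) (Phi_PPP : is_PPP P lam Phi).
Hypotheses (Ry_den : forall n, has_density P (Ry n) fq).
Hypotheses (hx_den : forall n, has_density P (hx n) (exponential_pdf 1)).
Hypotheses (hy_den : forall n, has_density P (hy n) (exponential_pdf 1)).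
Hypotheses (ho_den : has_density P ho (exponential_pdf 1)).
Hypothesis mro : measurable_fun setT ro.
Hypothesis Find : mutually_independent P (model_family Psi Phi Ry hx hy ho ro).
Variables (bx : R * (R * R) -> R) (bY : R * (R * R) * R -> R).
Hypotheses (mbx : measurable_fun setT bx) (bx0 : forall x, 0 <= bx x).
Hypotheses (mbY : measurable_fun setT bY) (bY0 : forall x, 0 <= bY x).
Variables (om1 om2 : R) (c : R -> R).
Hypotheses (om20 : 0 < om2) (mc : measurable_fun setT c) (c0 : forall r, 0 <= c r).

Notation I := (interference Psi Phi Ry hx hy ro bx bY).
Notation bsL := (bs_loss bx).
Notation ueL := (ue_loss fq bY).

Lemma measurable_bs_loss s : 0 <= s -> measurable_fun setT (bsL s).
Proof.
move=> s0; apply: (@measurable_area_loss R (fun z => (1 + s * bx z)^-1)).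
  by apply: measurable_funV; apply: measurable_funD => //; exact: measurable_funM.
move=> z; have h : 0 <= s * bx z by rewrite mulr_ge0.
by rewrite invr_ge0 invf_le1 ?lerDl ?h ?addr_ge0// ltr_wpDr.
Qed.

Lemma measurable_ue_loss s : 0 <= s -> measurable_fun setT (ueL s).
Proof.
move=> s0.
pose g (z : (R * (measurableTypeR R * measurableTypeR R)) * measurableTypeR R) :=
  (fq z.2 * (1 - (1 + s * bY z)^-1))%:E.
have mg : measurable_fun setT g.
  have mg' : measurable_fun setT (fun z : R * (R * R) * R => (fq z.2 * (1 - (1 + s * bY z)^-1))%:E).
    apply/measurable_EFinP; apply: measurable_funM; first exact: (measurableT_comp mfq).
    apply: measurable_funB => //; apply: measurable_funV; apply: measurable_funD => //.
    exact: measurable_funM.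
  exact: mg'.
have g0 z : (0 <= g z)%E.
  have h : 0 <= s * bY z by rewrite mulr_ge0.
  by rewrite lee_fin mulr_ge0// subr_ge0 invf_le1 ?lerDl// ltr_wpDr.
have mF := measurable_fun_fubini_tonelli_F (m2 := mu) g mg g0.
have F0 z : (0 <= fubini_F mu g z)%E by apply: integral_ge0 => q _; exact: g0.
exact: (@measurable_integral_product _ _ _ R (measurableTypeR R) (measurableTypeR R) R mu mu _ mF F0).
Qed.

(* The conditional Laplace transform, given [ro = r], of interference plus noise at [z / om2]. *)
Definition cond_laplace z r := expR (- (z / om2 * c r)) *
  (expR (- (lam * fine (bsL (z / om2) r))) * expR (- (lam * fine (ueL (z / om2) r)))).

Lemma measurable_cond_laplace z : 0 <= z -> measurable_fun setT (cond_laplace z).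
Proof.
move=> z0; have s0 : 0 <= z / om2 by rewrite divr_ge0// ltW.
have me (g : R -> R) : measurable_fun setT g -> measurable_fun setT (fun r => expR (- g r)).
  by move=> mg; apply: (measurableT_comp (f := @expR R)) => //; exact: measurable_funN.
have mb : measurable_fun setT (fun r => fine (bsL (z / om2) r)).
  by apply: measurableT_comp => //; exact: measurable_bs_loss.
have mu' : measurable_fun setT (fun r => fine (ueL (z / om2) r)).
  by apply: measurableT_comp => //; exact: measurable_ue_loss.
apply: measurable_funM; first by apply: me; exact: measurable_funM.
by apply: measurable_funM; apply: me; apply: measurable_funM.
Qed.

Lemma cond_laplace01 z r : 0 <= z -> 0 <= cond_laplace z r <= 1.
Proof.
move=> z0; have s0 : 0 <= z / om2 by rewrite divr_ge0// ltW.
have b0 : 0 <= fine (bsL (z / om2) r).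
  rewrite fine_ge0//; apply: integral_ge0 => x _; rewrite lee_fin.
  have h : 0 <= z / om2 * bx (r, x) by rewrite mulr_ge0.
  by rewrite subr_ge0 invf_le1 ?lerDl// ltr_wpDr.
have u0 : 0 <= fine (ueL (z / om2) r).
  rewrite fine_ge0//; apply: integral_ge0 => y _; apply: integral_ge0 => q _; rewrite lee_fin.
  have h : 0 <= z / om2 * bY (r, y, q) by rewrite mulr_ge0.
  by rewrite mulr_ge0// subr_ge0 invf_le1 ?lerDl// ltr_wpDr.
rewrite /cond_laplace -!expRD expR_ge0/= -expR0 ler_expR.
have h1 := mulr_ge0 s0 (c0 r); have h2 := mulr_ge0 (ltW lam0) b0.
have h3 := mulr_ge0 (ltW lam0) u0; lra.
Qed.

Let mI : measurable_fun setT I.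
Proof.
exact: (measurable_interference Psi_PPP Phi_PPP Ry_den hx_den hy_den ho_den mro mbx bx0 mbY bY0).
Qed.

(** Everything is reduced to the finite number E, the mean of 1 - erfc: both sides equal om1 (1 -
    E). Finiteness of E makes the subtraction legitimate and allows [om1] of either sign. *)
Lemma expected_error_rate (e : R -> R) :
  {ae P, forall w, (0 < I w)%E} ->
  (forall s, 0 < s -> {ae P, forall w, bsL s (ro w) \is a fin_num}) ->
  (forall s, 0 < s -> {ae P, forall w, ueL s (ro w) \is a fin_num}) ->
  (forall z, 0 < z -> (\int[P]_w (cond_laplace z (ro w))%:E = (e z)%:E)%E) ->
  (\int[P]_w (om1 * erfc (Num.sqrt (om2 * sinr (ho w) (I w) (c (ro w)))))%:E =
   om1%:E - \int[mu]_(z in `]0%R, +oo[)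
     (om1 * ((Num.sqrt (pi * z))^-1 * expR (- z) * e z))%:E)%E.
Proof.
move=> I0 finx finy eE.
pose u w := erfc (Num.sqrt (om2 * sinr (ho w) (I w) (c (ro w)))).
pose pref z : R := (Num.sqrt (pi * z))^-1 * expR (- z).
pose H z := (\int[P]_w (expR (- (z / om2 * c (ro w))) * elap (z / om2) (I w))%:E)%E.
have Ige0 w : (0 <= I w)%E by exact: interference_ge0.
have [mho _] := ho_den.
have msqrt : measurable_fun setT (@Num.sqrt R).
  by apply: continuous_measurable_fun; exact: sqrt_continuous.
have mcr : measurable_fun setT (fun w => c (ro w)) by exact: measurableT_comp.
have mu1 : measurable_fun setT u.
  apply: (measurableT_comp (@measurable_erfc R)); apply: (measurableT_comp msqrt).
  by apply: measurable_funM => //; apply: measurable_sinr.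
have u01 w : 0 <= 1 - u w <= 1 by apply: erfc_compl01; exact: sqrtr_ge0.
have u0 w : 0 <= u w by exact: erfc_ge0.
have HE z : 0 < z -> H z = (e z)%:E.
  move=> z0; have s0 : 0 < z / om2 by rewrite divr_gt0.
  have mk : measurable_fun setT (fun r => expR (- (z / om2 * c r))).
    by apply: (measurableT_comp (f := @expR R)) => //; apply: measurable_funN; exact: measurable_funM.
  have k01 r : 0 <= expR (- (z / om2 * c r)) <= 1.
    by rewrite expR_ge0/= -expR0 ler_expR oppr_le0 mulr_ge0// ltW.
  have h := laplace_interference lam0 mfq fq0 Psi_PPP Phi_PPP Ry_den hx_den hy_den ho_den mro Find
    mbx bx0 mbY bY0 s0 mk k01 (finx _ s0) (finy _ s0).
  exact: (eq_trans h (eE z z0)).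
have mH : measurable_fun setT H.
  pose h (w : Omega) (z : R) := expR (- (z / om2 * c (ro w))) * elap (z / om2) (I w).
  have h0 (z : Omega * R) : (0 <= (h z.1 z.2)%:E)%E.
    by rewrite lee_fin mulr_ge0 ?expR_ge0// /elap; case: (I z.1) => // r; rewrite expR_ge0.
  have mh : measurable_fun setT (fun z : Omega * R => (h z.1 z.2)%:E).
    have mfs := @measurable_fst _ _ Omega R.
    have mz : measurable_fun setT (fun z : Omega * R => z.2 / om2) by exact: measurable_funM.
    apply/measurable_EFinP; apply: measurable_funM.
      apply: (measurableT_comp (f := @expR R)) => //; apply: measurable_funN; apply: measurable_funM => //.
      exact: (measurableT_comp mcr mfs).
    apply: measurable_elap => //; exact: (measurableT_comp mI mfs).
  exact: (measurable_fun_fubini_tonelli_G (m1 := P) _ mh h0).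
have pref0 z : 0 <= pref z by rewrite mulr_ge0 ?expR_ge0// invr_ge0 sqrtr_ge0.
have mpref : measurable_fun setT pref.
  apply: measurable_funM.
    by apply: measurable_funV; apply: (measurableT_comp msqrt); exact: measurable_funM.
  by apply: (measurableT_comp (f := @expR R)).
have e0 z : 0 < z -> 0 <= e z.
  move=> z0; rewrite -lee_fin -(HE z z0); apply: integral_ge0 => w _.
  by rewrite lee_fin mulr_ge0 ?expR_ge0// /elap; case: (I w) => // r; rewrite expR_ge0.
pose D : set R := `]0%R, +oo[%classic.
have D0 z : D z -> 0 < z by rewrite /D /= in_itv/= andbT.
(* [e] is specified at positive [z] only, so its measurability is borrowed from [H] and holds on
   [D]. *)
have mG : measurable_fun D (fun z => pref z * e z).
  apply: (eq_measurable_fun (fun z => pref z * fine (H z))).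
    by move=> z /set_mem/D0 z0; rewrite HE.
  apply: measurable_funTS; apply: measurable_funM => //.
  exact: measurableT_comp.
pose E := fine (\int[P]_w (1 - u w)%:E)%E.
have EE : (\int[P]_w (1 - u w)%:E = E%:E)%E.
  by apply: integral_unit_fin => //; exact: measurable_funB.
have EG : (\int[mu]_(z in D) (pref z * e z)%:E = E%:E)%E.
  rewrite -EE; apply/esym.
  apply: (eq_trans (transform_fading Psi_PPP Phi_PPP Ry_den hx_den hy_den ho_den mro Find
    mbx bx0 mbY bY0 om20 mc c0 I0)).
  rewrite [RHS]integral_mkcond; apply: eq_integral => z _; rewrite patchE.
  case: ifPn => [/set_mem/D0 z0|].
    by apply: (eq_trans (congr1 (fun t => ((pref z)%:E * t)%E) (HE z z0))); rewrite -EFinM.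
  rewrite notin_setE /D /= in_itv/= andbT => /negP; rewrite -leNgt => z0.
  by rewrite ler0_sqrtr ?invr0 ?mul0r ?mul0e// mulr_ge0_le0// pi_ge0.
have -> : (\int[mu]_(z in `]0%R, +oo[) (om1 * ((Num.sqrt (pi * z))^-1 * expR (- z) * e z))%:E =
    (om1 * E)%:E)%E.
  apply: (@integralZ_real _ _ R mu D (fun z => pref z * e z) om1 E) => //.
  - exact: measurable_itv.
  - by move=> z /D0 z0; rewrite mulr_ge0// e0.
have Eu : (\int[P]_w (u w)%:E = (1 - E)%:E)%E.
  apply: ereal_subr; rewrite -EE -ge0_integralD//.
  - under eq_integral do rewrite -EFinD addrC subrK.
    by apply: (eq_trans (integral_cst P measurableT 1%E)); rewrite mul1e; exact: probability_setT.
  - by move=> w _; rewrite lee_fin.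
  - exact/measurable_EFinP.
  - by move=> w _; rewrite lee_fin; have /andP[] := u01 w.
  - by apply/measurable_EFinP; exact: measurable_funB.
rewrite (@integralZ_real _ _ R P setT u om1 (1 - E))//.
by rewrite -EFinB; congr (_%:E); ring.
Qed.

End error_rate.

Section error_rates.
Context (R : realType) (eta lam rho Pum Pb beta sigma2 om1 om2 : R).
Hypotheses (eta2 : 2 < eta) (lam0 : 0 < lam) (rho0 : 0 < rho) (Pum0 : 0 < Pum) (Pb0 : 0 < Pb).
Hypotheses (beta0 : 0 <= beta) (sigma20 : 0 <= sigma2) (om20 : 0 < om2).
Notation mu := (@lebesgue_measure R).
Let rmx := rmax Pum rho eta.
Let M2 := lower_gamma 2 (pi * lam * rmx ^+ 2) / (pi * lam * (1 - expR (- (pi * lam * rmx ^+ 2)))).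

Let rmx0 : 0 < rmx. Proof. by rewrite powR_gt0// divr_gt0. Qed.
Let eta0 : 0 < eta. Proof. by rewrite (lt_trans _ eta2). Qed.

Lemma EPuE : EPu eta lam rho rmx = rho `^ (2 / eta) * M2.
Proof.
rewrite /EPu /Rintegral.
have mf : measurable_fun setT (fun r : R => r ^+ 2 * fR lam rmx r).
  by apply: measurable_funM; [exact: measurable_funX|exact: measurable_fR].
have f0 r : 0 <= r ^+ 2 * fR lam rmx r by rewrite mulr_ge0 ?sqr_ge0 ?fR_ge0.
have h : (\int[mu]_(r in `[0%R, rmx]) (r ^+ 2 * fR lam rmx r)%:E = M2%:E)%E.
  rewrite -(second_moment lam0 rmx0) integral_mkcond; apply: eq_integral => r _; rewrite patchE.
  case: ifPn => //; rewrite notin_setE/= in_itv/= => h.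
  by rewrite /fR ifN ?mulr0//; exact/negP.
have := @integralZ_real _ _ R mu `[0%R, rmx]%classic _ (rho `^ (2 / eta)) M2 (measurable_itv _)
  (measurable_funTS mf) (fun r _ => f0 r) h.
move=> hZ; rewrite -[RHS]/(fine (_%:E)) -hZ; congr fine.
apply: eq_integral => r; rewrite inE/= in_itv/= => /andP[r0 _]; congr (_%:E).
rewrite powRM ?powR_ge0 ?(ltW rho0)// -powRrM -mulrA; congr (_ * (_ * _)).
by rewrite mulrCA mulfV ?gt_eqF// mulr1 (powR_mulrn 2).
Qed.

Let mpow (a : R) : measurable_fun setT (fun r : R => r `^ a). Proof. exact: measurable_powR. Qed.

Let ae_mark d (Omega : measurableType d) (P : probability Omega R) (X : Omega -> R) :
  has_density P X (fR lam rmx) -> {ae P, forall w, 0 < X w <= rmx}.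
Proof.
move=> XP; apply: filterS (@ae_density _ _ _ P X _ `]0%R, rmx]%classic XP _ _) => [w| |r].
- by rewrite /= in_itv.
- exact: measurable_itv.
- rewrite /= in_itv/= /fR; case: ifPn => // /andP[r0 r1] h.
  have -> : r = 0 by apply/eqP; rewrite eq_le r0 andbT leNgt; apply/negP => r0'; apply: h; rewrite r0' r1.
  by rewrite mulr0 !mul0r.
Qed.

Section uplink.
Variable au : R.
Hypothesis au0 : 0 <= au.
Context d (Omega : measurableType d) (P : probability Omega R).
Variables (Psi Phi : nat -> Omega -> R * R) (Ry hx hy : nat -> Omega -> R) (ho : Omega -> R).
Hypothesis model : ul_model P eta lam rho Pum Psi Phi Ry hx hy ho.

Let bx (z : R * (R * R)) : R := Pb * au * norm2 z.2 `^ (- eta) / rho.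
Let bY (z : R * (R * R) * R) : R := ue_gain eta rho z.1.2 z.2.
Let c (r : R) : R := beta * Pb * au / rho + sigma2 / rho.

Lemma BER_UL_formula :
  (BER_UL P eta rho Pb au beta sigma2 om1 om2 Psi Phi Ry hx hy ho =
   om1%:E - \int[mu]_(z in `]0%R, +oo[)
        (om1 / Num.sqrt (pi * z) *
         expR (- (2 * pi * lam / (eta - 2)) * (z / om2) * rho `^ (- (2 / eta))
                 * EPu eta lam rho rmx * Fhyp eta (- (z / om2))
               - (2 * pi ^+ 2 * lam / eta)
                 * (z * Pb * au / (om2 * rho)) `^ (2 / eta) * csc (2 * pi / eta)
               - z * (1 + beta * Pb * au / (om2 * rho)
                        + sigma2 / (om2 * rho))))%:E)%E.
Proof.
have [PsiP [PhiP [RyD [hxD [hyD [hoD Find]]]]]] := model.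
have mro : measurable_fun setT (fun _ : Omega => 0 : R) by exact: measurable_cst.
have mbx : measurable_fun setT bx.
  apply: measurable_funM => //; apply: measurable_funM => //.
  apply: (measurableT_comp (mpow (- eta))).
  exact: (measurableT_comp (@measurable_norm2 R)).
have bx0 z : 0 <= bx z by rewrite !mulr_ge0 ?powR_ge0 ?(ltW Pb0)// invr_ge0 ltW.
have mbY : measurable_fun setT bY.
  have mp : measurable_fun setT (fun z : R * (R * R) * R => (z.1.2, z.2)).
    apply: measurable_fun_pair => //.
    exact: (measurableT_comp (@measurable_snd _ _ R (R * R)%type)).
  exact: (measurableT_comp (measurable_ue_gain eta rho) mp).
have bY0 z : 0 <= bY z by exact: ue_gain_ge0.
have mc : measurable_fun setT c by exact: measurable_cst.
have c0 r : 0 <= c r by rewrite addr_ge0// divr_ge0 ?mulr_ge0// ltW.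
have hxpos : {ae P, forall w, forall n, 0 < hx n w}.
  by apply: ae_foralln => n; exact: ae_exponential_gt0 (hxD n).
have hypos : {ae P, forall w, forall n, 0 < hy n w}.
  by apply: ae_foralln => n; exact: ae_exponential_gt0 (hyD n).
have Rypos : {ae P, forall w, forall n, 0 < Ry n w <= rmx}.
  by apply: ae_foralln => n; exact: ae_mark (RyD n).
have lossx s r : 0 < s -> bs_loss bx s r = (2 * pi ^+ 2 / eta * (s * Pb * au / rho) `^ (2 / eta) * csc (2 * pi / eta))%:E.
  move=> s0; have s'0 : 0 <= s * Pb * au / rho by rewrite divr_ge0 ?mulr_ge0// ltW.
  rewrite -(integral_sat_plane eta2 s'0); apply: eq_integral => x _; congr (1 - (1 + _)^-1)%:E.
  by rewrite /bx /=; ring.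
have lossy s r : 0 < s -> ue_loss (fR lam rmx) bY s r = (2 * pi * s / (eta - 2) * Fhyp eta (- s) * M2)%:E.
  by move=> s0; exact: (user_loss eta2 lam0 rmx0 rho0 (ltW s0)).
have thE z r : 0 < z -> cond_laplace lam (fR lam rmx) bx bY om2 c z r * expR (- z) =
    expR (- (2 * pi * lam / (eta - 2)) * (z / om2) * rho `^ (- (2 / eta))
                 * EPu eta lam rho rmx * Fhyp eta (- (z / om2))
               - (2 * pi ^+ 2 * lam / eta)
                 * (z * Pb * au / (om2 * rho)) `^ (2 / eta) * csc (2 * pi / eta)
               - z * (1 + beta * Pb * au / (om2 * rho)
                        + sigma2 / (om2 * rho))).
  move=> z0; have s0 : 0 < z / om2 by rewrite divr_gt0.
  rewrite /cond_laplace lossx// lossy//= -!expRD; congr expR; rewrite EPuE.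
  have -> : z * Pb * au / (om2 * rho) = z / om2 * Pb * au / rho.
    by field; rewrite !gt_eqF.
  have rr : rho `^ (- (2 / eta)) * rho `^ (2 / eta) = 1.
    by rewrite -powRD_gt0// addNr powRr0.
  set A := (_ `^ (2 / eta)) in rr |- *.
  rewrite (_ : _ * rho `^ (- (2 / eta)) * (rho `^ (2 / eta) * M2) = - (2 * pi * lam / (eta - 2)) * (z / om2) * M2 * (rho `^ (- (2 / eta)) * rho `^ (2 / eta))); last by ring.
  rewrite rr /c; field.
  by rewrite !gt_eqF ?subr_gt0.
transitivity (\int[P]_w (om1 * erfc (Num.sqrt (om2 * sinr (ho w)
    (interference Psi Phi Ry hx hy (fun=> 0) bx bY w) (c 0))))%:E)%E.
  (* The model sums the fadings themselves and [interference] their absolute values; the two agree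
     where all fadings are positive. *)
  apply: integral_ae; apply: filterS2 hxpos hypos => w hxw hyw.
  suff E : I_u eta rho Pb au Psi Phi Ry hx hy w =
      interference Psi Phi Ry hx hy (fun=> 0) bx bY w by rewrite /SINR_u E.
  rewrite /I_u /interference; congr (_ + _)%E; apply: eq_eseriesr => n _; congr (_%:E).
    by rewrite gtr0_norm// /bx /=; ring.
  rewrite gtr0_norm// /bY /ue_gain /Pmark /=; case: ifPn => _; last by rewrite mul0r.
  by field; rewrite gt_eqF.
rewrite (@expected_error_rate _ Omega R P lam (fR lam rmx) Psi Phi Ry hx hy ho (fun=> 0) lam0
  (measurable_fR lam rmx) (fR_ge0 lam0 rmx0) PsiP PhiP RyD hxD hyD hoD mro Find
  bx bY mbx bx0 mbY bY0 om1 om2 c om20 mc c0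
  (fun z => cond_laplace lam (fR lam rmx) bx bY om2 c z 0)).
- congr (_ - _)%E; apply: eq_integral => z; rewrite inE/= in_itv/= andbT => z0.
  by congr (_%:E); rewrite -(thE z 0 z0); ring.
(* Since [au] may be 0, the positive term must come from a user: one farther than [rmx] is farther
   than its own mark radius and passes the power-control test. *)
- have far := ae_far_point rmx lam0 PhiP.
  apply: filterS3 far Rypos hypos => w [n nfar] Rw hw.
  rewrite /interference; apply: lte_spaddre => //; last first.
    by apply: nneseries_ge0 => m _ _; rewrite lee_fin mulr_ge0.
  apply: nneseries_gt0 => [m|]; first by rewrite mulr_ge0.
  have /andP[q0 q1] := Rw n; have qn := le_lt_trans q1 nfar.
  exists n; rewrite /bY /= (ue_gainE eta2 rho0 q0 (lt_trans q0 qn)) qn.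
  by rewrite !mulr_gt0 ?powR_gt0 ?(lt_trans q0 qn)// normr_gt0 gt_eqF.
- by move=> s s0; apply: aeW => w; rewrite lossx.
- by move=> s s0; apply: aeW => w; rewrite lossy.
(* The uplink is the case of the constant distance 0, for which the conditional transform is already
   the unconditional one. *)
- move=> z z0; apply: (eq_trans (integral_cst P measurableT _)).
  by apply: (eq_trans (congr1 _ (probability_setT P))); rewrite mule1.
Qed.

End uplink.

Section downlink.
Variable ad : R.
Hypothesis ad0 : 0 <= ad.
Context d (Omega : measurableType d) (P : probability Omega R).
Variables (Psi Phi : nat -> Omega -> R * R) (Ry hx hy : nat -> Omega -> R) (ho ro : Omega -> R).
Hypothesis model : dl_model P eta lam rho Pum Psi Phi Ry hx hy ho ro.

Let bx (z : R * (R * R)) : R :=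
  if z.1 < norm2 z.2 then norm2 z.2 `^ (- eta) / z.1 `^ (- eta) else 0.
(** Cross-mode power at level [rho] relative to the desired power Pb r^(-eta). It multiplies the
    normalised gain of every user, so the user loss is evaluated at s kap(r) in place of s. *)
Let kap (r : R) : R := ad * rho / (Pb * r `^ (- eta)).
Let bY (z : R * (R * R) * R) : R := kap z.1.1 * ue_gain eta rho z.1.2 z.2.
Let c (r : R) : R := beta * rho * ad * r `^ (2 * eta) / Pb + sigma2 * r `^ eta / Pb.

Lemma BER_DL_formula :
  (BER_DL P eta rho Pb ad beta sigma2 om1 om2 Psi Phi Ry hx hy ho ro =
   om1%:E - \int[mu]_(z in `]0%R, +oo[) \int[mu]_(r in `[0%R, rmx])
        (om1 * fR lam rmx r / Num.sqrt (pi * z) *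
         expR (- z * (1 + beta * rho * ad * r `^ (2 * eta) / (om2 * Pb)
                        + sigma2 * r `^ eta / (om2 * Pb))
               - 2 * pi * lam * z * ad * EPu eta lam rho rmx * rho `^ (1 - 2 / eta) * r `^ eta
                 / (om2 * (eta - 2) * Pb)
                 * Fhyp eta (- (z * ad * rho * r `^ eta / (om2 * Pb)))
               - 2 * pi * lam * r ^+ 2 * z / ((eta - 2) * om2)
                 * Fhyp eta (- (z / om2))))%:E)%E.
Proof.
have [[PsiP [PhiP [RyD [hxD [hyD [hoD Find]]]]]] roD] := model.
have mro : measurable_fun setT ro by case: roD.
have mn : measurable_fun setT (fun z : R * (R * R) => norm2 z.2).
  exact: (measurableT_comp (@measurable_norm2 R)).
have mbx : measurable_fun setT bx.
  apply: measurable_fun_ifT; [exact: measurable_fun_ltr| |exact: measurable_cst].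
  apply: measurable_funM; first exact: (measurableT_comp (mpow (- eta))).
  by apply: measurable_funV; exact: (measurableT_comp (mpow (- eta))).
have bx0 z : 0 <= bx z by rewrite /bx; case: ifPn => // _; rewrite divr_ge0 ?powR_ge0.
have mkap : measurable_fun setT kap.
  by apply: measurable_funM => //; apply: measurable_funV; exact: measurable_funM.
have kap0 r : 0 <= kap r.
  by rewrite divr_ge0 ?mulr_ge0 ?powR_ge0 ?(ltW rho0) ?(ltW Pb0).
have mbY : measurable_fun setT bY.
  have m1 := @measurable_fst _ _ (R * (R * R))%type R.
  apply: measurable_funM.
    exact: (measurableT_comp mkap (measurableT_comp (@measurable_fst _ _ R (R * R)%type) m1)).
  have mp : measurable_fun setT (fun z : R * (R * R) * R => (z.1.2, z.2)).
    apply: measurable_fun_pair => //.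
    exact: (measurableT_comp (@measurable_snd _ _ R (R * R)%type)).
  exact: (measurableT_comp (measurable_ue_gain eta rho) mp).
have bY0 z : 0 <= bY z by rewrite mulr_ge0// ue_gain_ge0.
have mc : measurable_fun setT c.
  by apply: measurable_funD; apply: measurable_funM => //; apply: measurable_funM.
have c0 r : 0 <= c r.
  by rewrite addr_ge0// divr_ge0 ?(ltW Pb0)// !mulr_ge0 ?powR_ge0 ?(ltW rho0).
have hxpos : {ae P, forall w, forall n, 0 < hx n w}.
  by apply: ae_foralln => n; exact: ae_exponential_gt0 (hxD n).
have hypos : {ae P, forall w, forall n, 0 < hy n w}.
  by apply: ae_foralln => n; exact: ae_exponential_gt0 (hyD n).
have ropos := ae_mark roD.
have lossx s r : 0 < s -> 0 < r -> bs_loss bx s r = (2 * pi * r ^+ 2 * s / (eta - 2) * Fhyp eta (- s))%:E.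
  move=> s0 r0; rewrite -(integral_sat_outside eta2 r0 (ltW s0)).
  apply: eq_integral => x _; congr (_%:E); rewrite /bx /=; case: ifPn => _; last first.
    by rewrite mulr0 addr0 invr1 subrr.
  by rewrite [r `^ (- eta)]powRN invrK [_ * r `^ eta]mulrC.
have kapE r : kap r = ad * rho * r `^ eta / Pb.
  by rewrite /kap powRN invfM invrK; ring.
have lossy s r : 0 < s -> ue_loss (fR lam rmx) bY s r =
    (2 * pi * (s * kap r) / (eta - 2) * Fhyp eta (- (s * kap r)) * M2)%:E.
  move=> s0; rewrite -(user_loss eta2 lam0 rmx0 rho0 (mulr_ge0 (ltW s0) (kap0 r))).
  apply: eq_integral => y _; apply: eq_integral => q _; congr (_ * (1 - (1 + _)^-1))%:E.
  by rewrite /bY /= mulrA.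
pose th := cond_laplace lam (fR lam rmx) bx bY om2 c.
have thE z r : 0 < z -> 0 < r -> th z r * expR (- z) =
    expR (- z * (1 + beta * rho * ad * r `^ (2 * eta) / (om2 * Pb)
                        + sigma2 * r `^ eta / (om2 * Pb))
               - 2 * pi * lam * z * ad * EPu eta lam rho rmx * rho `^ (1 - 2 / eta) * r `^ eta
                 / (om2 * (eta - 2) * Pb)
                 * Fhyp eta (- (z * ad * rho * r `^ eta / (om2 * Pb)))
               - 2 * pi * lam * r ^+ 2 * z / ((eta - 2) * om2)
                 * Fhyp eta (- (z / om2))).
  move=> z0 r0; have s0 : 0 < z / om2 by rewrite divr_gt0.
  rewrite /th /cond_laplace lossx// lossy//= -!expRD; congr expR; rewrite EPuE.
  have -> : z * ad * rho * r `^ eta / (om2 * Pb) = z / om2 * kap r.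
    by rewrite kapE; field; rewrite !gt_eqF.
  have rr : rho `^ (2 / eta) * rho `^ (1 - 2 / eta) = rho.
    rewrite -powRD_gt0// (_ : 2 / eta + (1 - 2 / eta) = 1); last by ring.
    by rewrite powRr1// ltW.
  set Fk := Fhyp eta (- (z / om2 * kap r)).
  rewrite (_ : 2 * pi * lam * z * ad * (rho `^ (2 / eta) * M2) * rho `^ (1 - 2 / eta) =
    2 * pi * lam * z * ad * M2 * (rho `^ (2 / eta) * rho `^ (1 - 2 / eta))); last by ring.
  rewrite rr /c kapE; field.
  by rewrite !gt_eqF ?subr_gt0.
have mth z : 0 < z -> measurable_fun setT (th z).
  by move=> z0; exact: (measurable_cond_laplace lam (measurable_fR lam rmx) (fR_ge0 lam0 rmx0) mbx bx0 mbY bY0 om20 mc (ltW z0)).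
have th01 z r : 0 < z -> 0 <= th z r <= 1.
  by move=> z0; exact: (cond_laplace01 lam0 (fR_ge0 lam0 rmx0) bx0 bY0 om20 c0 r (ltW z0)).
pose e z := fine (\int[P]_w (th z (ro w))%:E)%E.
have eE z : 0 < z -> (\int[P]_w (th z (ro w))%:E = (e z)%:E)%E.
  move=> z0; apply: integral_unit_fin; first exact: (measurableT_comp (mth z z0)).
  by move=> w; exact: th01.
have eR z : 0 < z -> (\int[mu]_(r in `[0%R, rmx]) (fR lam rmx r * th z r)%:E = (e z)%:E)%E.
  move=> z0; apply: (eq_trans _ (eE z z0)).
  have h := expectation_density (f := fun r => (th z r)%:E) roD (measurable_fR lam rmx) (fR_ge0 lam0 rmx0).
  apply/esym/(eq_trans (h _ _)).
  - by apply/measurable_EFinP; exact: mth.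
  - by move=> r; rewrite lee_fin; have /andP[] := th01 z r z0.
  rewrite [RHS]integral_mkcond; apply: eq_integral => r _; rewrite patchE.
  case: ifPn => [_|]; first by rewrite EFinM muleC.
  rewrite notin_setE/= in_itv/= => hr.
  by rewrite /fR ifN ?mule0//; exact/negP.
transitivity (\int[P]_w (om1 * erfc (Num.sqrt (om2 * sinr (ho w)
    (interference Psi Phi Ry hx hy ro bx bY w) (c (ro w)))))%:E)%E.
  apply: integral_ae; apply: filterS2 hxpos hypos => w hxw hyw.
  suff E : I_d eta rho Pb ad Psi Phi Ry hx hy ro w =
      interference Psi Phi Ry hx hy ro bx bY w by rewrite /SINR_d E.
  rewrite /I_d /interference; congr (_ + _)%E; apply: eq_eseriesr => n _; congr (_%:E).
    rewrite gtr0_norm// /bx /=; case: ifPn => _; last by rewrite mul0r.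
    by ring.
  rewrite gtr0_norm// /bY /ue_gain /Pmark /=; case: ifPn => _; last by rewrite mulr0 mul0r.
  by rewrite /kap; ring.
rewrite (@expected_error_rate _ Omega R P lam (fR lam rmx) Psi Phi Ry hx hy ho ro lam0
  (measurable_fR lam rmx) (fR_ge0 lam0 rmx0) PsiP PhiP RyD hxD hyD hoD mro Find
  bx bY mbx bx0 mbY bY0 om1 om2 c om20 mc c0 e).
- congr (_ - _)%E; apply: eq_integral => z; rewrite inE/= in_itv/= andbT => z0.
  rewrite mulrA -(@integralZ_real _ _ R mu `[0%R, rmx]%classic (fun r => fR lam rmx r * th z r)
    (om1 * ((Num.sqrt (pi * z))^-1 * expR (- z))) (e z)); last 4 first.
  + exact: measurable_itv.
  + apply: measurable_funTS; apply: measurable_funM; [exact: measurable_fR|exact: mth].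
  + by move=> r _; rewrite mulr_ge0 ?fR_ge0//; have /andP[] := th01 z r z0.
  + exact: eR.
  apply: eq_integral => r; rewrite inE/= in_itv/= => /andP[r0 r1]; congr (_%:E).
  (* At r = 0 the density [fR] vanishes and both integrands are 0, so [thE] is invoked for positive
     [r] only. *)
  move: r0; rewrite le_eqVlt => /orP[/eqP <-|r0].
    by rewrite /fR mulr0 !mul0r if_same mulr0 !mul0r mulr0.
  by rewrite -thE//; ring.
(* Since [ad] may be 0, the positive term must come from a base station: one farther than [rmx],
   hence farther than [ro], is an interferer. *)
- have far := ae_far_point rmx lam0 PsiP.
  apply: filterS3 far ropos hxpos => w [n nfar] /andP[r0 r1] hw.
  rewrite /interference addeC; apply: lte_spaddre => //; last first.
    by apply: nneseries_ge0 => m _ _; rewrite lee_fin mulr_ge0.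
  apply: nneseries_gt0 => [m|]; first by rewrite mulr_ge0.
  have rn := le_lt_trans r1 nfar.
  exists n; rewrite /bx /= rn.
  by rewrite !mulr_gt0 ?invr_gt0 ?powR_gt0 ?(lt_trans r0 rn)// normr_gt0 gt_eqF.
- by move=> s s0; apply: filterS ropos => w /andP[r0 _]; rewrite lossx.
- by move=> s s0; apply: aeW => w; rewrite lossy.
- exact: eE.
Qed.

End downlink.
End error_rates.

Theorem theorem1 (R : realType)
  (eta lam rho Pum Pb beta sigma2 om1 om2 au ad : R) :
  2 < eta -> 0 < lam -> 0 < rho -> 0 < Pum -> 0 < Pb -> 0 <= beta ->
  0 <= sigma2 -> 0 < om2 -> 0 <= au -> 0 <= ad ->
  let rmx := rmax Pum rho eta in
  let EP := EPu eta lam rho rmx in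
  (* closed form of E[P_u^(2/eta)] *)
  EP = rho `^ (2 / eta) * lower_gamma 2 (pi * lam * rmx ^+ 2) /
         (pi * lam * (1 - expR (- (pi * lam * rmx ^+ 2))))
  /\
  (* uplink *)
  (forall (d : measure_display) (Omega : measurableType d)
          (P : probability Omega R)
          (Psi Phi : nat -> Omega -> R * R) (Ry hx hy : nat -> Omega -> R)
          (ho : Omega -> R),
     ul_model P eta lam rho Pum Psi Phi Ry hx hy ho ->
     BER_UL P eta rho Pb au beta sigma2 om1 om2 Psi Phi Ry hx hy ho =
     (om1%:E - \int[@lebesgue_measure R]_(z in `]0%R, +oo[)
        (om1 / Num.sqrt (pi * z) *
         expR (- (2 * pi * lam / (eta - 2)) * (z / om2) * rho `^ (- (2 / eta))
                 * EP * Fhyp eta (- (z / om2))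
               - (2 * pi ^+ 2 * lam / eta)
                 * (z * Pb * au / (om2 * rho)) `^ (2 / eta) * csc (2 * pi / eta)
               - z * (1 + beta * Pb * au / (om2 * rho)
                        + sigma2 / (om2 * rho))))%:E)%E)
  /\
  (* downlink *)
  (forall (d : measure_display) (Omega : measurableType d)
          (P : probability Omega R)
          (Psi Phi : nat -> Omega -> R * R) (Ry hx hy : nat -> Omega -> R)
          (ho ro : Omega -> R),
     dl_model P eta lam rho Pum Psi Phi Ry hx hy ho ro ->
     BER_DL P eta rho Pb ad beta sigma2 om1 om2 Psi Phi Ry hx hy ho ro =
     (om1%:E - \int[@lebesgue_measure R]_(z in `]0%R, +oo[)
        \int[@lebesgue_measure R]_(r in `[0%R, rmx])
        (om1 * fR lam rmx r / Num.sqrt (pi * z) *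
         expR (- z * (1 + beta * rho * ad * r `^ (2 * eta) / (om2 * Pb)
                        + sigma2 * r `^ eta / (om2 * Pb))
               - 2 * pi * lam * z * ad * EP * rho `^ (1 - 2 / eta) * r `^ eta
                 / (om2 * (eta - 2) * Pb)
                 * Fhyp eta (- (z * ad * rho * r `^ eta / (om2 * Pb)))
               - 2 * pi * lam * r ^+ 2 * z / ((eta - 2) * om2)
                 * Fhyp eta (- (z / om2))))%:E)%E).
Proof.
move=> eta2 lam0 rho0 Pum0 Pb0 beta0 sigma20 om20 au0 ad0 rmx EP.
have EPE : EP = _ := EPuE eta2 lam0 rho0 Pum0.
split; first by rewrite EPE mulrA.
split=> [d Omega P Psi Phi Ry hx hy ho|d Omega P Psi Phi Ry hx hy ho ro] model.
  exact: BER_UL_formula.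
exact: BER_DL_formula.
Qed.
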